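(* Let $\rho\in\mathcal{C}^\infty_c(\mathbb{R}^n)$ with $\int_{\mathbb{R}^n}\rho(y)\,dy=1$, and write $\rho_{t}(x)=t^{-n}\rho(x/t)$ for $t>0$. (i) If $T$ is a basic functional of $\mathcal{L}(\mathcal{G}_c(\mathbb{R}^n),\widetilde{\mathbb{C}})$ then $[(\rho_{\varepsilon^q})_\varepsilon]\ast T\in\mathcal{G}(\mathbb{R}^n)$ for all $q\in\mathbb{N}$ and $[(\rho_{\varepsilon^q})_\varepsilon]\ast T\to T$ in $\mathcal{L}(\mathcal{G}_c(\mathbb{R}^n),\widetilde{\mathbb{C}})$ as $q\to\infty$. (ii) If $T$ is a basic functional of $\mathcal{L}(\mathcal{G}(\mathbb{R}^n),\widetilde{\mathbb{C}})$ then $[(\rho_{\varepsilon^q})_\varepsilon]\ast T\to T$ in $\mathcal{L}(\mathcal{G}(\mathbb{R}^n),\widetilde{\mathbb{C}})$ as $q\to\infty$. (iii) If $T$ is a basic functional of $\mathcal{L}(\mathcal{G}_{\mathscr{S}}(\mathbb{R}^n),\widetilde{\mathbb{C}})$ then $[(\rho_{\varepsilon^q})_\varepsilon]\ast T\to T$ in $\mathcal{L}(\mathcal{G}_{\mathscr{S}}(\mathbb{R}^n),\widetilde{\mathbb{C}})$ as $q\to\infty$.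
   Context: **Spaces.** Nets are indexed by $\varepsilon\in(0,1]$; $[(\cdot)_\varepsilon]$ denotes the class of a net; $O$-estimates are as $\varepsilon\to 0$; $K\Subset\mathbb{R}^n$ means compact. $\widetilde{\mathbb{C}}$ is the ring of nets in $\mathbb{C}$ that are $O(\varepsilon^{-N})$ for some $N\in\mathbb{N}$, modulo nets that are $O(\varepsilon^q)$ for all $q\in\mathbb{N}$; $|z|_{\mathrm{e}}:=e^{-\mathrm{v}(z)}$ with $\mathrm{v}(z)=\sup\{b\in\mathbb{R}:|z_\varepsilon|=O(\varepsilon^b)\}$. An ultra-pseudo-seminorm on a $\widetilde{\mathbb{C}}$-module is a map $P$ into $[0,\infty)$ with $P(0)=0$, $P(\lambda u)\le|\lambda|_{\mathrm{e}}P(u)$, $P(u+v)\le\max(P(u),P(v))$; families of these define the locally convex $\widetilde{\mathbb{C}}$-linear topologies; a set is bounded if every continuous ultra-pseudo-seminorm is bounded on it. $\mathcal{G}(\mathbb{R}^n)$: nets in $\mathcal{C}^\infty(\mathbb{R}^n)$ with $\forall K\,\forall\alpha\,\exists N$: $\sup_K|\partial^\alpha u_\varepsilon|=O(\varepsilon^{-N})$, modulo those with $\forall K\,\forall\alpha\,\forall q$: $\sup_K|\partial^\alpha u_\varepsilon|=O(\varepsilon^q)$; topologized by $\mathcal{P}_{K,i}(u)=\exp(-\sup\{b:\sup_{x\in K,|\alpha|\le i}|\partial^\alpha u_\varepsilon(x)|=O(\varepsilon^b)\})$. $\mathcal{G}_c(\mathbb{R}^n)$: compactly supported elements of $\mathcal{G}(\mathbb{R}^n)$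 (represented by nets with supports in a common compact set); it is the strict inductive limit (finest locally convex $\widetilde{\mathbb{C}}$-linear topology making inclusions continuous) of the spaces $\mathcal{G}_K(\mathbb{R}^n)$ of elements with support in $K$, each topologized by $\mathcal{P}_{K',i}$, $i\in\mathbb{N}$, with $K'$ any compact set containing $K$ in its interior. $\mathcal{G}_{\mathscr{S}}(\mathbb{R}^n)$: nets in $\mathscr{S}(\mathbb{R}^n)$ with $\forall h\,\exists N$: $p_h(u_\varepsilon)=O(\varepsilon^{-N})$, modulo those with $\forall h\,\forall q$: $p_h(u_\varepsilon)=O(\varepsilon^q)$, where $p_h(f)=\sup_{x,|\alpha|\le h}(1+|x|)^h|\partial^\alpha f(x)|$; topologized by $\mathcal{P}_h(u)=\exp(-\sup\{b:p_h(u_\varepsilon)=O(\varepsilon^b)\})$. $\mathcal{G}_\tau(\mathbb{R}^n)$: nets in $\mathcal{O}_M(\mathbb{R}^n)$ with $\forall\alpha\,\exists N$: $\sup_x(1+|x|)^{-N}|\partial^\alpha u_\varepsilon(x)|=O(\varepsilon^{-N})$, modulo those with $\forall\alpha\,\exists N\,\forall q$: $\sup_x(1+|x|)^{-N}|\partial^\alpha u_\varepsilon(x)|=O(\varepsilon^q)$. **Duals.** $\mathcal{L}(\cdot,\widetilde{\mathbb{C}})$ is the set of continuous $\widetilde{\mathbb{C}}$-linear functionals with the topology of uniform convergence on bounded subsets, given by $\mathcal{P}_B(T)=\sup_{u\in B}|Tu|_{\mathrm{e}}$, $B$ bounded. The spaces $\mathcal{G}(\mathbb{R}^n)$, $\mathcal{G}_c(\mathbb{R}^n)$,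 $\mathcal{G}_\tau(\mathbb{R}^n)$ are embedded in $\mathcal{L}(\mathcal{G}_c(\mathbb{R}^n),\widetilde{\mathbb{C}})$, $\mathcal{L}(\mathcal{G}(\mathbb{R}^n),\widetilde{\mathbb{C}})$, $\mathcal{L}(\mathcal{G}_{\mathscr{S}}(\mathbb{R}^n),\widetilde{\mathbb{C}})$ respectively via $u\mapsto(v\mapsto\int uv\,dx)$. **Basic functionals.** $T$ is basic if $Tu=[(T_\varepsilon u_\varepsilon)_\varepsilon]$ for all $u$, where: for $\mathcal{L}(\mathcal{G}_c(\mathbb{R}^n),\widetilde{\mathbb{C}})$, $T_\varepsilon\in\mathcal{D}'(\mathbb{R}^n)$ and $\forall K\,\exists j,N\,\exists\eta\in(0,1]\,\forall u\in\mathcal{D}_K(\mathbb{R}^n)\,\forall\varepsilon\in(0,\eta]$: $|T_\varepsilon(u)|\le\varepsilon^{-N}\sup_{x\in K,|\alpha|\le j}|\partial^\alpha u(x)|$; for $\mathcal{L}(\mathcal{G}(\mathbb{R}^n),\widetilde{\mathbb{C}})$, $T_\varepsilon\in\mathcal{E}'(\mathbb{R}^n)$ and $\exists K\,\exists j,N\,\exists\eta\,\forall u\in\mathcal{C}^\infty(\mathbb{R}^n)\,\forall\varepsilon\in(0,\eta]$: the same estimate; for $\mathcal{L}(\mathcal{G}_{\mathscr{S}}(\mathbb{R}^n),\widetilde{\mathbb{C}})$, $T_\varepsilon\in\mathscr{S}'(\mathbb{R}^n)$ and $\exists j,N\,\exists\eta\,\forall u\in\mathscr{S}(\mathbb{R}^n)\,\forall\varepsilon\in(0,\eta]$: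 $|T_\varepsilon(u)|\le\varepsilon^{-N}\sup_{y,|\beta|\le j}(1+|y|)^j|\partial^\beta u(y)|$. **Convolution.** For $u\in\mathcal{G}_c(\mathbb{R}^n)$ and $T$ basic in $\mathcal{L}(\mathcal{G}_c(\mathbb{R}^n),\widetilde{\mathbb{C}})$ (or $u\in\mathcal{G}(\mathbb{R}^n)$ and $T$ basic in $\mathcal{L}(\mathcal{G}(\mathbb{R}^n),\widetilde{\mathbb{C}})$, or $u\in\mathcal{G}_{\mathscr{S}}(\mathbb{R}^n)$ and $T$ basic in $\mathcal{L}(\mathcal{G}_{\mathscr{S}}(\mathbb{R}^n),\widetilde{\mathbb{C}})$), $u\ast T$ is the class of $x\mapsto T_\varepsilon(u_\varepsilon(x-\cdot))$, in $\mathcal{G}(\mathbb{R}^n)$ (resp. $\mathcal{G}(\mathbb{R}^n)$, resp. $\mathcal{G}_\tau(\mathbb{R}^n)$). If $u\in\mathcal{G}_c(\mathbb{R}^n)$ and $T$ is basic in $\mathcal{L}(\mathcal{G}(\mathbb{R}^n),\widetilde{\mathbb{C}})$ then $u\ast T\in\mathcal{G}_c(\mathbb{R}^n)$. *)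

(* Defs.v *)
From HB Require Import structures.
From mathcomp Require Import all_boot all_order all_algebra.
From mathcomp Require Import generic_quotient ring_quotient.
From mathcomp Require Import all_classical all_reals all_analysis.
From mathcomp Require Import complex.

Set Implicit Arguments.
Unset Strict Implicit.
Unset Printing Implicit Defensive.

Import Order.TTheory GRing.Theory Num.Theory.
Import numFieldNormedType.Exports.
Import Normc.

Local Open Scope classical_set_scope.
Local Open Scope complex_scope.
Local Open Scope ring_scope.

(* The index set ]0, 1] of the nets. *)
Definition eps01 (R : realType) := {e : R | 0 < e <= 1}.

Section Asymptotics.
Context {R : realType}.
Local Notation I := (eps01 R).

(* [f e = O(e ^ b)] as [e -> 0], for [f] with values in [0, +oo]. *)
Definition Oeps (f : I -> \bar R) (b : R) : Prop :=
  exists C eta : R, 0 < eta /\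
    forall e : I, val e <= eta -> (f e <= (C * val e `^ b)%:E)%E.

Definition valuation (f : I -> \bar R) : \bar R :=
  ereal_sup [set b%:E | b in [set b | Oeps f b]].

(* [exp (- v)], with [exp (- oo) = 0]; [v = -oo] does not occur for moderate
   nets. *)
Definition expval (f : I -> \bar R) : R := fine (expeR (- valuation f)).

End Asymptotics.

Definition snet (R : realType) := eps01 R -> R[i].

Section Scalars.
Context {R : realType}.
Local Notation I := (eps01 R).

Definition snorm (z : snet R) : I -> \bar R := fun e => (normc (z e))%:E.

Definition smoderate : set (snet R) :=
  [set z | exists N : nat, Oeps (snorm z) (- N%:R)].

Definition snegligible : set (snet R) :=
  [set z | forall q : nat, Oeps (snorm z) q%:R].

Lemma eps_gt0 (e : I) : 0 < val e.
Proof. by case: e => e /= /andP[]. Qed.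

Lemma eps_le1 (e : I) : val e <= 1.
Proof. by case: e => e /= /andP[]. Qed.

Lemma normc_ge0 (z : R[i]) : 0 <= normc z.
Proof. by case: z => a b; exact: sqrtr_ge0. Qed.

Lemma OepsW (f : I -> \bar R) (b : R) : Oeps f b ->
  exists C eta : R, [/\ 0 < eta, 0 <= C &
    forall e : I, val e <= eta -> (f e <= (C * val e `^ b)%:E)%E].
Proof.
move=> [C [eta [eta0 H]]]; exists (Num.max C 0), eta; split => //.
  by rewrite le_max lexx orbT.
move=> e /H /le_trans; apply; rewrite lee_fin ler_wpM2r ?powR_ge0//.
by rewrite le_max lexx.
Qed.

Lemma Oeps_mono (f g : I -> \bar R) (a b : R) : b <= a ->
  (forall e, (g e <= f e)%E) -> Oeps f a -> Oeps g b.
Proof.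
move=> ba gf /OepsW[C [eta [eta0 C0 H]]]; exists C, eta; split => // e /H fe.
apply: (le_trans (gf e)); apply: (le_trans fe); rewrite lee_fin ler_wpM2l//.
have /andP[e0 e1] := valP e.
by apply: ger_powR => //; rewrite e0.
Qed.


Lemma Oeps2 (f g h : I -> \bar R) (a b c : R) (op : R -> R -> R) :
  (forall e, forall A B : R, 0 <= A -> 0 <= B ->
    (f e <= A%:E)%E -> (g e <= B%:E)%E -> (h e <= (op A B)%:E)%E) ->
  (forall A B : R, 0 <= A -> 0 <= B -> exists C : R, forall e : I,
    op (A * val e `^ a) (B * val e `^ b) <= C * val e `^ c) ->
  Oeps f a -> Oeps g b -> Oeps h c.
Proof.
move=> H1 H2 /OepsW[A [ea [ea0 A0 HA]]] /OepsW[B [eb [eb0 B0 HB]]].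
have [C HC] := H2 A B A0 B0.
exists C, (Num.min ea eb); split; first by rewrite lt_min ea0.
move=> e; rewrite le_min => /andP[/HA fe /HB ge].
apply: (@le_trans _ _ (op (A * val e `^ a) (B * val e `^ b))%:E).
  by apply: H1; rewrite ?mulr_ge0 ?powR_ge0.
by rewrite lee_fin.
Qed.

Lemma OepsD (f g h : I -> \bar R) (b : R) :
  (forall e, forall A B : R, 0 <= A -> 0 <= B ->
    (f e <= A%:E)%E -> (g e <= B%:E)%E -> (h e <= (A + B)%:E)%E) ->
  Oeps f b -> Oeps g b -> Oeps h b.
Proof.
move=> H; apply: (Oeps2 (op := +%R)) => // A B _ _.
by exists (A + B) => e; rewrite mulrDl.
Qed.

Lemma OepsM (f g h : I -> \bar R) (a b : R) :
  (forall e, forall A B : R, 0 <= A -> 0 <= B ->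
    (f e <= A%:E)%E -> (g e <= B%:E)%E -> (h e <= (A * B)%:E)%E) ->
  Oeps f a -> Oeps g b -> Oeps h (a + b).
Proof.
move=> H; apply: (Oeps2 (op := *%R)) => // A B _ _.
exists (A * B) => e; rewrite powRD; first by rewrite mulrACA.
by rewrite (lt0r_neq0 (eps_gt0 e)) implybT.
Qed.

Lemma le_normcD (x y : R[i]) : normc (x + y) <= normc x + normc y.
Proof. exact: (@complex.le_normcD R). Qed.

Lemma normcN (x : R[i]) : normc (- x) = normc x.
Proof. exact: (@complex.normcN R). Qed.

Lemma snormD (y z : snet R) (b : R) :
  Oeps (snorm y) b -> Oeps (snorm z) b -> Oeps (snorm (y + z)) b.
Proof.
apply: OepsD => e A B _ _; rewrite !lee_fin => yA zB.
exact: le_trans (le_normcD _ _) (lerD yA zB).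
Qed.

Lemma snormM (y z : snet R) (a b : R) :
  Oeps (snorm y) a -> Oeps (snorm z) b -> Oeps (snorm (y * z)) (a + b).
Proof.
apply: OepsM => e A B A0 _; rewrite !lee_fin => yA zB.
by rewrite normcM ler_pM ?normc_ge0.
Qed.

Lemma smoderateD (y z : snet R) :
  smoderate y -> smoderate z -> smoderate (y + z).
Proof.
move=> [N HN] [M HM]; exists (maxn N M); apply: snormD.
  by apply: Oeps_mono HN => //; rewrite lerN2 ler_nat leq_maxl.
by apply: Oeps_mono HM => //; rewrite lerN2 ler_nat leq_maxr.
Qed.

Lemma smoderateM (y z : snet R) :
  smoderate y -> smoderate z -> smoderate (y * z).
Proof.
move=> [N HN] [M HM]; exists (N + M)%N; rewrite natrD opprD.
exact: snormM.
Qed.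

Lemma smoderateN (y : snet R) : smoderate y -> smoderate (- y).
Proof.
move=> [N HN]; exists N; apply: Oeps_mono HN => // e.
by rewrite /snorm lee_fin normcN.
Qed.

Lemma smoderate1 : smoderate 1.
Proof.
exists 0%N, 1, 1; split => // e _.
by rewrite /snorm lee_fin mulr0n oppr0 powRr0 mulr1 normc1.
Qed.

Lemma snegligible0 : snegligible 0.
Proof.
move=> q; exists 0, 1; split => // e _.
by rewrite /snorm lee_fin mul0r normc0.
Qed.

Lemma snegligibleB (y z : snet R) :
  snegligible y -> snegligible z -> snegligible (y - z).
Proof.
move=> Hy Hz q; apply: snormD => //; apply: Oeps_mono (Hz q) => // e.
by rewrite /snorm lee_fin normcN.
Qed.

Lemma snegligibleM (y z : snet R) :
  smoderate y -> snegligible z -> snegligible (y * z).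
Proof.
move=> [N Hy] Hz q.
have := snormM Hy (Hz (N + q)%N); apply: Oeps_mono => //.
by rewrite natrD addKr.
Qed.

Lemma snegligible1 : ~ snegligible 1.
Proof.
move=> /(_ 1%N)/OepsW[C [eta [eta0 C0 H]]].
pose x := Num.min 1 (Num.min eta ((C + 1)^-1 / 2)).
have C1 : 0 < C + 1 by rewrite ltr_wpDl.
have x0 : 0 < x.
  by rewrite !lt_min ltr01 eta0 divr_gt0 ?invr_gt0.
have x01 : 0 < x <= 1 by rewrite x0 ge_min lexx.
have /H : val (exist _ x x01 : I) <= eta by rewrite /= !ge_min lexx orbT.
rewrite /snorm lee_fin normc1 /= powRr1 ?(ltW x0)//.
apply/negP; rewrite -ltNge.
have xC : x <= (C + 1)^-1 / 2 by rewrite !ge_min lexx !orbT.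
apply: (@le_lt_trans _ _ ((C + 1) * ((C + 1)^-1 / 2))).
  by apply: ler_pM => //; rewrite ?ltW// ltrDl.
by rewrite mulrA divff ?gt_eqF// mul1r invf_lt1// ltr1n.
Qed.

End Scalars.

Arguments smoderate {R}.
Arguments snegligible {R}.

(* The ring of generalized complex numbers: the moderate nets modulo the ideal
   of negligible ones. *)
Section GeneralizedNumbers.
Variable R : realType.

Definition smod_pred : {pred snet R} := mem (@smoderate R).

Fact smod_subring : subring_closed smod_pred.
Proof.
split=> [|y z|y z]; rewrite !inE.
- exact: smoderate1.
- by move=> ? /smoderateN; exact: smoderateD.
- exact: smoderateM.
Qed.

HB.instance Definition _ :=
  GRing.isSubringClosed.Build (snet R) smod_pred smod_subring.

Record mscal := MScal { mscal_val :> snet R; _ : mscal_val \in smod_pred }.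

HB.instance Definition _ := [isSub for mscal_val].
HB.instance Definition _ := [Choice of mscal by <:].
HB.instance Definition _ :=
  GRing.SubChoice_isSubComPzRing.Build (snet R) smod_pred mscal
    (GRing.subringClosedP _).

Fact mscal_oner_neq0 : (1 : mscal) != 0.
Proof.
apply/eqP => /(congr1 val); rewrite rmorph1 raddf0 => h.
by apply: (@snegligible1 R); rewrite h; exact: snegligible0.
Qed.

HB.instance Definition _ := GRing.PzSemiRing_isNonZero.Build mscal
  mscal_oner_neq0.

Definition sneg_pred : {pred mscal} := [pred z | `[< snegligible (val z) >]].

Fact sneg_idealr : idealr_closed sneg_pred.
Proof.
split.
- by apply/asboolP; exact: snegligible0.
- by apply/asboolPn; exact: snegligible1.
- move=> a u v /asboolP Hu /asboolP Hv; apply/asboolP.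
  have -> : val (a * u + v) = val a * val u - (0 - val v).
    by rewrite sub0r opprK.
  apply: snegligibleB; last by apply: snegligibleB => //; exact: snegligible0.
  by apply: snegligibleM => //; have := valP a; rewrite inE.
Qed.

HB.instance Definition _ := isIdealr.Build mscal sneg_pred sneg_idealr.

Definition Ct := {ideal_quot sneg_pred}.

HB.instance Definition _ := GRing.ComNzRing.on Ct.
HB.instance Definition _ := Quotient.on Ct.

End GeneralizedNumbers.

Section SmoothFunctions.
Context {R : realType} {n : nat}.
Local Notation Rn := 'rV[R]_n.
Implicit Types (g h : Rn -> R) (f : Rn -> R[i]) (x y : Rn).

Definition pderiv (i : 'I_n) g : Rn -> R :=
  fun x => 'D_(delta_mx 0 i : Rn) g x.

(* All partial derivatives, of any order and in any order of differentiation,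
   exist and are continuous. *)
Definition rsmooth g : Prop := forall s : seq 'I_n,
  let gs := foldr pderiv g s in
  continuous gs /\ forall i x, derivable gs x (delta_mx 0 i : Rn).

Definition multi_index := {ffun 'I_n -> nat}.

Definition mlength (a : multi_index) : nat := (\sum_i a i)%N.

Definition rpartial (a : multi_index) g : Rn -> R :=
  foldr (fun i k => iter (a i) (pderiv i) k) g (enum 'I_n).

Definition smooth f : Prop :=
  rsmooth (fun x => complex.Re (f x)) /\ rsmooth (fun x => complex.Im (f x)).

Definition partial (a : multi_index) f : Rn -> R[i] := fun x =>
  rpartial a (fun y => complex.Re (f y)) x +i*
  rpartial a (fun y => complex.Im (f y)) x.

Definition enorm x : R := Num.sqrt (\sum_i x 0 i ^+ 2).

(* [sup {w x * |partial a f x| : x in A, a in D}], taken in [0, +oo]: it may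
   be infinite, and the supremum over the empty set is [0]. *)
Definition wsup (w : Rn -> R) (A : set Rn) (D : set multi_index) f : \bar R :=
  ereal_sup [set r | r = 0%E \/
    exists x a, [/\ A x, D a & r = (w x * normc (partial a f x))%:E]].

Definition upto (k : nat) : set multi_index := [set a | (mlength a <= k)%N].

Definition sup_on (K : set Rn) (a : multi_index) : (Rn -> R[i]) -> \bar R :=
  wsup (fun=> 1) K [set a].

Definition sup_upto (K : set Rn) (k : nat) : (Rn -> R[i]) -> \bar R :=
  wsup (fun=> 1) K (upto k).

Definition schwartz_norm (k : nat) : (Rn -> R[i]) -> \bar R :=
  wsup (fun x => (1 + enorm x) ^+ k) setT (upto k).

Definition slow_norm (N : nat) (a : multi_index) : (Rn -> R[i]) -> \bar R :=
  wsup (fun x => (1 + enorm x) ^- N) setT [set a].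

Definition schwartz f : Prop :=
  smooth f /\ forall k, (schwartz_norm k f < +oo)%E.

Definition slowly_increasing f : Prop :=
  smooth f /\ forall a, exists N, (slow_norm N a f < +oo)%E.

Definition fsupport f : set Rn := closure [set x | f x != 0].

Definition test_function f : Prop := smooth f /\ compact (fsupport f).

Lemma rsmooth_lin g h (c d : R) : rsmooth g -> rsmooth h ->
  forall s : seq 'I_n,
  foldr pderiv (fun x => c * g x + d * h x) s =
  (fun x => c * foldr pderiv g s x + d * foldr pderiv h s x).
Proof.
move=> sg sh; elim => [//|i s IH] /=.
rewrite IH; apply/funext => x; rewrite /pderiv.
have [_ /(_ i x) dg] := sg s.
have [_ /(_ i x) dh] := sh s.
rewrite (@deriveD _ _ _ (c \*: foldr pderiv g s) (d \*: foldr pderiv h s)).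
- by rewrite !deriveZ.
- exact: derivableZ.
- exact: derivableZ.
Qed.

Lemma rsmoothP g h (c d : R) : rsmooth g -> rsmooth h ->
  rsmooth (fun x => c * g x + d * h x).
Proof.
move=> sg sh s /=; rewrite rsmooth_lin//.
have [cg dg] := sg s.
have [ch dh] := sh s.
split=> [x|i x].
  exact: (cvgD (cvgM (cvg_cst _) (cg x)) (cvgM (cvg_cst _) (ch x))).
by apply: (@derivableD _ _ _ (c \*: foldr pderiv g s) (d \*: foldr pderiv h s));
  apply: derivableZ.
Qed.

Definition word (a : multi_index) : seq 'I_n :=
  flatten [seq nseq (a i) i | i <- enum 'I_n].

Lemma rpartialE (a : multi_index) g : rpartial a g = foldr pderiv g (word a).
Proof.
rewrite /rpartial /word; elim: (enum 'I_n) => [//|i s IH] /=.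
rewrite foldr_cat -IH; elim: (a i) => [//|m IHm] /=.
by rewrite IHm.
Qed.

Lemma rpartial_lin (a : multi_index) g h (c d : R) :
  rsmooth g -> rsmooth h ->
  rpartial a (fun x => c * g x + d * h x) =
  (fun x => c * rpartial a g x + d * rpartial a h x).
Proof. by move=> sg sh; rewrite !rpartialE rsmooth_lin. Qed.

Lemma smooth0 : smooth (fun=> 0).
Proof.
have s0 : rsmooth (fun=> 0).
  suff H s : foldr pderiv (fun=> 0) s = fun=> 0.
    move=> s; rewrite /= H; split; first exact: cst_continuous.
    by move=> i x; exact: derivable_cst.
  elim: s => [//|i s /= ->]; apply/funext => x.
  exact: derive_cst.
by split.
Qed.

Let ReD (u v : R[i]) : complex.Re (u + v) = 1 * complex.Re u + 1 * complex.Re v.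
Proof. by case: u v => [a b] [c d]; rewrite !mul1r. Qed.
Let ImD (u v : R[i]) : complex.Im (u + v) = 1 * complex.Im u + 1 * complex.Im v.
Proof. by case: u v => [a b] [c d]; rewrite !mul1r. Qed.
Let ReM (u v : R[i]) : complex.Re (u * v) =
  complex.Re u * complex.Re v + (- complex.Im u) * complex.Im v.
Proof. by case: u v => [a b] [c d] /=; rewrite mulNr. Qed.
Let ImM (u v : R[i]) : complex.Im (u * v) =
  complex.Im u * complex.Re v + complex.Re u * complex.Im v.
Proof. by case: u v => [a b] [c d] /=; rewrite addrC. Qed.

Let ReDf f1 f2 : (fun x => complex.Re (f1 x + f2 x)) =
  (fun x => 1 * complex.Re (f1 x) + 1 * complex.Re (f2 x)).
Proof. by apply/funext => x; rewrite ReD. Qed.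
Let ImDf f1 f2 : (fun x => complex.Im (f1 x + f2 x)) =
  (fun x => 1 * complex.Im (f1 x) + 1 * complex.Im (f2 x)).
Proof. by apply/funext => x; rewrite ImD. Qed.
Let ReMf (c : R[i]) f : (fun x => complex.Re (c * f x)) =
  (fun x => complex.Re c * complex.Re (f x) +
            (- complex.Im c) * complex.Im (f x)).
Proof. by apply/funext => x; rewrite ReM. Qed.
Let ImMf (c : R[i]) f : (fun x => complex.Im (c * f x)) =
  (fun x => complex.Im c * complex.Re (f x) + complex.Re c * complex.Im (f x)).
Proof. by apply/funext => x; rewrite ImM. Qed.

Lemma smoothD f1 f2 : smooth f1 -> smooth f2 -> smooth (fun x => f1 x + f2 x).
Proof.
by move=> [r1 i1] [r2 i2]; rewrite /smooth ReDf ImDf; split; exact: rsmoothP.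
Qed.

Lemma smoothZ (c : R[i]) f : smooth f -> smooth (fun x => c * f x).
Proof.
by move=> [r1 i1]; rewrite /smooth ReMf ImMf; split; exact: rsmoothP.
Qed.

Lemma partialD (a : multi_index) f1 f2 : smooth f1 -> smooth f2 ->
  partial a (fun x => f1 x + f2 x) = (fun x => partial a f1 x + partial a f2 x).
Proof.
move=> [r1 i1] [r2 i2]; rewrite /partial ReDf ImDf !rpartial_lin//.
by apply/funext => x; rewrite !mul1r.
Qed.

Lemma partialZ (a : multi_index) (c : R[i]) f : smooth f ->
  partial a (fun x => c * f x) = (fun x => c * partial a f x).
Proof.
move=> [r1 i1]; rewrite /partial ReMf ImMf !rpartial_lin//.
apply/funext => x; case: c => c1 c2 /=; congr (_ +i* _); first by rewrite mulNr.
by rewrite addrC.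
Qed.

Lemma wsup_le (w : Rn -> R) A D f (M : R) : 0 <= M ->
  (wsup w A D f <= M%:E)%E <->
  (forall x a, A x -> D a -> w x * normc (partial a f x) <= M).
Proof.
move=> M0; split=> [H x a Ax Da|H].
  rewrite -lee_fin; apply: le_trans H; apply: ereal_sup_ubound => /=.
  by right; exists x, a.
apply: ge_ereal_sup => r /= [->|[x [a [Ax Da ->]]]]; rewrite lee_fin//.
exact: H.
Qed.

Lemma wsup_ge0 (w : Rn -> R) A D f : (0 <= wsup w A D f)%E.
Proof. by apply: ereal_sup_ubound; left. Qed.

Lemma wsupD (w : Rn -> R) A D f1 f2 (a b : R) : (forall x, 0 <= w x) ->
  smooth f1 -> smooth f2 -> 0 <= a -> 0 <= b ->
  (wsup w A D f1 <= a%:E)%E -> (wsup w A D f2 <= b%:E)%E ->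
  (wsup w A D (fun x => f1 x + f2 x)%R <= (a + b)%:E)%E.
Proof.
move=> w0 s1 s2 a0 b0 /wsup_le-/(_ a0) H1 /wsup_le-/(_ b0) H2.
apply/wsup_le; first exact: addr_ge0.
move=> x m Ax Dm; rewrite partialD//.
apply: (le_trans (ler_wpM2l (w0 x) (le_normcD _ _))).
by rewrite mulrDr lerD ?H1 ?H2.
Qed.

Lemma wsupZ (w : Rn -> R) A D (c : R[i]) f (a b : R) : (forall x, 0 <= w x) ->
  smooth f -> 0 <= a -> 0 <= b -> normc c <= a ->
  (wsup w A D f <= b%:E)%E ->
  (wsup w A D (fun x => c * f x)%R <= (a * b)%:E)%E.
Proof.
move=> w0 s1 a0 b0 ca /wsup_le-/(_ b0) H1.
apply/wsup_le; first exact: mulr_ge0.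
move=> x m Ax Dm; rewrite partialZ// normcM mulrCA.
by rewrite ler_pM ?normc_ge0 ?H1 ?mulr_ge0 ?normc_ge0.
Qed.

Lemma wsup0 (w : Rn -> R) A D : wsup w A D (fun=> 0) = 0%E.
Proof.
apply/eqP; rewrite eq_le wsup_ge0 andbT; apply/wsup_le => // x a _ _.
have -> : (fun=> 0) = (fun _ : Rn => 0 * (0 : R[i])).
  by apply/funext => ?; rewrite mul0r.
by rewrite partialZ ?mul0r ?normc0 ?mulr0//; exact: smooth0.
Qed.

Lemma wsup_le_weight (w1 w2 : Rn -> R) A D f : (forall x, w1 x <= w2 x) ->
  (wsup w1 A D f <= wsup w2 A D f)%E.
Proof.
move=> w12; apply: ge_ereal_sup => r /= [->|[x [a [Ax Da ->]]]].
  exact: wsup_ge0.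
apply: (@le_trans _ _ (w2 x * normc (partial a f x))%:E).
  by rewrite lee_fin ler_wpM2r ?normc_ge0.
by apply: ereal_sup_ubound; right; exists x, a.
Qed.

Lemma enorm_ge0 x : 0 <= enorm x. Proof. exact: sqrtr_ge0. Qed.

Lemma slow_norm_mono (N M : nat) a f : (N <= M)%N ->
  (slow_norm M a f <= slow_norm N a f)%E.
Proof.
move=> NM; apply: wsup_le_weight => x.
rewrite lef_pV2 ?posrE ?exprn_gt0 ?ltr_wpDr ?enorm_ge0//.
by rewrite ler_weXn2l// lerDl enorm_ge0.
Qed.

End SmoothFunctions.

Arguments multi_index : clear implicits.

Definition net (R : realType) (n : nat) := eps01 R -> 'rV[R]_n -> R[i].

Section Nets.
Context {R : realType} {n : nat}.
Local Notation Rn := 'rV[R]_n.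
Local Notation I := (eps01 R).
Implicit Types (u v : net R n) (z : snet R) (K : set Rn) (f : Rn -> R[i]).

Definition net_scale z u : net R n := fun e x => z e * u e x.

(* The moderate and negligible nets defining the algebra of generalized
   functions. *)
Definition G_moderate : set (net R n) := [set u |
  (forall e, smooth (u e)) /\
  forall K a, compact K ->
    exists N : nat, Oeps (fun e => sup_on K a (u e)) (- N%:R)].

Definition G_negligible : set (net R n) := [set u |
  (forall e, smooth (u e)) /\
  forall K a, compact K ->
    forall q : nat, Oeps (fun e => sup_on K a (u e)) q%:R].

(* The same for generalized functions based on the Schwartz space. *)
Definition GS_moderate : set (net R n) := [set u |
  (forall e, schwartz (u e)) /\
  forall k, exists N : nat, Oeps (fun e => schwartz_norm k (u e)) (- N%:R)].

Definition GS_negligible : set (net R n) := [set u |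
  (forall e, schwartz (u e)) /\
  forall k, forall q : nat, Oeps (fun e => schwartz_norm k (u e)) q%:R].

(* The same for tempered generalized functions. *)
Definition Gt_moderate : set (net R n) := [set u |
  (forall e, slowly_increasing (u e)) /\
  forall a, exists N : nat, Oeps (fun e => slow_norm N a (u e)) (- N%:R)].

Definition Gt_negligible : set (net R n) := [set u |
  (forall e, slowly_increasing (u e)) /\
  forall a, exists N : nat, forall q : nat,
    Oeps (fun e => slow_norm N a (u e)) q%:R].

Lemma wsup_OepsD (w : Rn -> R) A D u v (b : R) : (forall x, 0 <= w x) ->
  (forall e, smooth (u e)) -> (forall e, smooth (v e)) ->
  Oeps (fun e => wsup w A D (u e)) b -> Oeps (fun e => wsup w A D (v e)) b ->
  Oeps (fun e => wsup w A D ((u + v) e)) b.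
Proof.
by move=> w0 su sv; apply: OepsD => e x y x0 y0 Hx Hy; exact: wsupD.
Qed.

Lemma wsup_OepsZ (w : Rn -> R) A D z u (a b : R) : (forall x, 0 <= w x) ->
  (forall e, smooth (u e)) ->
  Oeps (snorm z) a -> Oeps (fun e => wsup w A D (u e)) b ->
  Oeps (fun e => wsup w A D (net_scale z u e)) (a + b).
Proof.
move=> w0 su; apply: OepsM => e x y x0 y0; rewrite /snorm lee_fin => Hx Hy.
exact: wsupZ.
Qed.

Lemma wsup_Oeps0 (w : Rn -> R) A D (b : R) :
  Oeps (fun e => wsup w A D ((0 : net R n) e)) b.
Proof.
by exists 0, 1; split => // e _; rewrite mul0r; rewrite (wsup0 w A D).
Qed.

Lemma wsup_fin (w : Rn -> R) A D f : (wsup w A D f < +oo)%E ->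
  exists2 M : R, 0 <= M & (wsup w A D f <= M%:E)%E.
Proof.
have := wsup_ge0 w A D f; case: (wsup w A D f) => [r|//|//] r0 _.
by exists r.
Qed.

Lemma wsup_finD (w : Rn -> R) A D f1 f2 : (forall x, 0 <= w x) ->
  smooth f1 -> smooth f2 ->
  (wsup w A D f1 < +oo)%E -> (wsup w A D f2 < +oo)%E ->
  (wsup w A D (fun x => (f1 x + f2 x)%R) < +oo)%E.
Proof.
move=> w0 s1 s2 /wsup_fin[a a0 Ha] /wsup_fin[b b0 Hb].
exact: le_lt_trans (wsupD w0 s1 s2 a0 b0 Ha Hb) (ltry _).
Qed.

Lemma wsup_finZ (w : Rn -> R) A D (c : R[i]) f : (forall x, 0 <= w x) ->
  smooth f -> (wsup w A D f < +oo)%E ->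
  (wsup w A D (fun x => (c * f x)%R) < +oo)%E.
Proof.
move=> w0 s1 /wsup_fin[b b0 Hb].
apply: le_lt_trans (wsupZ w0 s1 (normc_ge0 c) b0 (lexx _) Hb) (ltry _).
Qed.

Lemma schwartz_weight_ge0 (k : nat) (x : Rn) : 0 <= (1 + enorm x) ^+ k.
Proof. by rewrite exprn_ge0// addr_ge0// enorm_ge0. Qed.

Lemma slow_weight_ge0 (N : nat) (x : Rn) : 0 <= (1 + enorm x) ^- N.
Proof. by rewrite invr_ge0 schwartz_weight_ge0. Qed.

Lemma schwartzD f1 f2 : schwartz f1 -> schwartz f2 ->
  schwartz (fun x => f1 x + f2 x).
Proof.
move=> [s1 H1] [s2 H2]; split=> [|k]; first exact: smoothD.
exact: wsup_finD (schwartz_weight_ge0 k) s1 s2 (H1 k) (H2 k).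
Qed.

Lemma schwartzZ (c : R[i]) f : schwartz f -> schwartz (fun x => c * f x).
Proof.
move=> [s1 H1]; split=> [|k]; first exact: smoothZ.
exact: wsup_finZ (schwartz_weight_ge0 k) s1 (H1 k).
Qed.

Lemma schwartz0 : schwartz (fun _ : Rn => 0).
Proof. by split=> [|k]; [exact: smooth0 | rewrite /schwartz_norm wsup0]. Qed.

Lemma slowly_increasingD f1 f2 :
  slowly_increasing f1 -> slowly_increasing f2 ->
  slowly_increasing (fun x => f1 x + f2 x).
Proof.
move=> [s1 H1] [s2 H2]; split=> [|a]; first exact: smoothD.
have [N HN] := H1 a; have [M HM] := H2 a; exists (maxn N M).
apply: wsup_finD => //; first exact: slow_weight_ge0.
  exact: le_lt_trans (slow_norm_mono _ _ (leq_maxl _ _)) HN.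
exact: le_lt_trans (slow_norm_mono _ _ (leq_maxr _ _)) HM.
Qed.

Lemma slowly_increasingZ (c : R[i]) f :
  slowly_increasing f -> slowly_increasing (fun x => c * f x).
Proof.
move=> [s1 H1]; split=> [|a]; first exact: smoothZ.
have [N HN] := H1 a; exists N.
exact: wsup_finZ (slow_weight_ge0 N) s1 HN.
Qed.

Lemma slowly_increasing0 : slowly_increasing (fun _ : Rn => 0).
Proof.
by split=> [|a]; [exact: smooth0 | exists 0%N; rewrite /slow_norm wsup0].
Qed.

Lemma Oeps_negW (f : I -> \bar R) (N M : nat) : (N <= M)%N ->
  Oeps f (- N%:R) -> Oeps f (- M%:R).
Proof. by move=> NM; apply: Oeps_mono => //; rewrite lerN2 ler_nat. Qed.

End Nets.

(* A space of nets closed under the operations needed to quotient its moderate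
   elements by the negligible ones, and to multiply the classes by generalized
   numbers. *)
Record net_space (R : realType) (n : nat) := NetSpace {
  ns_moderate : set (net R n);
  ns_negligible : set (net R n);
  ns_moderate0 : ns_moderate 0;
  ns_moderateD : forall u v,
    ns_moderate u -> ns_moderate v -> ns_moderate (u + v);
  ns_moderateZ : forall z u,
    smoderate z -> ns_moderate u -> ns_moderate (net_scale z u);
  ns_negligible0 : ns_negligible 0;
  ns_negligibleD : forall u v,
    ns_negligible u -> ns_negligible v -> ns_negligible (u + v);
  ns_negligibleZ : forall z u,
    smoderate z -> ns_negligible u -> ns_negligible (net_scale z u);
  ns_negligibleM : forall z u,
    snegligible z -> ns_moderate u -> ns_negligible (net_scale z u) }.

Section NetSpaces.
Context {R : realType} {n : nat}.
Local Notation Rn := 'rV[R]_n.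
Implicit Types (u v : net R n) (z : snet R) (K : set Rn).

Let one_ge0 (x : Rn) : 0 <= 1 :> R. Proof. exact: ler01. Qed.

Program Definition G_space : net_space R n :=
  @NetSpace R n G_moderate G_negligible _ _ _ _ _ _ _.
Next Obligation.
split=> [e|K a _]; first exact: smooth0.
by exists 0%N; exact: wsup_Oeps0.
Qed.
Next Obligation.
move=> u v [su Hu] [sv Hv]; split=> [e|K a cK].
  exact: smoothD (su e) (sv e).
have [N HN] := Hu K a cK; have [M HM] := Hv K a cK; exists (maxn N M).
apply: wsup_OepsD => //.
  exact: Oeps_negW (leq_maxl _ _) HN.
exact: Oeps_negW (leq_maxr _ _) HM.
Qed.
Next Obligation.
move=> z u [N HN] [su Hu]; split=> [e|K a cK]; first exact: smoothZ (su e).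
have [M HM] := Hu K a cK; exists (N + M)%N.
by rewrite natrD opprD; exact: wsup_OepsZ.
Qed.
Next Obligation.
split=> [e|K a _ q]; first exact: smooth0.
exact: wsup_Oeps0.
Qed.
Next Obligation.
move=> u v [su Hu] [sv Hv]; split=> [e|K a cK q].
  exact: smoothD (su e) (sv e).
by apply: wsup_OepsD => //; [exact: Hu | exact: Hv].
Qed.
Next Obligation.
move=> z u [N HN] [su Hu]; split=> [e|K a cK q]; first exact: smoothZ (su e).
have -> : q%:R = - N%:R + (N + q)%:R :> R by rewrite natrD addKr.
by apply: wsup_OepsZ => //; exact: Hu.
Qed.
Next Obligation.
move=> z u Hz [su Hu]; split=> [e|K a cK q]; first exact: smoothZ (su e).
have [N HN] := Hu K a cK.
have -> : q%:R = (q + N)%:R + - N%:R :> R by rewrite natrD addrK.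
by apply: wsup_OepsZ => //; exact: Hz.
Qed.

Program Definition GS_space : net_space R n :=
  @NetSpace R n GS_moderate GS_negligible _ _ _ _ _ _ _.
Next Obligation.
split=> [e|k]; first exact: schwartz0.
by exists 0%N; exact: wsup_Oeps0.
Qed.
Next Obligation.
move=> u v [su Hu] [sv Hv]; split=> [e|k].
  exact: schwartzD (su e) (sv e).
have [N HN] := Hu k; have [M HM] := Hv k; exists (maxn N M).
apply: wsup_OepsD => //.
- exact: schwartz_weight_ge0.
- by move=> e; exact: (su e).1.
- by move=> e; exact: (sv e).1.
- exact: Oeps_negW (leq_maxl _ _) HN.
- exact: Oeps_negW (leq_maxr _ _) HM.
Qed.
Next Obligation.
move=> z u [N HN] [su Hu]; split=> [e|k]; first exact: schwartzZ (su e).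
have [M HM] := Hu k; exists (N + M)%N.
rewrite natrD opprD; apply: wsup_OepsZ => //.
  exact: schwartz_weight_ge0.
by move=> e; exact: (su e).1.
Qed.
Next Obligation.
split=> [e|k q]; first exact: schwartz0.
exact: wsup_Oeps0.
Qed.
Next Obligation.
move=> u v [su Hu] [sv Hv]; split=> [e|k q].
  exact: schwartzD (su e) (sv e).
apply: wsup_OepsD; [exact: schwartz_weight_ge0| | |exact: Hu|exact: Hv].
  by move=> e; exact: (su e).1.
by move=> e; exact: (sv e).1.
Qed.
Next Obligation.
move=> z u [N HN] [su Hu]; split=> [e|k q]; first exact: schwartzZ (su e).
have -> : q%:R = - N%:R + (N + q)%:R :> R by rewrite natrD addKr.
by apply: (wsup_OepsZ (schwartz_weight_ge0 k) _ HN (Hu k _)) => e;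
  exact: (su e).1.
Qed.
Next Obligation.
move=> z u Hz [su Hu]; split=> [e|k q]; first exact: schwartzZ (su e).
have [N HN] := Hu k.
have -> : q%:R = (q + N)%:R + - N%:R :> R by rewrite natrD addrK.
by apply: (wsup_OepsZ (schwartz_weight_ge0 k) _ (Hz _) HN) => e;
  exact: (su e).1.
Qed.

Lemma slow_Oeps (N M : nat) a u (b : R) : (N <= M)%N ->
  Oeps (fun e => slow_norm N a (u e)) b ->
  Oeps (fun e => slow_norm M a (u e)) b.
Proof. by move=> NM; apply: Oeps_mono => // e; exact: slow_norm_mono. Qed.

Program Definition Gt_space : net_space R n :=
  @NetSpace R n Gt_moderate Gt_negligible _ _ _ _ _ _ _.
Next Obligation.
split=> [e|a]; first exact: slowly_increasing0.
by exists 0%N; exact: wsup_Oeps0.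
Qed.
Next Obligation.
move=> u v [su Hu] [sv Hv]; split=> [e|a].
  exact: slowly_increasingD (su e) (sv e).
have [N HN] := Hu a; have [M HM] := Hv a; exists (maxn N M).
apply: wsup_OepsD => //.
- exact: slow_weight_ge0.
- by move=> e; exact: (su e).1.
- by move=> e; exact: (sv e).1.
- exact: slow_Oeps (leq_maxl _ _) (Oeps_negW (leq_maxl _ _) HN).
- exact: slow_Oeps (leq_maxr _ _) (Oeps_negW (leq_maxr _ _) HM).
Qed.
Next Obligation.
move=> z u [N HN] [su Hu]; split=> [e|a].
  exact: slowly_increasingZ (su e).
have [M HM] := Hu a; exists (N + M)%N.
rewrite natrD opprD; apply: wsup_OepsZ => //.
- exact: slow_weight_ge0.
- by move=> e; exact: (su e).1.
- exact: slow_Oeps (leq_addl _ _) HM.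
Qed.
Next Obligation.
split=> [e|a]; first exact: slowly_increasing0.
by exists 0%N => q; exact: wsup_Oeps0.
Qed.
Next Obligation.
move=> u v [su Hu] [sv Hv]; split=> [e|a].
  exact: slowly_increasingD (su e) (sv e).
have [N HN] := Hu a; have [M HM] := Hv a; exists (maxn N M) => q.
apply: wsup_OepsD => //.
- exact: slow_weight_ge0.
- by move=> e; exact: (su e).1.
- by move=> e; exact: (sv e).1.
- exact: slow_Oeps (leq_maxl _ _) (HN q).
- exact: slow_Oeps (leq_maxr _ _) (HM q).
Qed.
Next Obligation.
move=> z u [N HN] [su Hu]; split=> [e|a].
  exact: slowly_increasingZ (su e).
have [M HM] := Hu a; exists M => q.
have -> : q%:R = - N%:R + (N + q)%:R :> R by rewrite natrD addKr.
by apply: (wsup_OepsZ (slow_weight_ge0 M) _ HN (HM _)) => e;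
  exact: (su e).1.
Qed.
Next Obligation.
move=> z u Hz [su Hu]; split=> [e|a].
  exact: slowly_increasingZ (su e).
have [N HN] := Hu a; exists N => q.
have -> : q%:R = (q + N)%:R + - N%:R :> R by rewrite natrD addrK.
by apply: (wsup_OepsZ (slow_weight_ge0 N) _ (Hz _) (HN)) => e;
  exact: (su e).1.
Qed.

End NetSpaces.

Arguments G_space R n : clear implicits.
Arguments GS_space R n : clear implicits.
Arguments Gt_space R n : clear implicits.

Section Quotients.
Local Open Scope quotient_scope.
Variables (R : realType) (n : nat) (S : net_space R n).

Definition moderate_pred : {pred net R n} := mem (ns_moderate S).

Fact moderate_zmod : zmod_closed moderate_pred.
Proof.
split=> [|u v]; rewrite !inE; first exact: ns_moderate0.
move=> Hu Hv; apply: ns_moderateD => //.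
have -> : - v = net_scale (-1) v.
  by apply/funext => e; apply/funext => x; rewrite /net_scale /= mulN1r.
by apply: ns_moderateZ => //; apply: smoderateN; exact: smoderate1.
Qed.

HB.instance Definition _ :=
  GRing.isZmodClosed.Build (net R n) moderate_pred moderate_zmod.

Record mnet := MNet { mnet_val :> net R n; _ : mnet_val \in moderate_pred }.

HB.instance Definition _ := [isSub for mnet_val].
HB.instance Definition _ := [Choice of mnet by <:].
HB.instance Definition _ := [SubChoice_isSubZmodule of mnet by <:].

Definition negligible_pred : {pred mnet} :=
  [pred u | `[< ns_negligible S (val u) >]].

Fact negligible_zmod : zmod_closed negligible_pred.
Proof.
split=> [|u v]; first by apply/asboolP; exact: ns_negligible0.
move=> /asboolP Hu /asboolP Hv; apply/asboolP.
have -> : val (u - v) = val u + net_scale (-1) (val v).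
  rewrite raddfB; apply/funext => e; apply/funext => x.
  by rewrite /net_scale !fctE mulN1r.
apply: ns_negligibleD => //; apply: ns_negligibleZ => //.
by apply: smoderateN; exact: smoderate1.
Qed.

HB.instance Definition _ :=
  GRing.isZmodClosed.Build mnet negligible_pred negligible_zmod.

Definition Gen := {ideal_quot negligible_pred}.

HB.instance Definition _ := GRing.Zmodule.on Gen.
HB.instance Definition _ := Quotient.on Gen.

Lemma moderateP (u : mnet) : ns_moderate S (val u).
Proof. by have := valP u; rewrite inE. Qed.

Lemma smoderateP (z : mscal R) : smoderate (val z).
Proof. by have := valP z; rewrite inE. Qed.

Fact mscale_subproof (z : mscal R) (u : mnet) :
  net_scale (val z) (val u) \in moderate_pred.
Proof.
by rewrite inE; apply: ns_moderateZ; [exact: smoderateP | exact: moderateP].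
Qed.

Definition mscale (z : mscal R) (u : mnet) : mnet :=
  MNet (mscale_subproof z u).

Lemma GenP (u v : mnet) :
  \pi_Gen u = \pi_Gen v <-> ns_negligible S (val (u - v)).
Proof.
split=> [/eqP|H].
  by rewrite -Quotient.idealrBE => /asboolP.
by apply/eqP; rewrite -Quotient.idealrBE; apply/asboolP.
Qed.

Lemma CtP (y z : mscal R) :
  \pi_(Ct R) y = \pi_(Ct R) z <-> snegligible (val (y - z)).
Proof.
split=> [/eqP|H].
  by rewrite -Quotient.idealrBE => /asboolP.
by apply/eqP; rewrite -Quotient.idealrBE; apply/asboolP.
Qed.

Definition gscale (z : Ct R) (u : Gen) : Gen :=
  \pi_Gen (mscale (repr z) (repr u)).

Lemma gscaleE (z : mscal R) (u : mnet) :
  gscale (\pi_(Ct R) z) (\pi_Gen u) = \pi_Gen (mscale z u).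
Proof.
rewrite /gscale; set z' := repr _; set u' := repr _; apply/GenP.
have zz' : snegligible (val (z' - z)) by apply/CtP; rewrite /z' reprK.
have uu' : ns_negligible S (val (u' - u)) by apply/GenP; rewrite /u' reprK.
have -> : val (mscale z' u' - mscale z u) =
    net_scale (val z') (val (u' - u)) + net_scale (val (z' - z)) (val u).
  rewrite !raddfB /=; apply/funext => e; apply/funext => x.
  by rewrite /net_scale !fctE mulrBr mulrBl addrA subrK.
apply: ns_negligibleD.
  by apply: ns_negligibleZ => //; exact: smoderateP.
by apply: ns_negligibleM => //; exact: moderateP.
Qed.

Let mnet_ext (u v : mnet) : (forall e x, val u e x = val v e x) -> u = v.
Proof. by move=> H; apply/val_inj/funext => e; apply/funext => x. Qed.

Fact gscaleA (y z : Ct R) (u : Gen) : gscale y (gscale z u) = gscale (y * z) u.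
Proof.
rewrite -[y]reprK -[z]reprK -[u]reprK -(rmorphM (\pi_(Ct R))).
rewrite (gscaleE (repr z)) !gscaleE.
by apply: (congr1 (\pi_Gen)); apply: mnet_ext => e x;
  rewrite /= /net_scale mulrA.
Qed.

Fact gscale1 : left_id 1 gscale.
Proof.
move=> u; rewrite -[u]reprK -(rmorph1 (\pi_(Ct R))) gscaleE.
by apply: (congr1 (\pi_Gen)); apply: mnet_ext => e x;
  rewrite /= /net_scale mul1r.
Qed.

Fact gscaleDr : right_distributive gscale +%R.
Proof.
move=> z u v; rewrite -[z]reprK -[u]reprK -[v]reprK -(raddfD (\pi_Gen)).
rewrite !gscaleE.
rewrite -(raddfD (\pi_Gen)).
apply: (congr1 (\pi_Gen)); apply: mnet_ext => e x.
by rewrite /= /net_scale !fctE mulrDr.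
Qed.

Fact gscaleDl (u : Gen) : {morph gscale^~ u : y z / y + z}.
Proof.
move=> y z /=; rewrite -[z]reprK -[u]reprK -[y]reprK -(raddfD (\pi_(Ct R))).
rewrite !gscaleE.
rewrite -(raddfD (\pi_Gen)).
apply: (congr1 (\pi_Gen)); apply: mnet_ext => e x.
by rewrite /= /net_scale !fctE mulrDl.
Qed.

HB.instance Definition _ := GRing.Zmodule_isLmodule.Build (Ct R) Gen
  gscaleA gscale1 gscaleDr gscaleDl.

End Quotients.

Section Classes.
Local Open Scope quotient_scope.
Context {R : realType} {n : nat}.

(* The class of a net; the junk value [0] when the net is not moderate. *)
Definition cls (S : net_space R n) (u : net R n) : Gen S :=
  \pi_(Gen S) (insubd (0 : mnet S) u).

Definition represents (S : net_space R n) (u : net R n) (U : Gen S) : Prop :=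
  ns_moderate S u /\ cls S u = U.

Definition ccls (z : snet R) : Ct R := \pi_(Ct R) (insubd (0 : mscal R) z).

Definition crepresents (z : snet R) (Z : Ct R) : Prop :=
  smoderate z /\ ccls z = Z.

(* The following two do not depend on the chosen representative [repr]. *)
Definition sharp_norm (Z : Ct R) : R := expval (snorm (val (repr Z))).

(* [exp (- v)], for [v] the valuation of the net [p (u e)]. *)
Definition net_seminorm (S : net_space R n) (p : ('rV[R]_n -> R[i]) -> \bar R)
  (U : Gen S) : R := expval (fun e => p (val (repr U) e)).

End Classes.

Section LocallyConvex.
Variable R : realType.

Definition ultra_pseudo_seminorm (M : lmodType (Ct R)) (P : M -> R) : Prop :=
  [/\ forall u, 0 <= P u,
      P 0 = 0,
      forall (Z : Ct R) u, P (Z *: u) <= sharp_norm Z * P u &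
      forall u v, P (u + v) <= Num.max (P u) (P v)].

(* [M] with the topology defined by the family [F]: the finite intersections
   of balls of seminorms in [F] form a base of neighborhoods of each point. *)
Definition lcspace (M : zmodType) (F : set (M -> R)) : Type := M.

Definition lcopen (M : zmodType) (F : set (M -> R)) : set_system M :=
  [set U | forall x, U x -> exists D : set (M -> R), exists d : R,
    [/\ finite_set D, D `<=` F, 0 < d &
        forall y, (forall P, D P -> P (y - x) < d) -> U y]].

Section Topology.
Variables (M : zmodType) (F : set (M -> R)).

Lemma lcopenT : lcopen F setT.
Proof. by move=> x _; exists set0, 1; split. Qed.

Lemma lcopenI : setI_closed (lcopen F).
Proof.
move=> U V HU HV x [Ux Vx].
have [D [d [fD DF d0 H]]] := HU x Ux.
have [D' [d' [fD' D'F d'0 H']]] := HV x Vx.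
exists (D `|` D'), (Num.min d d'); split.
- by rewrite finite_setU.
- by move=> P [/DF|/D'F].
- by rewrite lt_min d0.
- move=> y Hy; split.
    by apply: H => P DP; have := Hy P (or_introl DP); rewrite lt_min => /andP[].
  by apply: H' => P DP; have := Hy P (or_intror DP); rewrite lt_min => /andP[].
Qed.

Lemma lcopen_bigU (I : Type) (f : I -> set M) :
  (forall i, lcopen F (f i)) -> lcopen F (\bigcup_i f i).
Proof.
move=> H x [i _ fx]; have [D [d [fD DF d0 Hd]]] := H i x fx.
by exists D, d; split=> // y Hy; exists i => //; exact: Hd.
Qed.

HB.instance Definition _ := Choice.on (lcspace F).
HB.instance Definition _ := isOpenTopological.Build (lcspace F)
  lcopenT lcopenI lcopen_bigU.

End Topology.

Definition sharp_family : set (Ct R -> R) := [set @sharp_norm R].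

Definition lccontinuous (M : lmodType (Ct R)) (F : set (M -> R))
    (T : M -> Ct R) : Prop :=
  continuous (T : lcspace F -> lcspace sharp_family).

Definition lcbounded (M : lmodType (Ct R)) (F : set (M -> R)) (B : set M) :
    Prop :=
  forall P : M -> R, ultra_pseudo_seminorm P ->
    continuous (P : lcspace F -> R) -> exists c : R, forall u, B u -> P u <= c.

(* [sup {|S u| : u in B}], which is [0] for [B] empty. *)
Definition dual_seminorm (M : Type) (B : set M) (S : M -> Ct R) : \bar R :=
  ereal_sup [set r | r = 0%E \/ exists2 u, B u & r = (sharp_norm (S u))%:E].

Definition dual_cvg (M : lmodType (Ct R)) (F : set (M -> R))
    (S : nat -> M -> Ct R) (T : M -> Ct R) : Prop :=
  forall B : set M, lcbounded F B ->
    (fun q => dual_seminorm B (fun u => S q u - T u)) @ \oo --> 0%E.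

End LocallyConvex.

Section ColombeauSpaces.
Local Open Scope quotient_scope.
Variables (R : realType) (n : nat).
Local Notation Rn := 'rV[R]_n.
Implicit Types (K V : set Rn).

Definition G := Gen (G_space R n).
Definition GS := Gen (GS_space R n).
Definition Gt := Gen (Gt_space R n).

HB.instance Definition _ := GRing.Lmodule.on G.
HB.instance Definition _ := GRing.Lmodule.on GS.
HB.instance Definition _ := GRing.Lmodule.on Gt.

(* The restriction of [U] to the open set [V] is zero. *)
Definition vanishes_on (U : G) V : Prop :=
  forall K a, compact K -> K `<=` V ->
    forall q : nat, Oeps (fun e => sup_on K a (val (repr U) e)) q%:R.

Definition gsupport (U : G) : set Rn :=
  [set x | forall V, open V -> V x -> ~ vanishes_on U V].

Definition gcompact_pred : {pred G} := [pred U | `[< compact (gsupport U) >]].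

Lemma vanishes_on_pi (m : mnet (G_space R n)) V :
  (forall K a, compact K -> K `<=` V ->
    forall q : nat, Oeps (fun e => sup_on K a (val m e)) q%:R) ->
  vanishes_on (\pi_G m) V.
Proof.
move=> H K a cK KV q; set m' := repr _.
have [sd Hd] : G_negligible (val (m' - m)).
  by apply/(@GenP _ _ (G_space R n)); rewrite /m' reprK.
have -> : (fun e => sup_on K a (val m' e)) =
    (fun e => sup_on K a ((val (m' - m) + val m) e)).
  by apply/funext => e; rewrite raddfB subrK.
apply: wsup_OepsD => //; [|exact: Hd|exact: H].
exact: (moderateP m).1.
Qed.

Lemma gsupport_closed (U : G) : closed (gsupport U).
Proof.
rewrite -[gsupport U]setCK; apply: open_closedC.
have -> : ~` gsupport U = \bigcup_(V in [set V | open V /\ vanishes_on U V]) V.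
  apply/seteqP; split=> [x /=|x [V [oV UV] Vx] /= /(_ V oV Vx)//].
  move=> /existsNP[V /not_implyP[oV /not_implyP[Vx /contrapT UV]]].
  by exists V.
by apply: bigcup_open => V [].
Qed.

Lemma gsupportD (U W : G) :
  gsupport (U + W) `<=` gsupport U `|` gsupport W.
Proof.
move=> x Hx; apply: contrapT => /not_orP[].
move=> /existsNP[V /not_implyP[oV /not_implyP[Vx /contrapT UV]]].
move=> /existsNP[V' /not_implyP[oV' /not_implyP[Vx' /contrapT WV]]].
apply: (Hx (V `&` V')); [exact: openI|by split|].
rewrite -[U]reprK -[W]reprK -(raddfD (\pi_G)); apply: vanishes_on_pi.
move=> K a cK KV q; rewrite raddfD; apply: wsup_OepsD => //.
- exact: (moderateP (repr U)).1.
- exact: (moderateP (repr W)).1.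
- by apply: UV => // y /KV[].
- by apply: WV => // y /KV[].
Qed.

Lemma gsupportZ (Z : Ct R) (U : G) : gsupport (Z *: U) `<=` gsupport U.
Proof.
move=> x Hx V oV Vx UV; apply: (Hx V) => //.
have -> : Z *: U = \pi_G (mscale (repr Z) (repr U)) by [].
apply: vanishes_on_pi => K a cK KV q.
have [N HN] := smoderateP (repr Z).
have -> : q%:R = - N%:R + (N + q)%:R :> R by rewrite natrD addKr.
apply: wsup_OepsZ => //; last exact: UV.
exact: (moderateP (repr U)).1.
Qed.

Lemma gsupport0 : gsupport 0 = set0.
Proof.
apply/seteqP; split=> // x /(_ setT openT I); apply.
rewrite -(raddf0 (\pi_G)); apply: vanishes_on_pi => K a _ _ q.
exact: wsup_Oeps0.
Qed.

Fact gcompact_submod : GRing.subsemimod_closed gcompact_pred.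
Proof.
split; first split.
- by apply/asboolP; rewrite gsupport0; exact: compact0.
- move=> U W /asboolP cU /asboolP cW; apply/asboolP.
  apply: (subclosed_compact (@gsupport_closed _) (compactU cU cW)).
  exact: gsupportD.
- move=> Z U /asboolP cU; apply/asboolP.
  exact: (subclosed_compact (@gsupport_closed _) cU (@gsupportZ Z U)).
Qed.

HB.instance Definition _ :=
  GRing.isSubmodClosed.Build (Ct R) G gcompact_pred gcompact_submod.

Record Gc := MkGc { Gc_val :> G; _ : Gc_val \in gcompact_pred }.

HB.instance Definition _ := [isSub for Gc_val].
HB.instance Definition _ := [Choice of Gc by <:].
HB.instance Definition _ := [SubChoice_isSubLmodule of Gc by <:].

(* The junk value [0] when the support of the class is not compact. *)
Definition Gc_cls (u : net R n) : Gc := insubd (0 : Gc) (cls (G_space R n) u).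

(* Representatives of elements of [Gc] are taken with supports in a common
   compact set. *)
Definition Gc_represents (u : net R n) (U : Gc) : Prop :=
  represents u (val U) /\
  exists2 K, compact K & forall e, fsupport (u e) `<=` K.

Definition G_family : set (G -> R) :=
  [set P | exists K k, compact K /\ P = net_seminorm (sup_upto K k)].

Definition GS_family : set (GS -> R) :=
  [set P | exists k, P = net_seminorm (schwartz_norm k)].

(* The topology of the subspace of the elements with support in [K] does not
   depend on the compact neighborhood [K'] of [K]. *)
Definition GK_family (K' : set Rn) : set (Gc -> R) :=
  [set P | exists k, P = fun U : Gc => net_seminorm (sup_upto K' k) (val U)].

Definition GK (K : set Rn) : set Gc := [set U | gsupport (val U) `<=` K].

(* [F] defines a locally convex topology on [Gc] for which the inclusions of
   all the subspaces [GK K] are continuous. *)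
Definition inductive_family (F : set (Gc -> R)) : Prop :=
  (forall P, F P -> ultra_pseudo_seminorm P) /\
  forall K K', compact K -> compact K' -> K `<=` K'° ->
    {within (GK K : set (lcspace (GK_family K'))),
      continuous (id : lcspace (GK_family K') -> lcspace F)}.

(* The inductive limit topology is the supremum of all these topologies; it is
   the finest of them by [Gc_family_inductive] and [Gc_family_finest] below. *)
Definition Gc_family : set (Gc -> R) :=
  \bigcup_(F in inductive_family) F.

End ColombeauSpaces.

Section InductiveLimit.
Variables (R : realType) (n : nat).

Lemma lcball_nbhs (M : lmodType (Ct R)) (F : set (M -> R)) (P : M -> R)
    (x : M) (d : R) : F P -> ultra_pseudo_seminorm P -> 0 < d ->
  nbhs (x : lcspace F) [set y | P (y - x) < d].
Proof.
move=> FP [_ P0 _ PD] d0.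
exists [set y | P (y - x) < d]; split => //=; last by rewrite subrr P0.
move=> y /= yx; exists [set P], d; split=> //; first by move=> _ ->.
move=> z /(_ P erefl) zy; rewrite -(subrK y z) -addrA /=.
by apply: (le_lt_trans (PD _ _)); rewrite gt_max zy.
Qed.

Lemma Gc_family_inductive : inductive_family (@Gc_family R n).
Proof.
split=> [P [F HF] FP|K K' cK cK' KK' x U]; first exact: HF.1.
move=> [B [oB Bx BU]]; have [D [d [fD DF d0 HD]]] := oB x Bx.
have sBU : [set y | forall P, D P -> P (y - x) < d] `<=` U.
  by move=> y Hy; apply: BU; exact: HD.
apply: (filterS sBU).
have [s Ds] := (iffLR (finite_seqP _)) fD.
suff {sBU HD fD} H : forall s' : seq (Gc R n -> R),
    (forall P, P \in s' -> Gc_family P) ->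
    \forall y \near nbhs (x : subspace (GK K : set (lcspace (GK_family K')))),
      forall P, P \in s' -> P ((y : Gc R n) - (x : Gc R n)) < d.
  have := H s; rewrite Ds in DF *; apply => P Ps; exact: DF.
elim=> [_|P s' IH Hs']; first by apply: filterE.
have [F [uF cF] FP] : Gc_family P by apply: Hs'; rewrite mem_head.
have H1 := cF K K' cK cK' KK' x _ (lcball_nbhs x FP (uF P FP) d0).
have H2 : forall Q, Q \in s' -> Gc_family Q.
  by move=> Q Qs; apply: Hs'; rewrite inE Qs orbT.
have {}H2 := IH H2.
near=> y => Q; rewrite inE => /orP[/eqP ->|Qs'].
  by near: y.
by move: Q Qs'; near: y.
Unshelve. all: by end_near. Qed.

Lemma Gc_family_finest (F : set (Gc R n -> R)) : inductive_family F ->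
  continuous (id : lcspace (@Gc_family R n) -> lcspace F).
Proof.
move=> HF x U [B [oB Bx BU]]; exists B; split=> // y /oB[D [d [fD DF d0 H]]].
by exists D, d; split=> // P /DF FP; exists F.
Qed.

End InductiveLimit.

Section BasicFunctionals.
Variables (R : realType) (n : nat).
Local Notation Rn := 'rV[R]_n.
Local Notation fct := (Rn -> R[i]).
Implicit Types (K : set Rn) (t : fct -> R[i]) (Te : eps01 R -> fct -> R[i]).

(* A distribution is given by its values on its space of test functions; the
   values elsewhere are irrelevant. *)
Definition linear_on (V : set fct) t : Prop :=
  forall (c : R[i]) f g, V f -> V g ->
    t (fun x => c * f x + g x) = c * t f + t g.

Definition test_function_in K : set fct :=
  [set f | smooth f /\ fsupport f `<=` K].

(* [D'], [E'] and [S'] respectively. *)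
Definition distribution t : Prop :=
  linear_on (@test_function R n) t /\
  forall K, compact K -> exists j (C : R), forall f, test_function_in K f ->
    ((normc (t f))%:E <= C%:E * sup_upto K j f)%E.

Definition compact_distribution t : Prop :=
  linear_on (@smooth R n) t /\
  exists K, compact K /\ exists j (C : R), forall f, smooth f ->
    ((normc (t f))%:E <= C%:E * sup_upto K j f)%E.

Definition tempered_distribution t : Prop :=
  linear_on (@schwartz R n) t /\
  exists j (C : R), forall f, schwartz f ->
    ((normc (t f))%:E <= C%:E * schwartz_norm j f)%E.

Definition basic_net_Gc Te : Prop :=
  (forall e, distribution (Te e)) /\
  forall K, compact K ->
    exists (j N : nat) (eta : R), 0 < eta <= 1 /\
    forall f, test_function_in K f -> forall e, val e <= eta ->
      ((normc (Te e f))%:E <= (val e `^ (- N%:R))%:E * sup_upto K j f)%E.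

Definition basic_net_G Te : Prop :=
  (forall e, compact_distribution (Te e)) /\
  exists K, compact K /\
    exists (j N : nat) (eta : R), 0 < eta <= 1 /\
    forall f, smooth f -> forall e, val e <= eta ->
      ((normc (Te e f))%:E <= (val e `^ (- N%:R))%:E * sup_upto K j f)%E.

Definition basic_net_GS Te : Prop :=
  (forall e, tempered_distribution (Te e)) /\
  exists (j N : nat) (eta : R), 0 < eta <= 1 /\
    forall f, schwartz f -> forall e, val e <= eta ->
      ((normc (Te e f))%:E <= (val e `^ (- N%:R))%:E * schwartz_norm j f)%E.

(* [Te] is a net defining the basic functional [T]. *)
Definition defines_Gc Te (T : Gc R n -> Ct R) : Prop :=
  basic_net_Gc Te /\
  forall u U, Gc_represents u U -> crepresents (fun e => Te e (u e)) (T U).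

Definition defines_G Te (T : G R n -> Ct R) : Prop :=
  basic_net_G Te /\
  forall u U, represents u U -> crepresents (fun e => Te e (u e)) (T U).

Definition defines_GS Te (T : GS R n -> Ct R) : Prop :=
  basic_net_GS Te /\
  forall u U, represents u U -> crepresents (fun e => Te e (u e)) (T U).

Definition basic_Gc (T : Gc R n -> Ct R) : Prop := exists Te, defines_Gc Te T.
Definition basic_G (T : G R n -> Ct R) : Prop := exists Te, defines_G Te T.
Definition basic_GS (T : GS R n -> Ct R) : Prop := exists Te, defines_GS Te T.

Definition conv_net (u : net R n) Te : net R n :=
  fun e x => Te e (fun y => u e (x - y)).

(* [W] is the convolution of [U] and [T]. *)
Definition is_conv_Gc (U : Gc R n) (T : Gc R n -> Ct R) (W : G R n) : Prop :=
  exists u Te, [/\ Gc_represents u U, defines_Gc Te T &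
    represents (conv_net u Te) W].

Definition is_conv_G (U : G R n) (T : G R n -> Ct R) (W : G R n) : Prop :=
  exists u Te, [/\ represents u U, defines_G Te T &
    represents (conv_net u Te) W].

Definition is_conv_GS (U : GS R n) (T : GS R n -> Ct R) (W : Gt R n) : Prop :=
  exists u Te, [/\ represents u U, defines_GS Te T &
    represents (conv_net u Te) W].

End BasicFunctionals.

Section Embeddings.
Variable R : realType.

(* The Lebesgue integral over [R^n] as an iterated integral; it is only used
   for integrable continuous functions, for which they agree by Fubini. *)
Fixpoint rintegral (n : nat) : ('rV[R]_n -> R) -> R :=
  match n with
  | 0 => fun f => f 0
  | m.+1 => fun f => Rintegral lebesgue_measure setT
      (fun t : R => @rintegral m (fun y => f (row_mx (t%:M : 'rV[R]_1) y)))
  end.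

Variable n : nat.

Definition cintegral (f : 'rV[R]_n -> R[i]) : R[i] :=
  rintegral (fun x => complex.Re (f x)) +i*
  rintegral (fun x => complex.Im (f x)).

Definition integral_net (w v : net R n) : snet R :=
  fun e => cintegral (fun x => w e x * v e x).

Definition Gc_repr (U : Gc R n) : net R n :=
  xget 0 [set u | Gc_represents u U].

(* [v |-> \int w v], computed on representatives. *)
Definition embed_G (W : G R n) : Gc R n -> Ct R :=
  fun V => ccls (integral_net (val (repr W)) (Gc_repr V)).

Definition embed_Gc (W : Gc R n) : G R n -> Ct R :=
  fun V => ccls (integral_net (Gc_repr W) (val (repr V))).

Definition embed_Gt (W : Gt R n) : GS R n -> Ct R :=
  fun V => ccls (integral_net (val (repr W)) (val (repr V))).

(* The net [rho_(e ^ q)], where [rho_t x = t ^ - n * rho (x / t)]. *)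
Definition mollifier (rho : 'rV[R]_n -> R[i]) (q : nat) : net R n :=
  fun e x => ((val e ^+ q) ^- n)%:C * rho ((val e ^+ q)^-1 *: x).

End Embeddings.

(* Main.v *)
(* Write v_q(y) = \int rho(z) v(y + e^q z) dz. Pairing rho_(e^q) * T with v and
   moving the integral inside T gives T(v_q), so that the functional
   rho_(e^q) * T - T sends v to the class of T_e(v_q - v), for one fixed net T_e
   defining T. Since \int rho = 1, a first order expansion bounds every derivative
   of v_q - v by e^q times the derivatives of v of one order more, hence
   T_e(v_q - v) = O(e^(q + b - N)), where the exponent N depends only on T_e and b
   can be chosen uniformly for v in a bounded set. For G_c, uniformity moreover
   needs that the elements of a bounded set have supports in a common compact
   set. *)

Require Import Defs.
From mathcomp Require Import all_boot all_order all_algebra.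
From mathcomp Require Import all_classical all_reals all_analysis.
From mathcomp Require Import complex.
From mathcomp Require Import ring lra measurable_realfun.

Set Implicit Arguments.
Unset Strict Implicit.
Unset Printing Implicit Defensive.

Import Order.TTheory GRing.Theory Num.Theory.
Import numFieldNormedType.Exports.
Import Normc.

Local Open Scope classical_set_scope.
Local Open Scope complex_scope.
Local Open Scope ring_scope.

(** * Calculus on R^n *)

(** For each q separately, the hypothesis on W provides some net defining T and some representative
    of the mollifier, so no exponent uniform in q can be read off from it. The pairing is therefore
    turned back into the value of T at the class of v_q, where no net occurs any more; only then is
    T computed with one net chosen once and for all. Since T_e is an abstract functional, the
    integral moves inside it by approximation: finite sums with nodes independent of the integrand
    are close to the integral, T_e commutes with them, and its seminorm estimate controls the error.
    Differentiation under an integral sign is in turn an instance of the smoothness of the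
    convolution with a distribution. A seminorm bounded by c on a set gives O(e^b) on it for every b
    < - ln c, which is the origin of the uniform b. The common support in G_c comes from a gliding
    hump: without it, a suitable continuous seminorm would be unbounded on the set. *)

Lemma ler0_eps (R : realType) (x : R) :
  (forall e : R, 0 < e -> x <= e) -> x <= 0.
Proof. by move=> H; apply/ler_addgt0Pl => e e0; rewrite addr0; exact: H. Qed.

Lemma double_lt (R : realType) (m : R) : 0 < m ->
  exists2 k : R, 0 < k & 2 * k < m.
Proof. by move=> m0; exists (m / 4); lra. Qed.

Section RealCalculus.
Context {R : realType} {n : nat}.
Local Notation Rn := 'rV[R]_n.
Implicit Types (g h : Rn -> R) (x y d : Rn) (s t : seq 'I_n) (i j : 'I_n).

Definition basis_vec (i : 'I_n) : Rn := delta_mx 0 i.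
Local Notation e_ := basis_vec.

Lemma normr_coord x i : `|x 0 i| <= `|x|.
Proof.
have /mapP[j Hj ->] : `|x 0 i| \in [seq `|x z.1 z.2| | z : 'I_1 * 'I_n].
  by apply/mapP; exists (0, i) => //=; rewrite mem_enum.
by rewrite [leRHS]/Num.norm /= mx_normrE; apply/bigmax_geP; right => /=; exists j.
Qed.

Lemma normr_row_le x (c : R) : 0 <= c -> (forall i, `|x 0 i| <= c) -> `|x| <= c.
Proof.
move=> c0 H; rewrite [leLHS]/Num.norm /= mx_normrE.
apply: bigmax_le => // -[i j] _ /=; rewrite ord1; exact: H.
Qed.

Lemma normr_basis i : `|e_ i| <= 1.
Proof.
apply: normr_row_le => // j; rewrite !mxE eqxx /=.
by case: (j == i); rewrite /= ?normr0 ?normr1.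
Qed.

Lemma continuous_distP (T : normedModType R) (f : T -> R) :
  continuous f <-> forall (x : T) (e : R), 0 < e -> exists2 d : R, 0 < d &
    forall y : T, `|x - y| < d -> `|f x - f y| < e.
Proof.
split=> [cf x e e0|H x].
  have /cvgrPdist_lt/(_ e e0) := cf x.
  by move=> /nbhs_normP[d /= d0 H]; exists d => // y xy; exact: H.
apply/cvgrPdist_lt => e e0; have [d d0 Hd] := H x e e0.
by apply/nbhs_normP; exists d => //= y; exact: Hd.
Qed.

Lemma is_derive_dist (V : normedModType R) (f : V -> R) (x v : V) (l : R) :
  (forall e : R, 0 < e -> exists2 d : R, 0 < d & forall h : R, `|h| < d ->
    `|f (x + h *: v) - f x - h * l| <= e * `|h|) ->
  is_derive x v f l.
Proof.
move=> H.
have C : (fun h : R => h^-1 *: ((f \o shift x) (h *: v) - f x)) @ 0^' --> l.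
  apply/cvgrPdist_le => e e0; have [d d0 Hd] := H e e0.
  apply/nbhs_normP; exists d => //= h; rewrite /ball_ /= sub0r normrN => hd h0.
  rewrite -[X in `|X - _|](@mulKf _ h)// -mulrBr normrM normfV.
  rewrite ler_pdivrMl ?normr_gt0// mulrC distrC addrC /=.
  by have := Hd h hd; rewrite addrC [_ + x]addrC [l * h]mulrC [`|h| * e]mulrC [X in `|X|]addrC.
by apply: DeriveDef; [apply/cvg_ex; exists l | apply: cvg_lim].
Qed.

Lemma is_derive_line g x v (t : R) : derivable g (x + t *: v) v ->
  is_derive t 1 (fun t : R => g (x + t *: v)) ('D_v g (x + t *: v)).
Proof.
move=> dg.
have E : (fun h : R => h^-1 *: (((fun t : R => g (x + t *: v)) \o shift t) (h *: 1) - g (x + t *: v)))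
   = (fun h : R => h^-1 *: ((g \o shift (x + t *: v)) (h *: v) - g (x + t *: v))).
  apply/funext => h /=; congr (_ *: (g _ - _)).
  by rewrite [h *: 1]mulr1 scalerDl addrCA addrA addrC addrA addrC addrA.
by apply: DeriveDef; rewrite /derivable /derive E.
Qed.

(** The point [c] is located only by |c| <= |h|, so that one statement covers both signs of [h]. *)
Lemma mvt_line g x v (h : R) : (forall y, derivable g y v) ->
  exists2 c : R, `|c| <= `|h| & g (x + h *: v) - g x = h * 'D_v g (x + c *: v).
Proof.
move=> dg; pose f (t : R) := g (x + t *: v); pose df (t : R) := 'D_v g (x + t *: v).
have idf (t : R) : is_derive t 1 f (df t) by apply: is_derive_line.
have cf : continuous f.
  by move=> t; apply/differentiable_continuous/derivable1_diffP.
have fx : g x = f 0 by rewrite /f scale0r addr0.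
have [h0|h0] := leP 0 h.
  have [c + E] := @MVT_segment _ f df _ _ h0 (fun (t : R) _ => idf t) (continuous_subspaceT cf).
  rewrite in_itv /= => /andP[c0 ch]; exists c; first by rewrite !ger0_norm.
  by rewrite fx E subr0 mulrC.
have [c + E] := @MVT_segment _ f df _ _ (ltW h0) (fun (t : R) _ => idf t) (continuous_subspaceT cf).
rewrite in_itv /= => /andP[c0 ch]; exists c.
  by rewrite !ler0_norm ?(ltW h0)// lerN2.
by rewrite fx -opprB E sub0r mulrN opprK mulrC.
Qed.

Lemma pderiv_mvt g x i (h : R) : rsmooth g ->
  exists2 c : R, `|c| <= `|h| & g (x + h *: e_ i) - g x = h * pderiv i g (x + c *: e_ i).
Proof. by move=> sg; apply: mvt_line => y; have [_ /(_ i y)] := sg [::]. Qed.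

Lemma rsmooth_foldr g s : rsmooth g -> rsmooth (foldr pderiv g s).
Proof. by move=> sg t; have := sg (t ++ s); rewrite /= foldr_cat. Qed.

Lemma rsmooth_pderiv g i : rsmooth g -> rsmooth (pderiv i g).
Proof. exact: (@rsmooth_foldr g [:: i]). Qed.

Lemma rsmooth_continuous g : rsmooth g -> continuous g.
Proof. by move=> /(_ [::])[]. Qed.

(** Clairaut's theorem. The second difference of [g] over a square of side [k] is symmetric in the
    two directions, and two mean values, taken in either order, write it as k^2 times a mixed
    derivative at a point within 2k of [x]; continuity of both mixed derivatives at [x]
    concludes. *)
Lemma pderivC g i j : rsmooth g ->
  pderiv i (pderiv j g) = pderiv j (pderiv i g).
Proof.
move=> sg; apply/funext => x.
have step i' j' (k : R) : k != 0 -> exists2 y, `|x - y| <= 2 * `|k| &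
    g (x + k *: e_ i' + k *: e_ j') - g (x + k *: e_ i') - (g (x + k *: e_ j') - g x) =
    k * (k * pderiv j' (pderiv i' g) y).
  move=> k0; pose g1 y := 1 * g (y + k *: e_ j') + (-1) * g y.
  have dg y : derivable (fun y => g (y + k *: e_ j')) y (e_ i') /\
     'D_(e_ i') (fun y => g (y + k *: e_ j')) y = pderiv i' g (y + k *: e_ j').
    have [_ /(_ i' (y + k *: e_ j'))] := sg [::].
    rewrite /pderiv /derivable /derive /= -/(e_ i').
    suff -> : (fun h : R => h^-1 *: (g (h *: e_ i' + (y + k *: e_ j')) - g (y + k *: e_ j'))) =
       (fun h : R => h^-1 *: (((fun y0 : Rn => g (y0 + k *: e_ j')) \o shift y) (h *: e_ i') -
             g (y + k *: e_ j'))) by [].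
    by apply/funext => h /=; rewrite addrA.
  have dg0 y : derivable g y (e_ i') by have [_ /(_ i' y)] := sg [::].
  have [y|c ch E] := @mvt_line g1 x (e_ i') k.
    apply: (@derivableD _ _ _ (1 \*: _) (-1 \*: _)); apply: derivableZ => //.
    exact: (dg y).1.
  have D : 'D_(e_ i') g1 (x + c *: e_ i') =
     pderiv i' g (x + c *: e_ i' + k *: e_ j') - pderiv i' g (x + c *: e_ i').
    rewrite (@deriveD _ _ _ (1 \*: (fun y => g (y + k *: e_ j'))) (-1 \*: g)).
    - rewrite !deriveZ//; last exact: (dg _).1.
      by rewrite (dg _).2 scale1r scaleN1r.
    - by apply: derivableZ; exact: (dg _).1.
    - exact: derivableZ.
  have [c' ch' E'] := pderiv_mvt (x + c *: e_ i') j' k (rsmooth_pderiv i' sg).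
  exists (x + c *: e_ i' + c' *: e_ j').
    rewrite opprD addrA opprD addNKr -opprD normrN.
    apply: (le_trans (ler_normD _ _)); rewrite mulrDl mul1r lerD// normrZ.
      by rewrite (le_trans _ ch)// ler_piMr// normr_basis.
    by rewrite (le_trans _ ch')// ler_piMr// normr_basis.
  have -> : g (x + k *: e_ i' + k *: e_ j') - g (x + k *: e_ i') - (g (x + k *: e_ j') - g x) =
     g1 (x + k *: e_ i') - g1 x by rewrite /g1 !mul1r !mulN1r.
  by rewrite E D E'.
apply/eqP; rewrite -subr_eq0 -normr_le0; apply: ler0_eps => e e0.
have cij i' j' := (continuous_distP _).1 (rsmooth_continuous
  (rsmooth_pderiv i' (rsmooth_pderiv j' sg))) x _ (divr_gt0 e0 (ltr0n R 2)).
have [d1 d10 H1] := cij i j; have [d2 d20 H2] := cij j i.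
have m0 : 0 < Num.min d1 d2 by rewrite lt_min d10.
have [k k0 k2] := double_lt m0.
have [y xy Ey] := step i j k (lt0r_neq0 k0).
have [z xz Ez] := step j i k (lt0r_neq0 k0).
have E : pderiv j (pderiv i g) y = pderiv i (pderiv j g) z.
  have aux (a b c d : R) : a - b - (c - d) = a - c - (b - d).
    by rewrite !opprB [LHS]addrACA [RHS]addrACA (addrC (- b)).
  have := aux (g (x + k *: e_ i + k *: e_ j)) (g (x + k *: e_ i)) (g (x + k *: e_ j)) (g x).
  rewrite Ey [x + _ + _]addrAC Ez.
  by move=> /(mulfI (lt0r_neq0 k0)) /(mulfI (lt0r_neq0 k0)).
have kd : 2 * `|k| < Num.min d1 d2.
  by rewrite (gtr0_norm k0).
have := H2 y (le_lt_trans xy (lt_le_trans kd _)).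
have := H1 z (le_lt_trans xz (lt_le_trans kd _)).
rewrite !ge_min !lexx ?orbT => /(_ isT) A /(_ isT) B.
have -> : pderiv i (pderiv j g) x - pderiv j (pderiv i g) x =
  (pderiv i (pderiv j g) x - pderiv i (pderiv j g) z) - (pderiv j (pderiv i g) x - pderiv j (pderiv i g) y).
  by rewrite E opprB addrA subrK.
rewrite (splitr e) -[leLHS]/(`|_|).
exact: le_trans (ler_normB _ _) (lerD (ltW A) (ltW B)).
Qed.

End RealCalculus.

(** * Increments, affine substitutions and the Leibniz rule *)

Section RealCalculus2.
Context {R : realType} {n : nat}.
Local Notation Rn := 'rV[R]_n.
Local Notation e_ := (@basis_vec R n).
Implicit Types (g h : Rn -> R) (x y d : Rn) (s t : seq 'I_n) (i j : 'I_n).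

Lemma basis_coord i j (c : R) : (c *: e_ i) 0 j = if j == i then c else 0.
Proof. by rewrite !mxE eqxx /=; case: (j == i); rewrite ?mulr1 ?mulr0. Qed.

(** The coordinates of [d] are switched on one at a time, each at the cost of one mean value; since
    the norm is the sup norm, all intermediate points stay within |d| of [x]. *)
Lemma rsmooth_incr g x d (M : R) : rsmooth g -> 0 <= M ->
  (forall i z, `|z - x| <= `|d| -> `|pderiv i g z| <= M) ->
  `|g (x + d) - g x| <= n%:R * M * `|d|.
Proof.
move=> sg M0 HM; pose p s : Rn := \row_j (if j \in s then d 0 j else 0).
have H s : uniq s -> `|g (x + p s) - g x| <= (size s)%:R * M * `|d|.
  elim: s => [_|i s IH /= /andP[is_ us]].
    have -> : p [::] = 0 by apply/rowP => j; rewrite !mxE.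
    by rewrite addr0 subrr normr0 !mul0r.
  have -> : x + p (i :: s) = x + p s + d 0 i *: e_ i.
    rewrite -addrA; congr (_ + _); apply/rowP => j.
    rewrite mxE [in RHS]mxE basis_coord mxE inE.
    by case: eqP => [->|_]; rewrite /= ?(negbTE is_) ?add0r ?addr0.
  have [c ci E] := pderiv_mvt (x + p s) i (d 0 i) sg.
  rewrite -(subrK (g (x + p s)) (g _)) -addrA E.
  apply: (le_trans (ler_normD _ _)).
  rewrite -natr1 2!mulrDl mul1r [leRHS]addrC lerD//; last exact: IH.
  rewrite normrM mulrC ler_pM// ?normr_coord//; apply: HM.
  rewrite -(addrA x) (addrC x) addrK; apply: normr_row_le => // j.
  rewrite mxE basis_coord mxE.
  have [->|ji] := eqVneq j i; first by rewrite (negbTE is_) add0r (le_trans ci)// normr_coord.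
  by rewrite addr0; case: ifP => // _; rewrite ?normr0// normr_coord.
have := H (enum 'I_n) (enum_uniq _); rewrite size_enum_ord.
suff -> : p (enum 'I_n) = d by [].
by apply/rowP => j; rewrite mxE mem_enum.
Qed.

(** Two nested mean values take the place of Taylor's formula, hence the constant [M] and not
    [M / 2]. *)
Lemma rsmooth_taylor g x i (h M : R) : rsmooth g -> 0 <= M ->
  (forall c : R, `|c| <= `|h| -> `|pderiv i (pderiv i g) (x + c *: e_ i)| <= M) ->
  `|g (x + h *: e_ i) - g x - h * pderiv i g x| <= M * `|h| ^+ 2.
Proof.
move=> sg M0 HM.
have [c ch ->] := pderiv_mvt x i h sg.
rewrite -mulrBr normrM expr2 mulrA mulrC ler_pM//.
have [c' ch' ->] := pderiv_mvt x i c (rsmooth_pderiv i sg).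
rewrite normrM mulrC ler_pM//; apply: HM; exact: le_trans ch' ch.
Qed.

Lemma rsmooth_dist g x i (e : R) : rsmooth g -> 0 < e ->
  exists2 d : R, 0 < d & forall h : R, `|h| < d ->
    `|g (x + h *: e_ i) - g x - h * pderiv i g x| <= e * `|h|.
Proof.
move=> sg e0.
have [d d0 Hd] := (continuous_distP _).1 (rsmooth_continuous (rsmooth_pderiv i sg)) x e e0.
exists d => // h hd; have [c ch ->] := pderiv_mvt x i h sg.
rewrite -mulrBr normrM mulrC ler_pM// distrC ltW// Hd//.
rewrite opprD addNKr normrN normrZ (le_lt_trans _ hd)// (le_trans _ ch)//.
by rewrite ler_piMr// normr_basis.
Qed.

(** A family of continuous functions indexed by words and related by differentiation yields at once
    that [F [::]] is smooth and that the other members are its derivatives. Affine substitutions,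
    products and convolutions are all treated this way. *)
Lemma rsmooth_family (F : seq 'I_n -> Rn -> R) :
  (forall s, continuous (F s)) ->
  (forall s i x, is_derive x (e_ i) (F s) (F (i :: s) x)) ->
  (forall s, foldr pderiv (F [::]) s = F s) /\ rsmooth (F [::]).
Proof.
move=> cF dF.
have E s : foldr pderiv (F [::]) s = F s.
  elim: s => // i s /= ->; apply/funext => x.
  by rewrite /pderiv; have := dF s i x => H; rewrite derive_val.
by split=> // s /=; rewrite E; split=> // i x; have := dF s i x => H.
Qed.

Lemma foldr_pderiv_perm g s t : rsmooth g -> perm_eq s t ->
  foldr pderiv g s = foldr pderiv g t.
Proof.
move=> sg.
(* By [pderivC] any letter of a word can be moved to its front. *)
have H u i : i \in u -> foldr pderiv g u = pderiv i (foldr pderiv g (rem i u)).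
  elim: u => // j u IH /=; rewrite inE => /predU1P[->|iu]; first by rewrite eqxx.
  have [->|_] := eqVneq j i; first by [].
  by rewrite (IH iu) /= (pderivC j i (rsmooth_foldr _ sg)).
elim: s t => [t|i s IH t st]; first by rewrite perm_sym => /perm_nilP ->.
have it : i \in t by rewrite -(perm_mem st) mem_head.
rewrite (H t i it) /=; congr pderiv; apply: IH.
by rewrite -(perm_cons i); apply: perm_trans st _; exact: perm_to_rem.
Qed.

Lemma continuous_affine g a (c : R) : continuous g ->
  continuous (fun y => g (a + c *: y)).
Proof.
move=> /continuous_distP cg; apply/continuous_distP => x e e0.
have [d d0 Hd] := cg (a + c *: x) e e0.
(* The added 1 covers the case [c = 0]. *)
have c10 : 0 < `|c| + 1 by rewrite ltr_wpDl.
exists (d / (`|c| + 1)) => [|y xy]; first exact: divr_gt0.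
apply: Hd; rewrite opprD addrACA subrr add0r -scalerBr normrZ.
move: xy; rewrite ltr_pdivlMr// mulrC; apply: le_lt_trans.
by rewrite ler_wpM2r// lerDl.
Qed.

Lemma rsmooth_affine g (a : Rn) (c : R) : rsmooth g ->
  (forall s, foldr pderiv (fun y => g (a + c *: y)) s =
    (fun y => c ^+ size s * foldr pderiv g s (a + c *: y))) /\
  rsmooth (fun y => g (a + c *: y)).
Proof.
move=> sg.
pose F s y := c ^+ size s * foldr pderiv g s (a + c *: y).
have E : F [::] = fun y => g (a + c *: y).
  by apply/funext => y; rewrite /F /= expr0 mul1r.
rewrite -E; apply: rsmooth_family => [s|s i x].
  have cg := @continuous_affine _ a c (rsmooth_continuous (rsmooth_foldr s sg)).
  by move=> x; exact: (cvgM (cvg_cst _) (cg x)).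
apply: is_derive_dist => e e0.
have C0 : 0 < `|c| ^+ (size s).+1 + 1 by rewrite ltr_wpDl.
have [d d0 Hd] := rsmooth_dist (a + c *: x) i (rsmooth_foldr s sg) (divr_gt0 e0 C0).
have c10 : 0 < `|c| + 1 by rewrite ltr_wpDl.
exists (d / (`|c| + 1)) => [|h hd]; first exact: divr_gt0.
have chd : `|c * h| < d.
  rewrite normrM; move: hd; rewrite ltr_pdivlMr// mulrC; apply: le_lt_trans.
  by rewrite ler_wpM2r// lerDl.
have := Hd _ chd; set u := foldr _ _ _; rewrite /F -/u /= => H.
have -> : c ^+ size s * u (a + c *: (x + h *: e_ i)) - c ^+ size s * u (a + c *: x) -
   h * (c ^+ (size s).+1 * pderiv i u (a + c *: x)) =
   c ^+ size s * (u (a + c *: x + (c * h) *: e_ i) - u (a + c *: x) - c * h * pderiv i u (a + c *: x)).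
  rewrite scalerDr scalerA addrA !mulrBr exprSr -!mulrA; congr (_ - _).
  by rewrite mulrCA; congr (_ * _); rewrite mulrCA.
rewrite normrM normrX; apply: (le_trans (ler_wpM2l (exprn_ge0 _ (normr_ge0 _)) H)).
have aux (p q e' z h' : R) : p * (e' * z * (q * h')) = e' * h' * (p * q * z) by ring.
rewrite normrM aux -exprSr -[leRHS]mulr1.
by rewrite ler_wpM2l ?mulr_ge0 ?(ltW e0)// ler_pdivrMr// mul1r lerDl.
Qed.

(** The radius is halved at each letter, so that equality in a neighbourhood survives
    differentiation. *)
Lemma foldr_pderiv_local g h s x (r : R) : 0 < r ->
  (forall y, `|x - y| < r -> g y = h y) ->
  foldr pderiv g s x = foldr pderiv h s x.
Proof.
elim: s x r => [x r r0 H|i s IH x r r0 H] /=.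
  by apply: H; rewrite subrr normr0.
apply: near_eq_derive; apply/nbhs_normP; exists (r / 2) => /= [|y].
  by rewrite divr_gt0.
move=> xy; apply: (IH _ (r / 2)) => [|z yz]; first by rewrite divr_gt0.
apply: H; rewrite -(subrKA y) (splitr r) (le_lt_trans (ler_normD _ _))//.
exact: ltrD.
Qed.

(** The 2^m ways of distributing the letters of a word of length m over two factors, listed with
    repetitions, so that the Leibniz rule needs no binomial coefficients. *)
Fixpoint leibniz s : seq (seq 'I_n * seq 'I_n) :=
  if s is i :: s' then
    [seq (i :: p.1, p.2) | p <- leibniz s'] ++ [seq (p.1, i :: p.2) | p <- leibniz s']
  else [:: ([::], [::])].

Lemma leibniz_size s p : p \in leibniz s ->
  (size p.1 <= size s)%N /\ (size p.2 <= size s)%N.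
Proof.
elim: s p => [p|i s IH p] /=; first by rewrite inE => /eqP ->.
rewrite mem_cat => /orP[] /mapP[q /IH[q1 q2] ->] /=; split => //; exact: ltnW.
Qed.

Definition lsum g h L x :=
  \sum_(p <- L) foldr pderiv g p.1 x * foldr pderiv h p.2 x.

Lemma lsum_continuous g h L : rsmooth g -> rsmooth h -> continuous (lsum g h L).
Proof.
move=> sg sh; elim: L => [|p L IH] x.
  have -> : lsum g h [::] = cst 0 by apply/funext => y; rewrite /lsum big_nil.
  exact: cst_continuous.
have -> : lsum g h (p :: L) =
    (fun y => foldr pderiv g p.1 y * foldr pderiv h p.2 y + lsum g h L y).
  by apply/funext => y; rewrite /lsum big_cons.
have c1 := rsmooth_continuous (rsmooth_foldr p.1 sg).
have c2 := rsmooth_continuous (rsmooth_foldr p.2 sh).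
exact: (cvgD (cvgM (c1 x) (c2 x)) (IH x)).
Qed.

Lemma rsmooth_lsum g h L i x : rsmooth g -> rsmooth h ->
  is_derive x (e_ i) (lsum g h L)
    (lsum g h ([seq (i :: p.1, p.2) | p <- L] ++ [seq (p.1, i :: p.2) | p <- L]) x).
Proof.
move=> sg sh; elim: L => [|p L IH].
  have -> : lsum g h [::] = cst 0 by apply/funext => y; rewrite /lsum big_nil.
  exact: is_derive_cst.
have -> : lsum g h (p :: L) = (foldr pderiv g p.1 * foldr pderiv h p.2) + lsum g h L.
  by apply/funext => y; rewrite /lsum big_cons.
have [_ /(_ i x) dg] := sg p.1; have [_ /(_ i x) dh] := sh p.2.
apply: (@is_derive_eq _ _ _ _ _ _ _
   ((foldr pderiv g p.1 x *: pderiv i (foldr pderiv h p.2) x +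
     foldr pderiv h p.2 x *: pderiv i (foldr pderiv g p.1) x) +
     lsum g h ([seq (i :: p.1, p.2) | p <- L] ++ [seq (p.1, i :: p.2) | p <- L]) x)).
  exact: (is_deriveD (DeriveDef (derivableM dg dh) (deriveM dg dh)) IH).
rewrite /lsum /= big_cons !big_cat /= big_cons /=.
rewrite [X in X + _ = _]addrC -!addrA; congr (_ + _); first by rewrite mulrC.
by rewrite addrCA.
Qed.

Lemma rsmoothM g h : rsmooth g -> rsmooth h ->
  (forall s, foldr pderiv (fun x => g x * h x) s = lsum g h (leibniz s)) /\
  rsmooth (fun x => g x * h x).
Proof.
move=> sg sh; have E : (fun x => g x * h x) = lsum g h (leibniz [::]).
  by apply/funext => x; rewrite /lsum big_seq1.
rewrite E; apply: (rsmooth_family (F := fun s => lsum g h (leibniz s))) => [s x|s i x].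
  exact: lsum_continuous.
exact: rsmooth_lsum.
Qed.

End RealCalculus2.

(** * Complex-valued functions and their derivatives along words *)

Section ComplexCalculus.
Context {R : realType} {n : nat}.
Local Notation Rn := 'rV[R]_n.
Local Notation e_ := (@basis_vec R n).
Implicit Types (f g : Rn -> R[i]) (x y d : Rn) (s t : seq 'I_n) (i j : 'I_n).

Lemma normc_le_abs (z : R[i]) : normc z <= `|complex.Re z| + `|complex.Im z|.
Proof.
case: z => a b /=; rewrite -[leRHS]ger0_norm ?addr_ge0// -sqrtr_sqr ler_sqrt ?sqr_ge0//.
rewrite sqrrD !real_normK ?num_real// addrAC lerDl mulrn_wge0// mulr_ge0//.
Qed.

Lemma abs_Re_le (z : R[i]) : `|complex.Re z| <= normc z.
Proof.
by case: z => a b /=; rewrite -sqrtr_sqr ler_sqrt ?addr_ge0 ?sqr_ge0// lerDl sqr_ge0.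
Qed.

Lemma abs_Im_le (z : R[i]) : `|complex.Im z| <= normc z.
Proof.
by case: z => a b /=; rewrite -sqrtr_sqr ler_sqrt ?addr_ge0 ?sqr_ge0// lerDr sqr_ge0.
Qed.

(** Real and imaginary parts are estimated separately; the factors 2 in the complex estimates below
    come from here. *)
Lemma normc_le (z : R[i]) (M : R) :
  `|complex.Re z| <= M -> `|complex.Im z| <= M -> normc z <= 2 * M.
Proof.
move=> H1 H2; apply: (le_trans (normc_le_abs z)).
by rewrite mulrDl mul1r lerD.
Qed.

Lemma normc_real (c : R) : normc c%:C = `|c|.
Proof. by rewrite /= expr0n addr0 sqrtr_sqr. Qed.

Lemma complex_eq (z w : R[i]) : complex.Re z = complex.Re w -> complex.Im z = complex.Im w -> z = w.
Proof. by case: z w => a b [c d] /= -> ->. Qed.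

Lemma cReD (z w : R[i]) : complex.Re (z + w) = complex.Re z + complex.Re w.
Proof. by case: z w => a b [c d]. Qed.
Lemma cImD (z w : R[i]) : complex.Im (z + w) = complex.Im z + complex.Im w.
Proof. by case: z w => a b [c d]. Qed.
Lemma cReN (z : R[i]) : complex.Re (- z) = - complex.Re z.
Proof. by case: z. Qed.
Lemma cImN (z : R[i]) : complex.Im (- z) = - complex.Im z.
Proof. by case: z. Qed.
Lemma cReZ (c : R) (z : R[i]) : complex.Re (c%:C * z) = c * complex.Re z.
Proof. by case: z => a b /=; rewrite mul0r subr0. Qed.
Lemma cImZ (c : R) (z : R[i]) : complex.Im (c%:C * z) = c * complex.Im z.
Proof. by case: z => a b /=; rewrite mul0r addr0. Qed.
Lemma cReM (z w : R[i]) : complex.Re (z * w) =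
  complex.Re z * complex.Re w - complex.Im z * complex.Im w.
Proof. by case: z w => a b [c d]. Qed.
Lemma cImM (z w : R[i]) : complex.Im (z * w) =
  complex.Re z * complex.Im w + complex.Im z * complex.Re w.
Proof. by case: z w => a b [c d]. Qed.

(* Words of directions compose by concatenation; for smooth functions they give
   the derivatives of [partial], by Clairaut's theorem. *)
Definition cderiv s f : Rn -> R[i] := fun x =>
  foldr pderiv (fun y => complex.Re (f y)) s x +i*
  foldr pderiv (fun y => complex.Im (f y)) s x.

Lemma partial_cderiv (a : multi_index n) f : partial a f = cderiv (word a) f.
Proof. by apply/funext => x; rewrite /partial !rpartialE. Qed.

Lemma cderiv0 f : cderiv [::] f = f.
Proof. by apply/funext => x; rewrite /cderiv /=; case: (f x). Qed.

Lemma cderiv_cat s t f : cderiv s (cderiv t f) = cderiv (s ++ t) f.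
Proof. by apply/funext => x; rewrite /cderiv !foldr_cat. Qed.

Lemma smooth_cderiv s f : smooth f -> smooth (cderiv s f).
Proof. by move=> [sr si]; split; rewrite /cderiv /=; exact: rsmooth_foldr. Qed.

Lemma cderiv_perm s t f : smooth f -> perm_eq s t -> cderiv s f = cderiv t f.
Proof.
move=> [sr si] st; apply/funext => x.
by rewrite /cderiv (foldr_pderiv_perm sr st) (foldr_pderiv_perm si st).
Qed.

Lemma size_word (a : multi_index n) : size (word a) = mlength a.
Proof.
rewrite /word /mlength size_flatten /shape sumnE 2!big_map big_enum /=.
by apply: eq_bigr => i _; exact: size_nseq.
Qed.

Definition word_index s : multi_index n := [ffun i => count_mem i s].

Lemma perm_word_index s : perm_eq s (word (word_index s)).
Proof.
apply/allP => i _ /=; apply/eqP.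
rewrite /word count_flatten -map_comp sumnE big_map big_enum /=.
rewrite (bigD1 i)//= count_nseq /= eqxx mul1n ffunE big1 ?addn0// => j ji.
by rewrite count_nseq /= (negbTE ji).
Qed.

Lemma cderiv_partial s f : smooth f -> cderiv s f = partial (word_index s) f.
Proof. by move=> sf; rewrite partial_cderiv (cderiv_perm sf (perm_word_index s)). Qed.

Lemma mlength_word_index s : mlength (word_index s) = size s.
Proof. by rewrite -size_word (perm_size (perm_word_index s)). Qed.

Lemma cderivD s f g : smooth f -> smooth g ->
  cderiv s (fun x => f x + g x) = (fun x => cderiv s f x + cderiv s g x).
Proof.
move=> sf sg; rewrite (cderiv_partial _ (smoothD sf sg)) partialD//.
by rewrite !cderiv_partial.
Qed.

Lemma cderivZ s (c : R[i]) f : smooth f ->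
  cderiv s (fun x => c * f x) = (fun x => c * cderiv s f x).
Proof.
by move=> sf; rewrite (cderiv_partial _ (smoothZ c sf)) partialZ// !cderiv_partial.
Qed.

Lemma cderiv_lin s (c : R[i]) f g : smooth f -> smooth g ->
  cderiv s (fun x => c * f x + g x) = (fun x => c * cderiv s f x + cderiv s g x).
Proof. by move=> sf sg; rewrite (cderivD s (smoothZ c sf) sg) (cderivZ s c sf). Qed.

Lemma smooth_lin (c : R[i]) f g : smooth f -> smooth g -> smooth (fun x => c * f x + g x).
Proof. by move=> sf sg; exact: smoothD (smoothZ c sf) sg. Qed.

Lemma smoothB f g : smooth f -> smooth g -> smooth (fun x => f x - g x).
Proof.
move=> sf sg; rewrite (_ : (fun x => _) = fun x => f x + (-1) * g x).
  exact: smoothD sf (smoothZ _ sg).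
by apply/funext => x; rewrite mulN1r.
Qed.

Lemma cderivB s f g : smooth f -> smooth g ->
  cderiv s (fun x => f x - g x) = (fun x => cderiv s f x - cderiv s g x).
Proof.
move=> sf sg; rewrite (_ : (fun x => _) = fun x => f x + (-1) * g x).
  rewrite (cderivD _ sf (smoothZ _ sg)) cderivZ//.
  by apply/funext => x; rewrite mulN1r.
by apply/funext => x; rewrite mulN1r.
Qed.

Lemma smooth_affine f (a : Rn) (c : R) : smooth f ->
  smooth (fun y => f (a + c *: y)).
Proof.
by move=> [sr si]; split; [exact: (rsmooth_affine a c sr).2|exact: (rsmooth_affine a c si).2].
Qed.

Lemma cderiv_affine s f (a : Rn) (c : R) : smooth f ->
  cderiv s (fun y => f (a + c *: y)) =
  (fun y => (c ^+ size s)%:C * cderiv s f (a + c *: y)).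
Proof.
move=> [sr si]; apply/funext => x; rewrite /cderiv.
rewrite (rsmooth_affine a c sr).1 (rsmooth_affine a c si).1.
by apply: complex_eq; rewrite ?cReZ ?cImZ.
Qed.

Lemma cderiv_local s f g x (r : R) : 0 < r ->
  (forall y, `|x - y| < r -> f y = g y) -> cderiv s f x = cderiv s g x.
Proof.
move=> r0 H; apply: complex_eq => /=; apply: (foldr_pderiv_local _ r0) => y /H -> //.
Qed.

Lemma cderiv_cst0 s : cderiv s (fun _ : Rn => 0) = fun=> 0.
Proof.
apply/funext => x; have := cderivZ s 0 smooth0.
rewrite (_ : (fun x => 0 * _) = fun=> 0); last by apply/funext => y; rewrite mul0r.
by move=> ->; rewrite mul0r.
Qed.

Lemma cderiv_eq0 s f x (r : R) : 0 < r ->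
  (forall y, `|x - y| < r -> f y = 0) -> cderiv s f x = 0.
Proof. by move=> r0 H; rewrite (cderiv_local _ r0 H) cderiv_cst0. Qed.

Lemma smooth_incr f x d (M : R) : smooth f -> 0 <= M ->
  (forall i z, `|z - x| <= `|d| -> normc (cderiv [:: i] f z) <= M) ->
  normc (f (x + d) - f x) <= 2 * (n%:R * M * `|d|).
Proof.
move=> [sr si] M0 H; apply: normc_le; rewrite ?cReD ?cImD ?cReN ?cImN.
  apply: (rsmooth_incr sr) => // i z /(H i); apply: le_trans.
  exact: (abs_Re_le (cderiv [:: i] f z)).
apply: (rsmooth_incr si) => // i z /(H i); apply: le_trans.
exact: (abs_Im_le (cderiv [:: i] f z)).
Qed.

Lemma smooth_taylor f x i (h M : R) : smooth f -> 0 <= M ->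
  (forall c : R, `|c| <= `|h| -> normc (cderiv [:: i; i] f (x + c *: e_ i)) <= M) ->
  normc (f (x + h *: e_ i) - f x - h%:C * cderiv [:: i] f x) <= 2 * (M * `|h| ^+ 2).
Proof.
move=> [sr si] M0 H; apply: normc_le; rewrite ?cReD ?cImD ?cReN ?cImN ?cReZ ?cImZ ?cReD ?cImD ?cReN ?cImN.
  apply: (rsmooth_taylor sr) => // c /H; apply: le_trans.
  exact: (abs_Re_le (cderiv [:: i; i] f (x + c *: e_ i))).
apply: (rsmooth_taylor si) => // c /H; apply: le_trans.
exact: (abs_Im_le (cderiv [:: i; i] f (x + c *: e_ i))).
Qed.

Lemma smooth_bounded_ball f (r : R) : smooth f -> exists2 M : R, 0 <= M &
  forall x, `|x| <= r -> normc (f x) <= M.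
Proof.
have H (g : Rn -> R) : continuous g -> exists2 M : R, 0 <= M & forall x, `|x| <= r -> `|g x| <= M.
  move=> cg; have cK : compact [set x : Rn | `|x| <= r].
    apply: bounded_closed_compact; last first.
      have -> : [set x : Rn | `|x| <= r] = (fun x : Rn => `|x|) @^-1` [set t | t <= r] by [].
      apply: closed_comp => [x _|]; last exact: closed_le.
      exact: norm_continuous.
    exists r; split; first exact: num_real.
    by move=> M rM x /= /le_trans; apply; exact: ltW.
  have /compact_bounded[M [Mr HM]] := continuous_compact (continuous_subspaceT cg) cK.
  exists (Num.max 0 (M + 1)) => [|x xr]; first by rewrite le_max lexx.
  rewrite le_max; apply/orP; right; apply: (HM (M + 1)); first by rewrite ltrDl.
  by exists x.
move=> [sr si].
have [M M0 HM] := H _ (rsmooth_continuous sr).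
have [N N0 HN] := H _ (rsmooth_continuous si).
exists (M + N) => [|x xr]; first exact: addr_ge0.
by apply: (le_trans (normc_le_abs _)); rewrite lerD ?HM ?HN.
Qed.

End ComplexCalculus.

(** * Integrals of functions with weighted Lipschitz bounds *)

Section OneDim.
Context {R : realType}.
Local Notation mu := (@lebesgue_measure R).
Implicit Types (g : R -> R) (M t a l : R).

(** [oneDsqr t] is 1 + t^2, so this is the Cauchy density up to normalization: integrable, but
    decaying only like a power, so that Schwartz functions are dominated by it. *)
Definition kappa1 (t : R) : R := (oneDsqr t)^-1.

Lemma kappa1_ge0 t : 0 <= kappa1 t. Proof. by rewrite invr_ge0. Qed.

Lemma kappa1_le1 t : kappa1 t <= 1. Proof. exact: oneDsqrV_le1. Qed.

Lemma continuous_kappa1 : continuous kappa1.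
Proof. exact: continuous_oneDsqrV. Qed.

Lemma integrable_kappa1 : mu.-integrable setT (EFin \o kappa1).
Proof.
apply/integrableP; split.
  by apply/measurable_EFinP; apply: continuous_measurable_fun; exact: continuous_kappa1.
have -> : (\int[mu]_x `|(EFin \o kappa1) x| = \int[mu]_x (kappa1 x)%:E)%E.
  by apply: eq_integral => x _ /=; rewrite ger0_norm// kappa1_ge0.
rewrite ge0_symfun_integralT//; first last.
- by move=> x; rewrite /kappa1 /oneDsqr /= sqrrN.
- exact: continuous_kappa1.
- exact: kappa1_ge0.
have -> : [set x : R | 0 <= x] = `[0, +oo[%classic by rewrite set_itvcy.
rewrite /kappa1 integral0y_oneDsqr -EFinM; exact: ltry.
Qed.

(** The decay makes tails uniformly small, the Lipschitz part makes Riemann sums converge at a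
    uniform rate. Increments are restricted to distance 1, where the weight at one of the two points
    can serve for both. *)
Definition wlip1 M g : Prop := (forall t, `|g t| <= M * kappa1 t) /\
  (forall t t', `|t - t'| <= 1 -> `|g t - g t'| <= M * `|t - t'| * kappa1 t).

Lemma wlip1_ge0 M g : wlip1 M g -> 0 <= M.
Proof.
move=> [/(_ 0) H _]; have := le_trans (normr_ge0 _) H.
by rewrite pmulr_lge0// invr_gt0; exact: lt_le_trans ltr01 (oneDsqr_ge1 _).
Qed.

Lemma wlip1_dist M g t t' : wlip1 M g -> `|t - t'| <= 1 -> `|g t - g t'| <= M * `|t - t'|.
Proof.
move=> Mg tt'; apply: (le_trans (Mg.2 _ _ tt')).
by rewrite ler_piMr ?kappa1_le1// mulr_ge0// (wlip1_ge0 Mg).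
Qed.

Lemma wlip1_continuous M g : wlip1 M g -> continuous g.
Proof.
move=> Mg; apply/continuous_distP => x e e0.
have M1 : 0 < M + 1 by rewrite ltr_wpDl// (wlip1_ge0 Mg).
exists (Num.min 1 (e / (M + 1))) => [|y]; first by rewrite lt_min ltr01 divr_gt0.
rewrite lt_min => /andP[xy1]; rewrite ltr_pdivlMr// => xy.
apply: le_lt_trans xy; apply: (le_trans (wlip1_dist Mg (ltW xy1))).
by rewrite mulrC ler_wpM2l// lerDl.
Qed.

Lemma wlip1_measurable M g : wlip1 M g -> measurable_fun setT g.
Proof. by move=> /wlip1_continuous; exact: continuous_measurable_fun. Qed.

Lemma wlip1_integrable M g : wlip1 M g -> mu.-integrable setT (EFin \o g).
Proof.
move=> Mg; have M0 := wlip1_ge0 Mg.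
apply: (@le_integrable _ _ _ mu setT measurableT _ (EFin \o (fun t => M * kappa1 t)%R)) => //.
- by apply/measurable_EFinP; exact: wlip1_measurable Mg.
- move=> t _ /=; rewrite lee_fin [leRHS]ger0_norm ?mulr_ge0 ?kappa1_ge0//; exact: Mg.1.
- have -> : EFin \o (fun t => M * kappa1 t) = (fun t => M%:E * (EFin \o kappa1) t)%E.
    by apply/funext => t /=; rewrite EFinM.
  by apply: integrableZl => //; exact: integrable_kappa1.
Qed.

Definition kappa1_mass : R := Rintegral mu setT kappa1.

Lemma kappa1_mass_ge0 : 0 <= kappa1_mass.
Proof. by apply: Rintegral_ge0 => t _; exact: kappa1_ge0. Qed.

Lemma Rintegral_kappa1_bound (D : set R) M g : measurable D ->
  measurable_fun setT g -> (forall t, `|g t| <= M * kappa1 t) ->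
  `|Rintegral mu D g| <= M * Rintegral mu D kappa1.
Proof.
move=> mD mg Hg.
have ik : mu.-integrable D (EFin \o kappa1).
  by apply: integrableS integrable_kappa1.
have M0 : 0 <= M.
  by have := le_trans (normr_ge0 _) (Hg 0);
  rewrite pmulr_lge0// invr_gt0; exact: lt_le_trans ltr01 (oneDsqr_ge1 _).
have iMk : mu.-integrable D (EFin \o (fun t => M * kappa1 t)).
  have -> : EFin \o (fun t => M * kappa1 t) = (fun t => M%:E * (EFin \o kappa1) t)%E.
    by apply/funext => t /=; rewrite EFinM.
  exact: integrableZl.
have ig : mu.-integrable D (EFin \o g).
  apply: (@le_integrable _ _ _ mu D mD _ (EFin \o (fun t => M * kappa1 t)%R)) => //.
  - by apply/measurable_EFinP; apply: measurable_funS mg.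
  - move=> t _ /=; rewrite lee_fin [leRHS]ger0_norm ?mulr_ge0 ?kappa1_ge0//; exact: Hg.
have H := @le_normr_Rintegral _ _ _ mu D g mD ig.
apply: (le_trans H).
rewrite -RintegralZl//; apply: le_Rintegral => //.
exact: integrable_abse ig.
Qed.

Lemma wlip1_bound M M' g : wlip1 M' g -> (forall t, `|g t| <= M * kappa1 t) ->
  `|Rintegral mu setT g| <= M * kappa1_mass.
Proof. move=> Mg; apply: Rintegral_kappa1_bound => //; exact: wlip1_measurable Mg. Qed.

Lemma kappa1_tail (e : R) : 0 < e -> exists k : nat,
  Rintegral mu (~` `]- k%:R, k%:R]%classic) kappa1 <= e.
Proof.
move=> e0; pose D k : set R := ~` `]- k%:R, k%:R]%classic.
have mD k : measurable (D k) by apply: measurableC.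
pose f_ k t := ((EFin \o kappa1) \_ (D k)) t.
have [|||||_ _] := @dominated_convergence _ _ _ mu setT measurableT f_ (cst 0%E) (EFin \o kappa1).
- move=> k; apply/(measurable_restrictT _ (mD k)).
  by have /integrableP[+ _] := integrable_kappa1; exact: measurable_funS.
- exact: measurable_cst.
- apply: aeW => t _; apply: cvg_near_cst.
  near=> k; rewrite /f_ patchE; case: ifPn => //.
  rewrite inE => -[].
  rewrite /= in_itv /=.
  have : `|t| < k%:R by near: k; exact: nbhs_infty_gtr.
  by rewrite ltr_norml => /andP[-> /ltW ->].
- exact: integrable_kappa1.
- apply: aeW => t k _; rewrite /f_ patchE; case: ifPn => _ /=.
    by rewrite ger0_norm// kappa1_ge0.
  by rewrite normr0 lee_fin kappa1_ge0.
rewrite integral0 => /fine_cvgP[_ /cvgrPdist_le/(_ e e0)] [k _ /(_ k (leqnn _))] /=.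
rewrite sub0r normrN => H; exists k.
apply: le_trans H; apply: le_trans (ler_norm _).
by rewrite /Rintegral -integral_mkcond.
Unshelve. all: by end_near. Qed.

End OneDim.

(** * Riemann sums and substitution on the real line *)

Section OneDimQuadrature.
Context {R : realType}.
Local Notation mu := (@lebesgue_measure R).
Implicit Types (g : R -> R) (M t a l : R).

(** On each of the [N] cells of length [h] the integrand differs from its value at the left end by
    at most [M * h]. *)
Lemma wlip1_riemann_sum M g a (h : R) (N : nat) : wlip1 M g -> 0 <= h <= 1 ->
  `|Rintegral mu `]a, a + N%:R * h]%classic g - \sum_(i < N) h * g (a + i%:R * h)|
  <= N%:R * (M * h * h).
Proof.
move=> Mg /andP[h0 h1]; have M0 := wlip1_ge0 Mg.
have ig (D : set R) : measurable D -> mu.-integrable D (EFin \o g).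
  by move=> mD; apply: integrableS (wlip1_integrable Mg).
elim: N => [|N IH].
  by rewrite mul0r addr0 set_itvoc0 Rintegral_set0 big_ord0 subr0 normr0 mul0r.
pose b := a + N%:R * h.
have bE : a + N.+1%:R * h = b + h by rewrite -natr1 mulrDl mul1r addrA.
have -> : Rintegral mu `]a, a + N.+1%:R * h]%classic g =
    Rintegral mu `]a, b]%classic g + Rintegral mu `]b, b + h]%classic g.
  rewrite bE -(@Rintegral_itvB _ g (BRight a) (BRight (b + h)) b).
  - by rewrite addrCA subrr addr0.
  - exact: ig.
  - by rewrite bnd_simp lerDl mulr_ge0.
  - by rewrite bnd_simp lerDl.
rewrite big_ord_recr /= opprD addrACA -natr1 mulrDl mul1r.
apply: (le_trans (ler_normD _ _)); apply: lerD; first exact: IH.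
rewrite -/b.
have mI : measurable (`]b, b + h]%classic : set R) by [].
have mEE : mu `]b, b + h]%classic = h%:E.
  rewrite lebesgue_measure_itv /= lte_fin ltrDl; case: ltP => hh.
    by rewrite -EFinB /= addrC addKr.
  by rewrite (@le_anti _ _ h 0)// hh h0.
have mE : fine (mu `]b, b + h]%classic) = h by rewrite mEE.
have ic (c : R) : mu.-integrable `]b, b + h]%classic (EFin \o cst c).
  apply: (@measurable_bounded_integrable _ _ _ mu) => //.
    by apply: (@le_lt_trans _ _ h%:E); [rewrite le_eqVlt; apply/orP; left; apply/eqP; exact: mEE|exact: ltry].
  exact: bounded_cst.
have -> : h * g b = Rintegral mu `]b, b + h]%classic (cst (g b)).
  by rewrite Rintegral_cst// mE mulrC.
rewrite -RintegralB//; [|exact: ig|exact: ic].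
have iB : mu.-integrable `]b, b + h]%classic (EFin \o (fun t => g t - g b)).
  have -> : EFin \o (fun t => g t - g b) = ((EFin \o g) \- (EFin \o cst (g b)))%E.
    by apply/funext => t.
  by apply: integrableB => //; exact: ig.
have H := @le_normr_Rintegral _ _ _ mu _ _ mI iB.
apply: (le_trans H).
have -> : M * h * h = Rintegral mu `]b, b + h]%classic (cst (M * h)).
  by rewrite Rintegral_cst// mE.
apply: le_Rintegral => //; [exact: integrable_abse iB|exact: ic|].
move=> t; rewrite /= in_itv /= => /andP[bt tb].
have tb0 : 0 <= t - b by rewrite subr_ge0 ltW.
have tbh : `|t - b| <= h by rewrite ger0_norm// lerBlDl.
apply: (le_trans (wlip1_dist Mg (le_trans tbh h1))).
by rewrite ler_wpM2l.
Qed.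

(** Nodes and weights depend on the tolerance [d] only, not on [g]. This uniformity is what later
    allows a functional to be interchanged with the integral. *)
Lemma quadrature1 (d : R) : 0 < d -> exists s : seq (R * R), forall M g, wlip1 M g ->
  `|Rintegral mu setT g - \sum_(p <- s) p.1 * g p.2| <= d * M.
Proof.
move=> d0; have d2 : 0 < d / 2 by rewrite divr_gt0.
have [k Hk] := kappa1_tail d2; pose A : R := k%:R.
have A0 : 0 <= A by [].
(* The first summand ensures h <= 1, as the Lipschitz bound requires; the second ensures N h^2 = 4
   A^2 / N <= d / 2. The other half of [d] pays for the tail outside ]-A, A]. *)
pose N := (Num.truncn (2 * A + 8 * A ^+ 2 / d)).+1; pose h : R := 2 * A / N%:R.
have N0 : 0 < N%:R :> R by [].
have HN : 2 * A + 8 * A ^+ 2 / d <= N%:R.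
  by apply: ltW; rewrite /N truncnS_gt.
have Q0 : 0 <= 8 * A ^+ 2 / d by rewrite divr_ge0 ?mulr_ge0 ?sqr_ge0 ?(ltW d0).
have h0 : 0 <= h by rewrite divr_ge0// mulr_ge0.
have h1 : h <= 1.
  by rewrite ler_pdivrMr// mul1r; apply: le_trans HN; rewrite lerDl.
have Nh : N%:R * h = 2 * A by rewrite mulrC divfK// gt_eqF.
have Nhh : N%:R * h * h <= d / 2.
  rewrite Nh /h mulrA ler_pdivrMr//.
  have : 8 * A ^+ 2 / d <= N%:R by apply: le_trans HN; rewrite lerDr mulr_ge0.
  rewrite ler_pdivrMr// => H.
  have -> : 2 * A * (2 * A) = 8 * A ^+ 2 / 2 by rewrite expr2; lra.
  have -> : d / 2 * N%:R = (N%:R * d) / 2 by rewrite mulrC mulrA.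
  by rewrite ler_pM2r ?invr_gt0.
exists [seq (h, - A + i%:R * h) | i <- iota 0 N] => M g Mg.
have M0 := wlip1_ge0 Mg.
rewrite big_map -[X in \sum_(i <- X) _](_ : index_iota 0 N = _); last by rewrite /index_iota subn0.
rewrite big_mkord /=.
have mI : measurable (`]- A, A]%classic : set R) by [].
have -> : Rintegral mu setT g = Rintegral mu `]- A, A]%classic g + Rintegral mu (~` `]- A, A]%classic) g.
  rewrite -Rintegral_setU//; first by rewrite setUv.
  - exact: measurableC.
  - by rewrite setUv; exact: wlip1_integrable Mg.
  - by rewrite disj_set2E setICr.
rewrite addrAC; apply: (le_trans (ler_normD _ _)).
rewrite (splitr d) mulrDl; apply: lerD.
  have := @wlip1_riemann_sum M g (- A) h N Mg.
  rewrite Nh [X in - A + X]mulrDl mul1r addKr h0 h1 => /(_ isT) /le_trans; apply.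
  have -> : N%:R * (M * h * h) = (N%:R * h * h) * M by ring.
  by rewrite ler_wpM2r.
have /le_trans := @Rintegral_kappa1_bound _ (~` `]- A, A]%classic) M g (measurableC mI)
  (wlip1_measurable Mg) Mg.1.
by apply; rewrite mulrC ler_wpM2r.
Qed.

Lemma wlip1D a l M M' g g' : wlip1 M g -> wlip1 M' g' ->
  wlip1 (`|a| * M + `|l| * M') (fun t => a * g t + l * g' t).
Proof.
move=> [g0 g1] [g0' g1']; split=> [t|t t' tt'].
  apply: (le_trans (ler_normD _ _)); rewrite !normrM mulrDl -!mulrA.
  by rewrite lerD ?ler_wpM2l.
have -> : a * g t + l * g' t - (a * g t' + l * g' t') =
   a * (g t - g t') + l * (g' t - g' t') by ring.
apply: (le_trans (ler_normD _ _)); rewrite !normrM !mulrDl -!mulrA.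
by rewrite lerD ?ler_wpM2l// mulrA ?g1 ?g1'.
Qed.

Lemma Rintegral_lin a l M M' g g' : wlip1 M g -> wlip1 M' g' ->
  Rintegral mu setT (fun t => a * g t + l * g' t) =
  a * Rintegral mu setT g + l * Rintegral mu setT g'.
Proof.
move=> Mg Mg'.
have iZ c N f : wlip1 N f -> mu.-integrable setT (EFin \o (fun t => c * f t)).
  move=> Nf; have -> : EFin \o (fun t => c * f t) = (fun t => c%:E * (EFin \o f) t)%E.
    by apply/funext => t /=; rewrite EFinM.
  by apply: integrableZl => //; exact: wlip1_integrable Nf.
rewrite RintegralD//; [|exact: iZ Mg|exact: iZ Mg'].
by rewrite !RintegralZl//; [exact: wlip1_integrable Mg'|exact: wlip1_integrable Mg].
Qed.

(** Substitution is applied to the nonnegative functions g + M kappa1 and M kappa1, whose difference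
    is [g], and the results are subtracted. *)
Lemma Rintegral_affine a l M g : 0 < l -> wlip1 M g ->
  Rintegral mu setT g = l * Rintegral mu setT (fun t => g (a + l * t)).
Proof.
move=> l0 Mg; have M0 := wlip1_ge0 Mg.
pose F (t : R) := a + l * t.
have dF : forall t : R, is_derive t 1 F l.
  move=> t; have -> : F = cst a \+ (l \*: id) by [].
  apply: is_derive_eq; by rewrite add0r [_ *: _]mulr1.
have F'E : (F^`())%classic = cst l.
  by apply/funext => t; rewrite derive1E; have := dF t => ?; rewrite derive_val.
have key (G : R -> R) : continuous G -> (forall x, 0 <= G x) ->
    (\int[mu]_x (G x)%:E = \int[mu]_x (l * G (F x))%:E)%E.
  move=> cG G0.
  rewrite (@increasing_ge0_integration_by_substitutionT _ F G)//.
  - by apply: eq_integral => t _; rewrite F'E /= mulrC.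
  - by move=> x y xy; rewrite /F ltrD2l ltr_pM2l.
  - by rewrite F'E => x; exact: cvg_cst.
  - by rewrite F'E; exact: is_cvg_cst.
  - by rewrite F'E; exact: is_cvg_cst.
  - have H : (l * x)%R @[x --> -oo] --> -oo by apply: gt0_cvgMrNy => //; exact: cvg_id.
    apply/cvgrNyPle => A; have /cvgrNyPle/(_ (A - a)) := H.
    by apply: filterS => x; rewrite lerBrDl.
  - have H : (l * x)%R @[x --> +oo] --> +oo by apply: gt0_cvgMry => //; exact: cvg_id.
    apply/cvgryPge => A; have /cvgryPge/(_ (A - a)) := H.
    by apply: filterS => x; rewrite lerBlDl.
pose k t := M * kappa1 t; pose G t := g t + k t.
have k0 t : 0 <= k t by rewrite mulr_ge0 ?kappa1_ge0.
have G0 t : 0 <= G t.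
  by have := Mg.1 t; rewrite ler_norml /G -lerBlDr sub0r => /andP[].
have ck : continuous k.
  by move=> t; apply: (@continuousM R R (cst M) kappa1); [exact: cst_continuous|exact: continuous_kappa1].
have cg := wlip1_continuous Mg.
have cG : continuous G by move=> t; exact: (cvgD (cg t) (ck t)).
have ik : mu.-integrable setT (EFin \o k).
  have -> : EFin \o k = (fun t => M%:E * (EFin \o kappa1) t)%E.
    by apply/funext => t /=; rewrite EFinM.
  by apply: integrableZl => //; exact: integrable_kappa1.
have ig := wlip1_integrable Mg.
have iG : mu.-integrable setT (EFin \o G).
  have -> : EFin \o G = ((EFin \o g) \+ (EFin \o k))%E by apply/funext => t.
  exact: integrableD.
have cF : continuous F.
  move=> t; apply: (@continuousD R R^o R (cst a) (fun t => l * t)); first exact: cst_continuous.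
  by apply: (@continuousM R R (cst l) id); [exact: cst_continuous|exact: cvg_id].
have trans (H : R -> R) : continuous H -> (forall x, 0 <= H x) -> mu.-integrable setT (EFin \o H) ->
   mu.-integrable setT (EFin \o (H \o F)) /\
   Rintegral mu setT H = l * Rintegral mu setT (H \o F).
  move=> cH H0 iH.
  have cHF : continuous (H \o F) by move=> t; apply: continuous_comp; [exact: cF|exact: cH].
  have ilHF : mu.-integrable setT (EFin \o (fun t => l * H (F t))).
    apply/integrableP; split.
      apply/measurable_EFinP; apply: continuous_measurable_fun => t.
      by apply: (@continuousM R R (cst l) (H \o F)); [exact: cst_continuous|exact: cHF].
    have -> : (\int[mu]_x `|(EFin \o (fun t => (l * H (F t))%R)) x| =
        \int[mu]_x (l * H (F x))%:E)%E.
      by apply: eq_integral => x _ /=; rewrite ger0_norm// mulr_ge0// ltW.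
    by rewrite -key//; exact: integrable_lty.
  have iHF : mu.-integrable setT (EFin \o (H \o F)).
    have -> : EFin \o (H \o F) = (fun t => (l^-1)%:E * (EFin \o (fun t => (l * H (F t))%R)) t)%E.
      by apply/funext => t /=; rewrite -EFinM mulKf// gt_eqF.
    exact: integrableZl.
  by split => //; rewrite -RintegralZl// /Rintegral key.
have [iGF EG] := trans G cG G0 iG.
have [ikF Ek] := trans k ck k0 ik.
have gE : g = fun t => G t - k t by apply/funext => t; rewrite /G addrK.
rewrite [in LHS]gE [in RHS]gE RintegralB// EG Ek -mulrBr.
by rewrite -RintegralB.
Qed.

End OneDimQuadrature.

(** * Iterated integrals over R^n *)

Section MultiDim.
Context {R : realType}.
Local Notation mu := (@lebesgue_measure R).
Local Notation c1 := (@kappa1_mass R).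

Definition kappa n (x : 'rV[R]_n) : R := \prod_i kappa1 (x 0 i).

(* The weight [kappa] is integrable, and the Lipschitz bound weighted by it makes
   finite sums approximate [rintegral F] uniformly in [F]: this replaces Fubini's
   theorem and differentiation under the integral sign. *)
Definition wlip n (M : R) (F : 'rV[R]_n -> R) : Prop :=
  (forall x, `|F x| <= M * kappa x) /\
  (forall x x', `|x - x'| <= 1 -> `|F x - F x'| <= M * `|x - x'| * kappa x).

Lemma kappa_gt0 n (x : 'rV[R]_n) : 0 < kappa x.
Proof.
apply: prodr_gt0 => i _; rewrite invr_gt0; exact: lt_le_trans ltr01 (oneDsqr_ge1 _).
Qed.

Lemma kappa_ge0 n (x : 'rV[R]_n) : 0 <= kappa x.
Proof. exact/ltW/kappa_gt0. Qed.

Lemma wlip_ge0 n M (F : 'rV[R]_n -> R) : wlip M F -> 0 <= M.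
Proof.
move=> [/(_ 0) H _]; have := le_trans (normr_ge0 _) H.
by rewrite pmulr_lge0// kappa_gt0.
Qed.

Definition rcons_mx n (t : R) (y : 'rV[R]_n) : 'rV[R]_n.+1 :=
  row_mx (t%:M : 'rV[R]_1) y.

Lemma rcons_mxEl n t (y : 'rV[R]_n) : rcons_mx t y 0 (@lshift 1 n ord0) = t.
Proof. by apply: (etrans (row_mxEl _ _ _ _)); rewrite mxE eqxx mulr1n. Qed.

Lemma rcons_mxEr n t (y : 'rV[R]_n) i : rcons_mx t y 0 (@rshift 1 n i) = y 0 i.
Proof. exact: row_mxEr. Qed.

Lemma kappa_cons n t (y : 'rV[R]_n) : kappa (rcons_mx t y) = kappa1 t * kappa y.
Proof.
rewrite /kappa (@big_split_ord _ _ _ 1 n) /= big_ord1.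
congr (kappa1 _ * _); first by rewrite rcons_mxEl.
by apply: eq_bigr => i _; rewrite rcons_mxEr.
Qed.

Lemma normr_cons n t t' (y y' : 'rV[R]_n) :
  `|rcons_mx t y - rcons_mx t' y'| <= Num.max `|t - t'| `|y - y'|.
Proof.
apply: normr_row_le => [|i]; first by rewrite le_max normr_ge0.
rewrite !mxE le_max.
case: (@fintype.split 1 n i) => j.
  by rewrite ord1 !mxE eqxx !mulr1n lexx.
apply/orP; right.
by have := normr_coord (y - y') j; rewrite !mxE.
Qed.

Lemma wlip_slice n M (F : 'rV[R]_n.+1 -> R) t : wlip M F ->
  wlip (M * kappa1 t) (fun y => F (rcons_mx t y)).
Proof.
move=> MF; have M0 := wlip_ge0 MF; split=> [y|y y' yy'].
  by rewrite -mulrA -kappa_cons; exact: MF.1.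
have H : `|rcons_mx t y - rcons_mx t y'| <= `|y - y'|.
  by apply: le_trans (normr_cons _ _ _ _) _; rewrite subrr normr0 ge_max normr_ge0 lexx.
apply: (le_trans (MF.2 _ _ (le_trans H yy'))); rewrite kappa_cons.
have -> : M * kappa1 t * `|y - y'| * kappa y = M * `|y - y'| * (kappa1 t * kappa y) by ring.
by rewrite ler_wpM2r ?mulr_ge0 ?kappa1_ge0 ?kappa_ge0// ler_wpM2l.
Qed.

Lemma wlipD n a b M M' (F G : 'rV[R]_n -> R) : wlip M F -> wlip M' G ->
  wlip (`|a| * M + `|b| * M') (fun x => a * F x + b * G x).
Proof.
move=> [F0 F1] [G0 G1]; split=> [x|x x' xx'].
  apply: (le_trans (ler_normD _ _)); rewrite !normrM mulrDl -!mulrA.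
  by rewrite lerD ?ler_wpM2l.
have -> : a * F x + b * G x - (a * F x' + b * G x') =
   a * (F x - F x') + b * (G x - G x') by ring.
apply: (le_trans (ler_normD _ _)); rewrite !normrM !mulrDl -!mulrA.
by rewrite lerD ?ler_wpM2l// mulrA ?F1 ?G1.
Qed.

Definition rintegral_linear n := forall a b M M' (F G : 'rV[R]_n -> R), wlip M F -> wlip M' G ->
  rintegral (fun x => a * F x + b * G x) = a * rintegral F + b * rintegral G.

Definition rintegral_bounded n := forall M M' (F : 'rV[R]_n -> R), wlip M' F ->
  (forall x, `|F x| <= M * kappa x) -> `|rintegral F| <= M * c1 ^+ n.

Lemma wlip1_slice_of n M (F : 'rV[R]_n.+1 -> R) : rintegral_linear n -> rintegral_bounded n ->
  wlip M F -> wlip1 (M * c1 ^+ n) (fun t => rintegral (fun y => F (rcons_mx t y))).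
Proof.
move=> lin bnd MF; have M0 := wlip_ge0 MF; split=> [t|t t' tt'].
  rewrite mulrAC; apply: bnd (wlip_slice t MF) _ => y.
  by rewrite -mulrA -kappa_cons; exact: MF.1.
have E := lin 1 (-1) _ _ _ _ (wlip_slice t MF) (wlip_slice t' MF).
rewrite mul1r mulN1r in E; rewrite -E.
have -> : M * c1 ^+ n * `|t - t'| * kappa1 t = M * `|t - t'| * kappa1 t * c1 ^+ n by ring.
apply: bnd (wlipD 1 (-1) (wlip_slice t MF) (wlip_slice t' MF)) _ => y.
rewrite mul1r mulN1r -mulrA -kappa_cons.
have H : `|rcons_mx t y - rcons_mx t' y| <= `|t - t'|.
  by apply: le_trans (normr_cons _ _ _ _) _; rewrite subrr normr0 ge_max normr_ge0 lexx.
apply: (le_trans (MF.2 _ _ (le_trans H tt'))).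
by rewrite ler_wpM2r ?kappa_ge0// ler_wpM2l.
Qed.

(** Both properties go through one induction: a slice integral has to be [wlip1] in the outer
    variable before it is integrated, and its increments are estimated by linearity together with
    the bound in dimension [n]. *)
Lemma rintegral_linear_bounded n : rintegral_linear n /\ rintegral_bounded n.
Proof.
elim: n => [|n [lin bnd]].
  split=> [//|M M' F MF /(_ 0)]; rewrite expr0 mulr1 /kappa big_ord0 mulr1.
  exact.
have slice M F := @wlip1_slice_of n M F lin bnd.
split=> [a b M M' F G MF MG|M M' F MF HF] /=.
  rewrite -(Rintegral_lin a b (slice _ _ MF) (slice _ _ MG)).
  congr (Rintegral _ _ _); apply/funext => t.
  exact: lin (wlip_slice t MF) (wlip_slice t MG).
rewrite exprSr mulrA; apply: wlip1_bound (slice _ _ MF) _ => t.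
rewrite mulrAC; apply: bnd (wlip_slice t MF) _ => y.
by rewrite -mulrA -kappa_cons.
Qed.

Lemma rintegral_lin n : rintegral_linear n.
Proof. exact: (rintegral_linear_bounded n).1. Qed.

Lemma rintegral_bound n : rintegral_bounded n.
Proof. exact: (rintegral_linear_bounded n).2. Qed.

Lemma wlip1_slice n M (F : 'rV[R]_n.+1 -> R) : wlip M F ->
  wlip1 (M * c1 ^+ n) (fun t => rintegral (fun y => F (rcons_mx t y))).
Proof. exact: wlip1_slice_of (@rintegral_lin n) (@rintegral_bound n). Qed.

(** The product of a rule for the outer variable and a rule for the slices, the latter with a
    tolerance divided by the total weight of the former. *)
Lemma quadrature n (d : R) : 0 < d -> exists s : seq (R * 'rV[R]_n),
  forall M F, wlip M F -> `|rintegral F - \sum_(p <- s) p.1 * F p.2| <= d * M.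
Proof.
elim: n d => [|n IH] d d0.
  exists [:: (1, 0)] => M F MF; rewrite big_seq1 /= mul1r subrr normr0.
  by rewrite mulr_ge0 ?(ltW d0)// (wlip_ge0 MF).
have d20 : 0 < d / 2 by rewrite divr_gt0.
have cn0 : 0 <= c1 ^+ n by rewrite exprn_ge0// kappa1_mass_ge0.
have cn : 0 < c1 ^+ n + 1 by rewrite ltr_wpDl.
(* The slice integrals are [wlip1] with constant [M * c1 ^+ n]; the tolerance is reduced
   accordingly. *)
have [s1 H1] := quadrature1 (divr_gt0 d20 cn).
pose A : R := \sum_(p <- s1) `|p.1| + 1.
have A0 : 0 < A by rewrite ltr_wpDl// sumr_ge0.
have [s2 H2] := IH _ (divr_gt0 d20 A0).
exists [seq (p.1 * q.1, rcons_mx p.2 q.2) | p <- s1, q <- s2] => M F MF.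
have M0 := wlip_ge0 MF.
rewrite big_allpairs_dep /= -/(rintegral _).
set G := fun t : R => rintegral _.
rewrite -(subrK (\sum_(p <- s1) p.1 * G p.2) (Rintegral _ _ _)) -addrA -sumrB.
apply: (le_trans (ler_normD _ _)); rewrite (splitr d) mulrDl; apply: lerD.
  apply: (le_trans (H1 _ _ (wlip1_slice MF))).
  rewrite [M * _]mulrC mulrA ler_wpM2r// -mulrA -[leRHS]mulr1.
  by rewrite ler_wpM2l ?(ltW d20)// mulrC ler_pdivrMr// mul1r lerDl.
apply: (le_trans (ler_norm_sum _ _ _)).
apply: (@le_trans _ _ (\sum_(p <- s1) `|p.1| * (d / 2 / A * M))).
  apply: ler_sum => p _.
  have -> : \sum_(q <- s2) p.1 * q.1 * F (rcons_mx p.2 q.2) =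
     p.1 * \sum_(q <- s2) q.1 * F (rcons_mx p.2 q.2).
    by rewrite mulr_sumr; apply: eq_bigr => q _; rewrite mulrA.
  rewrite -mulrBr normrM ler_wpM2l//.
  apply: (le_trans (H2 _ _ (wlip_slice p.2 MF))).
  rewrite ler_wpM2l ?divr_ge0 ?(ltW d0) ?(ltW A0)//.
  by rewrite ler_piMr// kappa1_le1.
rewrite -mulr_suml.
have -> : d / 2 * M = A * (d / 2 / A * M).
  by rewrite mulrA (mulrC A) divfK// gt_eqF.
apply: ler_wpM2r; last by rewrite /A lerDl.
by apply: mulr_ge0 => //; apply: divr_ge0; exact: ltW.
Qed.

Lemma rintegral_affine n (a : 'rV[R]_n) (l : R) M F : 0 < l -> wlip M F ->
  rintegral F = l ^+ n * rintegral (fun x => F (a + l *: x)).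
Proof.
elim: n a M F => [|n IH] a M F l0 MF.
  by rewrite expr0 mul1r /=; congr F; apply/rowP => -[].
pose a0 : R := a 0 0; pose a' : 'rV[R]_n := @rsubmx R 1 1 n a.
have E t y : a + l *: rcons_mx t y = rcons_mx (a0 + l * t) (a' + l *: y).
  have coord m (u v : 'rV[R]_m) i : (u + l *: v) 0 i = u 0 i + l * v 0 i by rewrite !mxE.
  apply/rowP => i; rewrite coord; case: (@split_ordP 1 n i) => j ->.
    by rewrite ord1 !rcons_mxEl /a0; congr (a _ _ + _); apply/val_inj.
  by rewrite !rcons_mxEr coord /a' mxE.
rewrite /= -/(rcons_mx _ _).
have wS := wlip1_slice MF; set G := fun t : R => rintegral _ in wS *.
(* The factor [l ^+ n] that the inner change of variables will produce is divided out beforehand;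
   the zero coefficient reduces linearity to multiplication by a scalar. *)
have lin := Rintegral_lin (l ^- n) 0 wS wS.
rewrite mul0r addr0 in lin.
have ln : l ^+ n != 0 by rewrite expf_neq0 ?gt_eqF.
rewrite -[LHS](mulVKf ln) -lin (Rintegral_affine a0 l0 (wlip1D (l ^- n) 0 wS wS)).
rewrite mulrA -exprSr; congr (_ * Rintegral _ _ _); apply/funext => t.
rewrite mul0r addr0 /G (IH a' _ _ l0 (wlip_slice _ MF)) mulKf//.
by congr rintegral; apply/funext => y; rewrite E.
Qed.

End MultiDim.

(** * Integrals of complex-valued functions *)

Section ComplexIntegral.
Context {R : realType} {n : nat}.
Local Notation Rn := 'rV[R]_n.
Local Notation c1 := (@kappa1_mass R).
Implicit Types (F G : Rn -> R[i]) (M : R).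

Definition cwlip M F : Prop :=
  (forall x, normc (F x) <= M * kappa x) /\
  (forall x x', `|x - x'| <= 1 -> normc (F x - F x') <= M * `|x - x'| * kappa x).

Lemma cwlip_Re M F : cwlip M F -> wlip M (fun x => complex.Re (F x)).
Proof.
move=> [F0 F1]; split=> [x|x x' xx']; first exact: le_trans (abs_Re_le _) (F0 x).
by rewrite -cReN -cReD; apply: le_trans (abs_Re_le _) (F1 x x' xx').
Qed.

Lemma cwlip_Im M F : cwlip M F -> wlip M (fun x => complex.Im (F x)).
Proof.
move=> [F0 F1]; split=> [x|x x' xx']; first exact: le_trans (abs_Im_le _) (F0 x).
by rewrite -cImN -cImD; apply: le_trans (abs_Im_le _) (F1 x x' xx').
Qed.

Lemma cintegral_lin (c : R[i]) M M' F G : cwlip M F -> cwlip M' G ->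
  cintegral (fun x => c * F x + G x) = c * cintegral F + cintegral G.
Proof.
move=> MF MG; have fr := cwlip_Re MF; have fi := cwlip_Im MF.
have gr := cwlip_Re MG; have gi := cwlip_Im MG.
have key a b (H : Rn -> R) N : wlip N H ->
    rintegral (fun x => 1 * (a * complex.Re (F x) + b * complex.Im (F x)) + 1 * H x) =
    a * rintegral (fun x => complex.Re (F x)) + b * rintegral (fun x => complex.Im (F x)) + rintegral H.
  move=> wH; rewrite (rintegral_lin 1 1 (wlipD a b fr fi) wH) (rintegral_lin a b fr fi).
  by rewrite !mul1r.
rewrite /cintegral; apply: complex_eq.
  rewrite cReD [in RHS]cReM /= -mulNr -(key _ _ _ _ gr); congr rintegral; apply/funext => x.
  by rewrite cReD cReM !mul1r mulNr.
rewrite cImD [in RHS]cImM /= [complex.Re c * _ + _]addrC -(key _ _ _ _ gi).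
congr rintegral; apply/funext => x.
by rewrite cImD cImM !mul1r [complex.Im c * _ + _]addrC.
Qed.

Lemma cwlip0 : cwlip 0 (fun=> 0).
Proof. by split=> [x|x x' _]; rewrite ?subrr normc0 !mul0r. Qed.

Lemma cintegral0 : cintegral (fun _ : Rn => 0) = 0.
Proof.
have := cintegral_lin 1 cwlip0 cwlip0.
have -> : (fun x : Rn => 1 * 0 + 0) = (fun=> 0 : R[i]) by apply/funext => x; rewrite mul1r addr0.
by rewrite mul1r => /eqP; rewrite eq_sym -subr_eq0 addrK => /eqP.
Qed.

Lemma cintegralZ (c : R[i]) M F : cwlip M F ->
  cintegral (fun x => c * F x) = c * cintegral F.
Proof.
move=> MF; have := cintegral_lin c MF cwlip0.
rewrite cintegral0 addr0 => <-; congr cintegral; apply/funext => x.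
by rewrite addr0.
Qed.

Lemma cintegral_bound M M' F : cwlip M' F -> (forall x, normc (F x) <= M * kappa x) ->
  normc (cintegral F) <= 2 * (M * c1 ^+ n).
Proof.
move=> MF H; apply: normc_le => /=.
  by apply: rintegral_bound (cwlip_Re MF) _ => x; exact: le_trans (abs_Re_le _) (H x).
by apply: rintegral_bound (cwlip_Im MF) _ => x; exact: le_trans (abs_Im_le _) (H x).
Qed.

Lemma cintegral_affine (a : Rn) (l : R) M F : 0 < l -> cwlip M F ->
  cintegral F = (l ^+ n)%:C * cintegral (fun x => F (a + l *: x)).
Proof.
move=> l0 MF; rewrite /cintegral; apply: complex_eq; rewrite ?cReZ ?cImZ /=.
  exact: rintegral_affine (cwlip_Re MF).
exact: rintegral_affine (cwlip_Im MF).
Qed.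

Lemma Re_sum (s : seq (R * Rn)) F :
  complex.Re (\sum_(p <- s) (p.1)%:C * F p.2) = \sum_(p <- s) p.1 * complex.Re (F p.2).
Proof.
elim: s => [|p s IH]; first by rewrite !big_nil.
by rewrite !big_cons cReD cReZ IH.
Qed.

Lemma Im_sum (s : seq (R * Rn)) F :
  complex.Im (\sum_(p <- s) (p.1)%:C * F p.2) = \sum_(p <- s) p.1 * complex.Im (F p.2).
Proof.
elim: s => [|p s IH]; first by rewrite !big_nil.
by rewrite !big_cons cImD cImZ IH.
Qed.

Lemma cquadrature (d : R) : 0 < d -> exists s : seq (R * Rn), forall M F, cwlip M F ->
  normc (cintegral F - \sum_(p <- s) (p.1)%:C * F p.2) <= d * M.
Proof.
move=> d0; have [s Hs] := @quadrature R n _ (divr_gt0 d0 (ltr0n R 2)).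
exists s => M F MF; have -> : d * M = 2 * (d / 2 * M).
  by rewrite mulrA (mulrC 2) divfK.
apply: normc_le; rewrite ?cReD ?cImD ?cReN ?cImN ?Re_sum ?Im_sum; apply: Hs.
  exact: cwlip_Re.
exact: cwlip_Im.
Qed.

Lemma cwlip_ext M F G : (forall x, F x = G x) -> cwlip M F -> cwlip M G.
Proof. by move=> /funext ->. Qed.

Lemma kappa_compact (r : R) : exists2 k : R, 0 < k & forall x : Rn, `|x| <= r -> k <= kappa x.
Proof.
exists ((1 + r ^+ 2)^-1 ^+ n) => [|x xr].
  by rewrite exprn_gt0// invr_gt0 ltr_wpDr ?sqr_ge0.
rewrite /kappa -[X in _ ^+ X](card_ord n) -prodr_const; apply: ler_prod => i _.
rewrite invr_ge0 addr_ge0 ?sqr_ge0//= lef_pV2 ?posrE ?ltr_wpDr ?sqr_ge0//.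
rewrite lerD2l -[leLHS]real_normK ?num_real// lerXn2r ?nnegrE//.
  by rewrite (le_trans _ (le_trans (normr_coord x i) xr)).
exact: le_trans (normr_coord x i) xr.
Qed.

(** Each factor of [kappa] is at least (1 + |x|)^-2. Hence a decay of order [2 * n] in excess of the
    growth of the other factor suffices for integration: this is the origin of the exponents
    [N + 2 * n] below. *)
Lemma kappa_weight (x : Rn) : (1 + `|x|) ^- (2 * n) <= kappa x.
Proof.
rewrite exprM -exprVn /kappa -[X in _ ^+ X](card_ord n) -prodr_const; apply: ler_prod => i _.
have p0 : 0 < 1 + `|x| by rewrite ltr_wpDr.
rewrite invr_ge0 exprn_ge0 ?(ltW p0)//= lef_pV2 ?posrE ?exprn_gt0//.
rewrite sqrrD expr1n mul1r /oneDsqr -addrA lerD2l -[leLHS]real_normK ?num_real//.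
rewrite (le_trans (_ : _ <= `|x| ^+ 2)) ?lerDr ?mulrn_wge0//.
by rewrite lerXn2r ?nnegrE// normr_coord.
Qed.

(** [C] depends on [r] only: it is the inverse of a lower bound of [kappa] on the ball of radius r +
    1, and outside this ball an increment over a distance at most 1 vanishes. *)
Lemma cwlip_support (r : R) : exists2 C : R, 0 <= C & forall F (B L : R), 0 <= B -> 0 <= L ->
  (forall x, r < `|x| -> F x = 0) -> (forall x, normc (F x) <= B) ->
  (forall x x', `|x - x'| <= 1 -> normc (F x - F x') <= L * `|x - x'|) ->
  cwlip (C * (B + L)) F.
Proof.
have [k k0 Hk] := kappa_compact (r + 1).
exists k^-1 => [|F B L B0 L0 F0 FB FL]; first by rewrite invr_ge0 ltW.
have kx (x : Rn) (c : R) : 0 <= c -> `|x| <= r + 1 -> c <= k^-1 * c * kappa x.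
  move=> c0 xr; rewrite mulrAC ler_peMl// mulrC ler_pdivlMr// mul1r; exact: Hk.
split=> [x|x x' xx'].
  have [xr|rx] := leP `|x| r.
    have /(kx x) : 0 <= B + L by rewrite addr_ge0.
    move/(_ (le_trans xr _)); rewrite lerDl => /(_ ler01); apply: le_trans.
    by apply: (le_trans (FB x)); rewrite lerDl.
  by rewrite F0// normc0 !mulr_ge0 ?addr_ge0 ?kappa_ge0// invr_ge0 ltW.
have [xr|rx] := leP `|x| (r + 1).
  have /(kx x) : 0 <= L * `|x - x'| by rewrite mulr_ge0.
  move/(_ xr) => H; apply: (le_trans (FL x x' xx')); apply: (le_trans H).
  rewrite ler_wpM2r ?kappa_ge0// mulrA ler_wpM2r// ler_wpM2l ?lerDr// invr_ge0 ltW//.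
have rx' : r < `|x'|.
  rewrite -(ltrD2r 1); apply: (lt_le_trans rx).
  rewrite -[X in `|X|](subrK x') (le_trans (ler_normD _ _))// addrC lerD2l//.
have rx2 : r < `|x| by apply: le_lt_trans rx; rewrite lerDl.
rewrite !F0// subrr normc0 !mulr_ge0 ?addr_ge0 ?kappa_ge0// invr_ge0 ltW//.
Qed.

End ComplexIntegral.

(** * Convolution with a distribution *)

Section Convolution.
Context {R : realType} {n : nat}.
Local Notation Rn := 'rV[R]_n.
Local Notation fct := (Rn -> R[i]).
Local Notation e_ := (@basis_vec R n).
Implicit Types (f g u v : fct) (x y z d : Rn) (s : seq 'I_n) (i : 'I_n) (A : set Rn)
  (V : set fct) (T : fct -> R[i]) (j k m : nat) (C M : R).

Definition tr x f : fct := fun y => f (x - y).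

Lemma trE x f : tr x f = fun y => f (x + (-1) *: y).
Proof. by apply/funext => y; rewrite /tr scaleN1r. Qed.

Lemma smooth_tr x f : smooth f -> smooth (tr x f).
Proof. by rewrite trE; exact: smooth_affine. Qed.

Lemma cderiv_tr x f s : smooth f ->
  cderiv s (tr x f) = fun y => ((-1) ^+ size s)%:C * tr x (cderiv s f) y.
Proof.
move=> sf; rewrite trE cderiv_affine//; apply/funext => y.
by rewrite /tr scaleN1r.
Qed.

Lemma normc_signM m (z : R[i]) : normc (((-1) ^+ m)%:C * z) = normc z.
Proof. by rewrite normcM normc_real normrX normrN1 expr1n mul1r. Qed.

Lemma normc_cderiv_tr x f s y : smooth f ->
  normc (cderiv s (tr x f) y) = normc (cderiv s f (x - y)).
Proof. by move=> sf; rewrite cderiv_tr// normc_signM. Qed.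

(** A predicate instead of a supremum, so that infinite values never enter the estimates. *)
Definition seminorm_le A j k f M : Prop := forall s y, (size s <= j)%N -> A y ->
  (1 + `|y|) ^+ k * normc (cderiv s f y) <= M.

(** Continuity in one explicit seminorm with an explicit constant: for a basic net, [C] becomes a
    power of the parameter while [V], [A], [j] and [k] stay fixed. *)
Record bounded_functional V A j k C T : Prop := BoundedFunctional {
  bf_smooth : forall f, V f -> smooth f;
  bf_closed : forall (c : R[i]) f g, V f -> V g -> V (fun x => c * f x + g x);
  bf_linear : linear_on V T;
  bf_ge0 : 0 <= C;
  bf_bound : forall f M, V f -> 0 <= M -> seminorm_le A j k f M -> normc (T f) <= C * M }.

(* Locally in [x], the functional sees all the translates [tr x u] with uniform
   bounds; it covers [D'], [E'] and [S'] at once. *)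
Definition convolvable T u : Prop := forall x0, exists V A j k C,
  [/\ bounded_functional V A j k C T,
      forall s x, `|x - x0| <= 1 -> V (tr x (cderiv s u)) &
      forall m, exists2 M : R, 0 <= M & forall s x y, (size s <= m)%N -> `|x - x0| <= 1 -> A y ->
        (1 + `|y|) ^+ k * normc (cderiv s u (x - y)) <= M].

Lemma convolvable_cderiv T u s : convolvable T u -> convolvable T (cderiv s u).
Proof.
move=> H x0; have [V [A [j [k [C [bT HV HM]]]]]] := H x0.
exists V, A, j, k, C; split=> [//|t x xx|m]; first by rewrite cderiv_cat; exact: HV.
have [M M0 H2] := HM (m + size s)%N; exists M => // t x y tm xx Ay.
by rewrite cderiv_cat; apply: H2 => //; rewrite size_cat leq_add2r.
Qed.

Lemma weight_gt0 y : 0 < 1 + `|y|.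
Proof. by rewrite ltr_wpDr. Qed.

Lemma weightX_gt0 y k : 0 < (1 + `|y|) ^+ k.
Proof. by rewrite exprn_gt0// weight_gt0. Qed.

Section local.
Variables (V : set fct) (A : set Rn) (j k : nat) (C M : R) (T : fct -> R[i]) (u : fct) (x0 : Rn).
Hypothesis su : smooth u.
Hypothesis bT : bounded_functional V A j k C T.
Hypothesis HV : forall s x, `|x - x0| <= 1 -> V (tr x (cderiv s u)).
Hypothesis M0 : 0 <= M.
Hypothesis HM : forall s x y, (size s <= j.+2)%N -> `|x - x0| <= 1 -> A y ->
        (1 + `|y|) ^+ k * normc (cderiv s u (x - y)) <= M.

Let x00 : `|x0 - x0| <= 1. Proof. by rewrite subrr normr0. Qed.

Let V0 : V (tr x0 u). Proof. by have := HV [::] x00; rewrite cderiv0. Qed.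

Let bnd s x y : (size s <= j.+2)%N -> `|x - x0| <= 1 -> A y ->
  normc (cderiv s u (x - y)) <= M / (1 + `|y|) ^+ k.
Proof. by move=> sj xx Ay; rewrite ler_pdivlMr ?weightX_gt0// mulrC HM. Qed.

Let Mk y : 0 <= M / (1 + `|y|) ^+ k.
Proof. by rewrite divr_ge0// ltW// weightX_gt0. Qed.

(** A derivative of order at most [j] of the difference of two translates is, up to sign, an
    increment of a derivative of [u], which is bounded by derivatives of one order more. *)
Lemma conv_lipschitz x : `|x - x0| <= 1 ->
  normc (T (tr x u) - T (tr x0 u)) <= C * (2 * (n%:R * M * `|x - x0|)).
Proof.
move=> xx; have Vx : V (tr x u) by have := HV [::] xx; rewrite cderiv0.
pose g y := -1 * tr x0 u y + tr x u y.
have -> : T (tr x u) - T (tr x0 u) = T g.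
  by rewrite (bf_linear bT)// mulN1r addrC.
apply: (bf_bound bT); first exact: (bf_closed bT).
  by rewrite !mulr_ge0.
move=> s y sj Ay.
rewrite /g (cderiv_lin s (-1) (smooth_tr x0 su) (smooth_tr x su)).
rewrite (cderiv_tr x0 s su) (cderiv_tr x s su) mulrCA -mulrDr normc_signM mulN1r [- _ + _]addrC /tr.
have -> : x - y = (x0 - y) + (x - x0) by rewrite [RHS]addrC addrA subrK.
rewrite -ler_pdivlMl ?weightX_gt0//.
have -> : ((1 + `|y|) ^+ k)^-1 * (2 * (n%:R * M * `|x - x0|)) =
  2 * (n%:R * (M / (1 + `|y|) ^+ k) * `|x - x0|) by ring.
apply: smooth_incr; [exact: smooth_cderiv|exact: Mk|].
move=> i z zd; rewrite cderiv_cat.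
have -> : z = (x0 + (z - (x0 - y))) - y.
  by rewrite [x0 + (z - _)]addrC -addrA subrK.
apply: bnd => //; first by rewrite /= ltnS (leq_trans sj).
by rewrite addrAC subrr add0r (le_trans zd).
Qed.

(** The same argument with the first-order Taylor remainder of the derivatives of [u]; it consumes
    two more orders, hence [j.+2] in [HM]. *)
Lemma conv_taylor i (h : R) : `|h| <= 1 ->
  normc (T (tr (x0 + h *: e_ i) u) - T (tr x0 u) - h%:C * T (tr x0 (cderiv [:: i] u)))
  <= C * (2 * (M * `|h| ^+ 2)).
Proof.
move=> h1.
have ce (c : R) : `|c| <= `|h| -> `|x0 + c *: e_ i - x0| <= 1.
  move=> ch; rewrite addrAC subrr add0r normrZ (le_trans _ h1)// (le_trans _ ch)//.
  by rewrite ler_piMr// normr_basis.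
have Vx : V (tr (x0 + h *: e_ i) u).
  by have := HV [::] (ce h (lexx _)); rewrite cderiv0.
have Vi := HV [:: i] x00.
pose g1 y := -1 * tr x0 u y + tr (x0 + h *: e_ i) u y.
have V1 : V g1 by exact: (bf_closed bT).
pose g y := (- h%:C) * tr x0 (cderiv [:: i] u) y + g1 y.
have -> : T (tr (x0 + h *: e_ i) u) - T (tr x0 u) - h%:C * T (tr x0 (cderiv [:: i] u)) = T g.
  by rewrite !(bf_linear bT)// mulN1r mulNr [RHS]addrC [- T _ + _]addrC.
apply: (bf_bound bT); first exact: (bf_closed bT).
  by rewrite !mulr_ge0.
move=> s y sj Ay.
have sm x := smooth_tr x su.
have si := smooth_cderiv [:: i] su.
rewrite /g (cderiv_lin s _ (smooth_tr x0 si) (smooth_lin (-1) (sm x0) (sm _))).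
rewrite /g1 (cderiv_lin s _ (sm x0) (sm _)).
rewrite (cderiv_tr _ _ si) !(cderiv_tr _ _ su).
rewrite mulrCA [-1 * (_ * _)]mulrCA -!mulrDr normc_signM.
have -> : cderiv s (cderiv [:: i] u) = cderiv [:: i] (cderiv s u).
  by rewrite !cderiv_cat; apply: cderiv_perm => //; rewrite perm_catC.
rewrite mulN1r mulNr /tr -ler_pdivlMl ?weightX_gt0//.
have -> : ((1 + `|y|) ^+ k)^-1 * (2 * (M * `|h| ^+ 2)) =
  2 * ((M / (1 + `|y|) ^+ k) * `|h| ^+ 2) by ring.
rewrite [- (_ * _) + _]addrC [- cderiv s u _ + _]addrC addrAC.
have -> : x0 + h *: e_ i - y = (x0 - y) + h *: e_ i by rewrite addrAC.
rewrite addrAC; apply: smooth_taylor; [exact: smooth_cderiv|exact: Mk|].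
move=> c ch; rewrite cderiv_cat -addrA [- y + _]addrC addrA.
by apply: bnd => //; exact: ce.
Qed.

End local.

(** The Lipschitz estimate gives continuity and the Taylor estimate gives the derivatives of the
    functions [T (tr x (cderiv s u))], which thus form a family as in [rsmooth_family]. *)
Lemma conv_smooth T u : smooth u -> convolvable T u ->
  smooth (fun x => T (tr x u)) /\
  forall s, cderiv s (fun x => T (tr x u)) = fun x => T (tr x (cderiv s u)).
Proof.
move=> su cT.
have lip s x0 : exists2 L : R, 0 < L & forall x, `|x - x0| <= 1 ->
    normc (T (tr x (cderiv s u)) - T (tr x0 (cderiv s u))) <= L * `|x - x0|.
  have [V [A [j [k [C [bT HV HM]]]]]] := convolvable_cderiv s cT x0.
  have [M M0 H2] := HM j.+2; have C0 := bf_ge0 bT.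
  exists (C * (2 * (n%:R * M)) + 1) => [|x xx]; first by rewrite ltr_wpDl// !mulr_ge0.
  apply: (le_trans (conv_lipschitz (smooth_cderiv s su) bT HV M0 H2 xx)).
  have -> : C * (2 * (n%:R * M * `|x - x0|)) = C * (2 * (n%:R * M)) * `|x - x0| by ring.
  by apply: ler_wpM2r; rewrite // lerDl.
have tay s x0 i : exists2 L : R, 0 < L & forall h : R, `|h| <= 1 ->
    normc (T (tr (x0 + h *: e_ i) (cderiv s u)) - T (tr x0 (cderiv s u)) -
       h%:C * T (tr x0 (cderiv (i :: s) u))) <= L * `|h| ^+ 2.
  have [V [A [j [k [C [bT HV HM]]]]]] := convolvable_cderiv s cT x0.
  have [M M0 H2] := HM j.+2; have C0 := bf_ge0 bT.
  exists (C * (2 * M) + 1) => [|h h1]; first by rewrite ltr_wpDl// !mulr_ge0.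
  have := conv_taylor (smooth_cderiv s su) bT HV M0 H2 i h1.
  rewrite cderiv_cat /= => /le_trans; apply.
  have -> : C * (2 * (M * `|h| ^+ 2)) = C * (2 * M) * `|h| ^+ 2 by ring.
  by apply: ler_wpM2r; rewrite ?exprn_ge0// lerDl.
(* [p] stands for the real part and for the imaginary part. *)
have main (p : R[i] -> R) : (forall z w : R[i], p (z - w) = p z - p w) ->
    (forall (c : R) (z : R[i]), p (c%:C * z) = c * p z) -> (forall z : R[i], `|p z| <= normc z) ->
    (forall s, foldr pderiv (fun x => p (T (tr x u))) s = fun x => p (T (tr x (cderiv s u)))) /\
    rsmooth (fun x => p (T (tr x u))).
  move=> pB pZ pn; pose F s x := p (T (tr x (cderiv s u))).
  have -> : (fun x => p (T (tr x u))) = F [::] by apply/funext => x; rewrite /F cderiv0.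
  apply: rsmooth_family => [s|s i x0].
    apply/continuous_distP => x0 e e0; have [L L0 HL] := lip s x0.
    exists (Num.min 1 (e / L)) => [|x]; first by rewrite lt_min ltr01 divr_gt0.
    rewrite lt_min distrC => /andP[/ltW x1]; rewrite ltr_pdivlMr// mulrC => xL.
    rewrite distrC -pB; apply: le_lt_trans xL; apply: le_trans (pn _) _; exact: HL.
  apply: is_derive_dist => e e0; have [L L0 HL] := tay s x0 i.
  exists (Num.min 1 (e / L)) => [|h]; first by rewrite lt_min ltr01 divr_gt0.
  rewrite lt_min => /andP[/ltW h1]; rewrite ltr_pdivlMr// mulrC => hL.
  rewrite /F -pZ -!pB; apply: le_trans (pn _) _; apply: le_trans (HL h h1) _.
  by rewrite expr2 mulrA ler_wpM2r// ltW.
have [Er sr] := main (@complex.Re R) (fun z w : R[i] => etrans (cReD z (- w)) (congr1 _ (cReN w)))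
   (@cReZ R) (@abs_Re_le R).
have [Ei si] := main (@complex.Im R) (fun z w : R[i] => etrans (cImD z (- w)) (congr1 _ (cImN w)))
   (@cImZ R) (@abs_Im_le R).
split; first exact: conj sr si.
move=> s; apply/funext => x; apply: complex_eq => /=.
  by rewrite Er.
by rewrite Ei.
Qed.

End Convolution.

(** * The three kinds of distributions as bounded functionals *)

Section Instances.
Context {R : realType} {n : nat}.
Local Notation Rn := 'rV[R]_n.
Local Notation fct := (Rn -> R[i]).
Implicit Types (f g u v : fct) (x y z d : Rn) (s : seq 'I_n) (i : 'I_n) (A K : set Rn)
  (V : set fct) (T : fct -> R[i]) (j k m : nat) (C M r : R).

Lemma enorm_le y : enorm y <= n%:R * `|y|.
Proof.
rewrite /enorm -[leRHS]ger0_norm ?mulr_ge0// -sqrtr_sqr ler_sqrt ?sqr_ge0//.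
apply: (@le_trans _ _ (\sum_(i < n) `|y| ^+ 2)).
  by apply: ler_sum => i _; rewrite -[leLHS]real_normK ?num_real// lerXn2r ?nnegrE// normr_coord.
rewrite sumr_const card_ord -[leLHS]mulr_natl exprMn ler_wpM2r ?sqr_ge0//.
by rewrite -natrX ler_nat; case: (n) => // n'; rewrite expnS expn1 leq_pmulr.
Qed.

Lemma norm_le_enorm y : `|y| <= enorm y.
Proof.
apply: normr_row_le => [|i]; first exact: enorm_ge0.
rewrite /enorm -sqrtr_sqr ler_sqrt ?sumr_ge0// => [|j _]; last exact: sqr_ge0.
by rewrite (bigD1 i)//= lerDl sumr_ge0// => j _; exact: sqr_ge0.
Qed.

Lemma weight_enorm y k : (1 + enorm y) ^+ k <= (n.+1%:R) ^+ k * (1 + `|y|) ^+ k.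
Proof.
rewrite -exprMn lerXn2r ?nnegrE ?mulr_ge0 ?addr_ge0 ?enorm_ge0//.
apply: (le_trans (_ : _ <= 1 + n%:R * `|y|)); first by rewrite lerD2l enorm_le.
rewrite mulrDr mulr1 lerD//; first by rewrite ler1n.
by rewrite ler_wpM2r// ler_nat.
Qed.

Lemma enorm_weight y k : (1 + `|y|) ^+ k <= (1 + enorm y) ^+ k.
Proof. by rewrite lerXn2r ?nnegrE ?addr_ge0 ?enorm_ge0// lerD2l norm_le_enorm. Qed.

Lemma sup_upto_le A j f M : smooth f -> 0 <= M ->
  (sup_upto A j f <= M%:E)%E <-> seminorm_le A j 0 f M.
Proof.
move=> sf M0; rewrite /sup_upto wsup_le//; split=> [H s y sj Ay|H x a Ax aj].
  by rewrite expr0 cderiv_partial//; apply: H => //; rewrite /upto /= mlength_word_index.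
by rewrite partial_cderiv; have := H (word a) x; rewrite expr0 size_word; apply.
Qed.

Lemma schwartz_norm_ge k f M : smooth f -> 0 <= M ->
  (schwartz_norm k f <= M%:E)%E -> seminorm_le setT k k f M.
Proof.
move=> sf M0 /wsup_le-/(_ M0) H s y sj _; rewrite cderiv_partial//.
have := H y (word_index s) I; rewrite /upto /= mlength_word_index => /(_ sj).
by apply: le_trans; rewrite ler_wpM2r ?normc_ge0// enorm_weight.
Qed.

Lemma schwartz_norm_le k f M : smooth f -> 0 <= M -> seminorm_le setT k k f M ->
  (schwartz_norm k f <= (n.+1%:R ^+ k * M)%:E)%E.
Proof.
move=> sf M0 H; apply/wsup_le => [|x a _ ak]; first by rewrite mulr_ge0 ?exprn_ge0.
rewrite partial_cderiv.
apply: (le_trans (ler_wpM2r (normc_ge0 _) (weight_enorm x k))).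
by rewrite -mulrA ler_wpM2l ?exprn_ge0//; apply: H => //; rewrite size_word.
Qed.

Lemma seminorm_le_mono A A' j j' k k' f M M' : A' `<=` A -> (j' <= j)%N -> (k' <= k)%N -> M <= M' ->
  seminorm_le A j k f M -> seminorm_le A' j' k' f M'.
Proof.
move=> AA jj kk MM H s y sj Ay; apply: le_trans MM; apply: le_trans (H s y _ _).
- by rewrite ler_wpM2r ?normc_ge0// ler_weXn2l// lerDl.
- exact: leq_trans jj.
- exact: AA.
Qed.

Lemma schwartzP f : schwartz f <-> smooth f /\
  forall j k, exists2 M : R, 0 <= M & seminorm_le setT j k f M.
Proof.
split=> [[sf H]|[sf H]]; split=> //.
  move=> j k; have /wsup_fin[M M0 HM] := H (maxn j k).
  exists M => //; have := schwartz_norm_ge sf M0 HM.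
  by apply: seminorm_le_mono; rewrite ?leq_maxl ?leq_maxr.
move=> k; have [M M0 HM] := H k k.
exact: le_lt_trans (schwartz_norm_le sf M0 HM) (ltry _).
Qed.

Lemma words_finite m : exists L : seq (seq 'I_n), forall s, (size s <= m)%N -> s \in L.
Proof.
exists [seq val b | b <- enum {: m.-bseq 'I_n}] => s sm.
by apply/mapP; exists (Bseq sm) => //; rewrite mem_enum.
Qed.

(** There are finitely many words of length at most [m]; as [P] is monotone in the constant, the sum
    of the individual constants serves all of them. *)
Lemma words_uniform (P : seq 'I_n -> R -> Prop) m :
  (forall s M M', 0 <= M -> M <= M' -> P s M -> P s M') ->
  (forall s, (size s <= m)%N -> exists2 M : R, 0 <= M & P s M) ->
  exists2 M : R, 0 <= M & forall s, (size s <= m)%N -> P s M.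
Proof.
move=> Pm H; have [L HL] := words_finite m.
suff [M M0 HM] : exists2 M : R, 0 <= M & forall s, s \in L -> (size s <= m)%N -> P s M.
  by exists M => // s sm; apply: HM => //; exact: HL.
elim: L {HL} => [|s L [M M0 HM]]; first by exists 0.
have [sm|sm] := boolP (size s <= m)%N.
  have [N N0 HN] := H s sm; exists (M + N) => [|t]; first exact: addr_ge0.
  rewrite inE => /predU1P[-> _|tL tm]; first by apply: Pm HN => //; rewrite lerDr.
  by apply: Pm (HM t tL tm) => //; rewrite lerDl.
exists M => // t; rewrite inE => /predU1P[->|tL]; first by rewrite (negbTE sm).
exact: HM.
Qed.

Lemma smooth_seminorm f m r : smooth f -> exists2 M : R, 0 <= M &
  forall s z, (size s <= m)%N -> `|z| <= r -> normc (cderiv s f z) <= M.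
Proof.
move=> sf; have [||M M0 HM] := @words_uniform
    (fun s M => forall z, `|z| <= r -> normc (cderiv s f z) <= M) m.
- by move=> s M M' _ MM H z /H /le_trans; apply.
- move=> s _; exact: smooth_bounded_ball (smooth_cderiv s sf).
by exists M => // s z sm; exact: HM.
Qed.

Definition cball r : set Rn := [set x | `|x| <= r].

Lemma cball_closed r : closed (cball r).
Proof.
have -> : cball r = (fun x : Rn => `|x|) @^-1` [set t | t <= r] by [].
apply: closed_comp => [x _|]; last exact: closed_le.
exact: norm_continuous.
Qed.

Lemma cball_compact r : compact (cball r).
Proof.
apply: bounded_closed_compact; last exact: cball_closed.
exists r; split; first exact: num_real.
by move=> M rM x /= /le_trans; apply; exact: ltW.
Qed.

Lemma compact_cball K : compact K -> exists2 r : R, 0 <= r & K `<=` cball r.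
Proof.
move=> /compact_bounded[M [_ HM]]; exists (Num.max 0 (M + 1)) => [|x Kx].
  by rewrite le_max lexx.
rewrite /cball /= le_max; apply/orP; right; apply: (HM (M + 1)) => //.
by rewrite ltrDl.
Qed.

Lemma fsupport_subset K f : closed K -> (fsupport f `<=` K) <-> (forall x, ~ K x -> f x = 0).
Proof.
move=> cK; split=> [H x nKx|H].
  apply/eqP; apply: contrapT => /negP fx; apply: nKx; apply: H; exact: subset_closure.
rewrite [X in _ `<=` X]((closure_id K).1 cK).
apply: closure_subset => x /= /eqP fx.
by apply: contrapT => /H.
Qed.

Lemma fsupport_cball r f : (fsupport f `<=` cball r) <-> (forall x, r < `|x| -> f x = 0).
Proof.
rewrite fsupport_subset; last exact: cball_closed.
split=> H x.
  by move=> rx; apply: H => /=; apply/negP; rewrite -ltNge.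
by move=> /negP; rewrite -ltNge; exact: H.
Qed.

Lemma test_functionP f : test_function f <->
  smooth f /\ exists2 r : R, 0 <= r & forall x, r < `|x| -> f x = 0.
Proof.
split=> [[sf /compact_cball[r r0 /fsupport_cball H]]|[sf [r r0 /fsupport_cball H]]].
  by split=> //; exists r.
split=> //.
have c1 : closed (fsupport f) by exact: closed_closure.
have c2 := @cball_compact r.
exact: (subclosed_compact c1 c2 H).
Qed.

Lemma cderiv_support f s r : (forall x, r < `|x| -> f x = 0) ->
  forall x, r < `|x| -> cderiv s f x = 0.
Proof.
move=> H x rx; have d0 : 0 < `|x| - r by rewrite subr_gt0.
apply: (cderiv_eq0 _ d0) => y xy; apply: H.
have := ler_normB x (x - y); rewrite subKr => A.
have := ler_normD (x - y) y; rewrite subrK => B.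
by move: (le_lt_trans B (ltr_leD xy (lexx _))); rewrite -addrA ltrDl addrC subr_gt0.
Qed.

Lemma test_function_schwartz f : test_function f -> schwartz f.
Proof.
move=> /test_functionP[sf [r r0 fr]]; apply/schwartzP; split=> // j k.
have [M M0 HM] := smooth_seminorm j r sf.
exists ((1 + r) ^+ k * M) => [|s y sj _]; first by rewrite mulr_ge0// exprn_ge0// addr_ge0.
have [yr|ry] := leP `|y| r.
  rewrite ler_pM ?normc_ge0 ?exprn_ge0//; last exact: HM.
  by rewrite lerXn2r ?nnegrE ?addr_ge0// lerD2l.
by rewrite (cderiv_support s fr ry) normc0 mulr0 mulr_ge0// exprn_ge0// addr_ge0.
Qed.

Lemma bounded_functional_compact T : compact_distribution T ->
  exists r j C, 0 <= r /\ bounded_functional (@smooth R n) (cball r) j 0 C T.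
Proof.
move=> [lT [K [cK [j [C HC]]]]]; have [r r0 Kr] := compact_cball cK.
(* The constant given by [compact_distribution] may be negative, whereas [bf_ge0] asks for a
   nonnegative one. *)
exists r, j, (Num.max C 0); split; first exact: r0.
split.
- by [].
- by move=> c f g; exact: smooth_lin.
- exact: lT.
- by rewrite le_max lexx orbT.
move=> f M sf M0 H; rewrite -lee_fin; apply: (le_trans (HC f sf)).
have H' : seminorm_le K j 0 f M by apply: seminorm_le_mono H.
have /(sup_upto_le K j sf M0) H2 := H'.
have s0 : (0 <= sup_upto K j f)%E by exact: wsup_ge0.
apply: (@le_trans _ _ ((Num.max C 0)%:E * sup_upto K j f)%E).
  by apply: lee_wpmul2r => //; rewrite lee_fin le_max lexx.
by rewrite EFinM; apply: lee_wpmul2l => //; rewrite lee_fin le_max lexx orbT.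
Qed.

Lemma bounded_functional_distribution T r : Defs.distribution T ->
  exists j C, bounded_functional (test_function_in (cball r)) (cball r) j 0 C T.
Proof.
move=> [lT HT]; have [j [C HC]] := HT _ (@cball_compact r).
have tf f : test_function_in (cball r) f -> test_function f.
  move=> [sf fr]; split=> //.
  by apply: (subclosed_compact _ (@cball_compact r) fr); exact: closed_closure.
exists j, (Num.max C 0); split.
- by move=> f [].
- move=> c f g [sf /fsupport_cball fr] [sg /fsupport_cball gr]; split.
    exact: smooth_lin.
  by apply/fsupport_cball => x rx; rewrite fr// gr// mulr0 addr0.
- by move=> c f g /tf Hf /tf Hg; exact: lT.
- by rewrite le_max lexx orbT.
move=> f M tff M0 H; rewrite -lee_fin; apply: (le_trans (HC f tff)).
have /(sup_upto_le _ j tff.1 M0) H2 := H.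
have s0 : (0 <= sup_upto (cball r) j f)%E by exact: wsup_ge0.
apply: (@le_trans _ _ ((Num.max C 0)%:E * sup_upto (cball r) j f)%E).
  by apply: lee_wpmul2r => //; rewrite lee_fin le_max lexx.
by rewrite EFinM; apply: lee_wpmul2l => //; rewrite lee_fin le_max lexx orbT.
Qed.

Lemma bounded_functional_tempered T : tempered_distribution T ->
  exists j C, bounded_functional (@schwartz R n) setT j j C T.
Proof.
move=> [lT [j [C HC]]].
exists j, (Num.max C 0 * n.+1%:R ^+ j); split.
- by move=> f [].
- by move=> c f g Sf Sg; exact: schwartzD (schwartzZ c Sf) Sg.
- exact: lT.
- by rewrite mulr_ge0 ?exprn_ge0// le_max lexx orbT.
move=> f M Sf M0 H; rewrite -lee_fin; apply: (le_trans (HC f Sf)).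
have H2 := schwartz_norm_le Sf.1 M0 H.
have s0 : (0 <= schwartz_norm j f)%E by exact: wsup_ge0.
apply: (@le_trans _ _ ((Num.max C 0)%:E * schwartz_norm j f)%E).
  by apply: lee_wpmul2r => //; rewrite lee_fin le_max lexx.
by rewrite -mulrA EFinM; apply: lee_wpmul2l => //; rewrite lee_fin le_max lexx orbT.
Qed.

(** Peetre's inequality: a power of 1 + |y| is moved onto [x] at the cost of the same power of 1 +
    |x - y|. *)
Lemma weight_sub x y k : (1 + `|y|) ^+ k <= (1 + `|x|) ^+ k * (1 + `|x - y|) ^+ k.
Proof.
rewrite -exprMn lerXn2r ?nnegrE ?mulr_ge0 ?addr_ge0//.
rewrite mulrDl mul1r mulrDr mulr1 -!addrA lerD2l addrCA.
have := ler_normB x (x - y); rewrite subKr => /le_trans; apply.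
by rewrite addrA lerDl mulr_ge0.
Qed.

Lemma schwartz_tr x f : schwartz f -> schwartz (tr x f).
Proof.
move=> /schwartzP[sf H]; apply/schwartzP; split; first exact: smooth_tr.
move=> j k; have [M M0 HM] := H j k.
exists ((1 + `|x|) ^+ k * M) => [|s y sj _].
  by rewrite mulr_ge0// ltW// weightX_gt0.
rewrite normc_cderiv_tr//; apply: (le_trans (ler_wpM2r (normc_ge0 _) (weight_sub x y k))).
by rewrite -mulrA ler_wpM2l ?(ltW (weightX_gt0 _ _))// HM.
Qed.

Lemma schwartz_cderiv s f : schwartz f -> schwartz (cderiv s f).
Proof.
move=> /schwartzP[sf H]; apply/schwartzP; split; first exact: smooth_cderiv.
move=> j k; have [M M0 HM] := H (j + size s)%N k; exists M => // t y tj _.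
by rewrite cderiv_cat; apply: HM => //; rewrite size_cat leq_add2r.
Qed.

Lemma convolvable_compact T u : compact_distribution T -> smooth u -> convolvable T u.
Proof.
move=> /bounded_functional_compact[r [j [C [r0 bT]]]] su x0.
exists (@smooth R n), (cball r), j, 0%N, C; split; [exact: bT|move=> s x _|move=> m].
  by apply: smooth_tr; exact: smooth_cderiv.
have [M M0 HM] := smooth_seminorm m (1 + `|x0| + r) su.
exists M => // s x y sm xx yr; rewrite expr0 mul1r; apply: HM => //.
apply: (le_trans (ler_normB _ _)); rewrite lerD//.
by rewrite -[x](subrK x0) (le_trans (ler_normD _ _))// lerD2r.
Qed.

Lemma convolvable_distribution T u : Defs.distribution T -> test_function u -> convolvable T u.
Proof.
move=> dT /test_functionP[su [r r0 ur]] x0.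
(* This ball contains the supports of all translates [tr x u] with |x - x0| <= 1. *)
have [j [C bT]] := bounded_functional_distribution (1 + `|x0| + r) dT.
exists (test_function_in (cball (1 + `|x0| + r))), (cball (1 + `|x0| + r)), j, 0%N, C.
have xb x : `|x - x0| <= 1 -> `|x| <= 1 + `|x0|.
  by move=> xx; rewrite -[x](subrK x0) (le_trans (ler_normD _ _))// lerD2r.
split; [exact: bT|move=> s x xx|move=> m].
  split; first by apply: smooth_tr; exact: smooth_cderiv.
  apply/fsupport_cball => y ry; apply: (cderiv_support s ur).
  have := ler_normB x (x - y); rewrite subKr => /(lt_le_trans ry).
  move=> H; rewrite -(ltrD2l `|x|); apply: le_lt_trans H.
  by rewrite lerD2r xb.
have [M M0 HM] := smooth_seminorm m (1 + `|x0| + (1 + `|x0| + r)) su.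
exists M => // s x y sm xx yr; rewrite expr0 mul1r; apply: HM => //.
by apply: (le_trans (ler_normB _ _)); rewrite lerD// xb.
Qed.

Lemma convolvable_tempered T u : tempered_distribution T -> schwartz u -> convolvable T u.
Proof.
move=> /bounded_functional_tempered[j [C bT]] Su x0.
exists (@schwartz R n), setT, j, j, C; split; [exact: bT|move=> s x _|move=> m].
  by apply: schwartz_tr; exact: schwartz_cderiv.
have /schwartzP[su H] := Su; have [M M0 HM] := H m j.
exists ((2 + `|x0|) ^+ j * M) => [|s x y sm xx _].
  by rewrite mulr_ge0// exprn_ge0// addr_ge0.
apply: (le_trans (ler_wpM2r (normc_ge0 _) (weight_sub x y j))).
rewrite -mulrA ler_pM ?exprn_ge0 ?addr_ge0 ?mulr_ge0 ?normc_ge0 ?exprn_ge0 ?addr_ge0//; last exact: HM.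
rewrite lerXn2r ?nnegrE ?addr_ge0// -[2]/(1 + 1) -addrA lerD2l.
by rewrite -[x](subrK x0) (le_trans (ler_normD _ _))// lerD2r.
Qed.

End Instances.

Arguments cball_compact {R n} r.

(** * Interchanging a functional with an integral *)

Section Interchange.
Context {R : realType} {n : nat}.
Local Notation Rn := 'rV[R]_n.
Local Notation fct := (Rn -> R[i]).
Implicit Types (g u v : fct) (x y z d : Rn) (s : seq 'I_n) (A : set Rn)
  (V : set fct) (T : fct -> R[i]) (j k : nat) (C M r : R).

Definition lin_sum (L : seq (R * Rn)) (f : Rn -> fct) : fct :=
  fun y => \sum_(p <- L) (p.1)%:C * f p.2 y.

Lemma bf_zero V A j k C T g : bounded_functional V A j k C T -> V g ->
  V (fun=> 0) /\ T (fun=> 0) = 0.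
Proof.
move=> bT Vg; have E : (fun=> 0 : R[i]) = (fun x => -1 * g x + g x).
  by apply/funext => x; rewrite mulN1r addNr.
by rewrite E; split; [exact: (bf_closed bT)|rewrite (bf_linear bT)// mulN1r addNr].
Qed.

Lemma bf_lin_sum V A j k C T L (f : Rn -> fct) : bounded_functional V A j k C T ->
  (forall x, V (f x)) ->
  [/\ V (lin_sum L f), T (lin_sum L f) = \sum_(p <- L) (p.1)%:C * T (f p.2) &
    forall s y, cderiv s (lin_sum L f) y = \sum_(p <- L) (p.1)%:C * cderiv s (f p.2) y].
Proof.
move=> bT Vf; elim: L => [|p L [V1 T1 D1]].
  have [V0 T0] := bf_zero bT (Vf 0).
  have -> : lin_sum [::] f = fun=> 0 by apply/funext => y; rewrite /lin_sum big_nil.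
  by rewrite big_nil; split=> // s y; rewrite cderiv_cst0 big_nil.
have -> : lin_sum (p :: L) f = fun y => (p.1)%:C * f p.2 y + lin_sum L f y.
  by apply/funext => y; rewrite /lin_sum big_cons.
split.
- exact: (bf_closed bT).
- by rewrite (bf_linear bT)// big_cons T1.
- move=> s y; rewrite (cderiv_lin _ _ (bf_smooth bT (Vf _)) (bf_smooth bT V1)).
  by rewrite big_cons D1.
Qed.

(* Both sides are limits of the same finite sums, by the quadrature rule. *)
Lemma functional_cintegral V A j k C T (f : Rn -> fct) g M :
  bounded_functional V A j k C T -> (forall x, V (f x)) -> V g -> 0 <= M ->
  (forall s y, (size s <= j)%N -> A y ->
    cwlip M (fun x => ((1 + `|y|) ^+ k)%:C * cderiv s (f x) y)) ->
  (forall s y, (size s <= j)%N -> A y ->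
    cderiv s g y = cintegral (fun x => cderiv s (f x) y)) ->
  T g = cintegral (fun x => T (f x)) /\ cwlip (C * M) (fun x => T (f x)).
Proof.
move=> bT Vf Vg M0 Hf Hg; have C0 := bf_ge0 bT.
have wn y (z : R[i]) : normc (((1 + `|y|) ^+ k)%:C * z) = (1 + `|y|) ^+ k * normc z.
  by rewrite normcM normc_real ger0_norm// ltW// weightX_gt0.
(* The weighted bounds pass through [T] because [kappa x] does not involve the variable on which [T]
   acts. *)
have cw : cwlip (C * M) (fun x => T (f x)).
  split=> [x|x x' xx'].
    rewrite -mulrA; apply: (bf_bound bT) => //; first by rewrite mulr_ge0// kappa_ge0.
    by move=> s y sj Ay; rewrite -wn; exact: (Hf s y sj Ay).1.
  have -> : T (f x) - T (f x') = T (fun y => -1 * f x' y + f x y).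
    by rewrite (bf_linear bT)// mulN1r addrC.
  rewrite -!mulrA; apply: (bf_bound bT); first exact: (bf_closed bT).
    by rewrite !mulr_ge0// kappa_ge0.
  move=> s y sj Ay; rewrite (cderiv_lin _ _ (bf_smooth bT (Vf _)) (bf_smooth bT (Vf _))).
  rewrite -wn mulN1r [- _ + _]addrC mulrBr mulrA; exact: (Hf s y sj Ay).2.
split=> //; apply/eqP; rewrite -subr_eq0; apply/eqP; apply: eq0_normc.
apply: le_anti; rewrite normc_ge0 andbT; apply: ler0_eps => e e0.
(* The quadrature errors for [T g] and for the integral of [T (f x)] are each at most d C M; with d
   = e / (2 C M + 1) their sum stays below [e]. *)
have D0 : 0 < 2 * (C * M) + 1 by rewrite ltr_wpDl// !mulr_ge0.
have [L HL] := @cquadrature R n _ (divr_gt0 e0 D0).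
set d := e / _ in HL; have d0 : 0 <= d by rewrite divr_ge0 ?(ltW e0) ?(ltW D0).
have [VL TL DL] := bf_lin_sum L bT Vf.
have H1 : normc (T g - \sum_(p <- L) (p.1)%:C * T (f p.2)) <= C * (d * M).
  rewrite -TL; have -> : T g - T (lin_sum L f) = T (fun y => -1 * lin_sum L f y + g y).
    by rewrite (bf_linear bT)// mulN1r addrC.
  apply: (bf_bound bT); [exact: (bf_closed bT)|exact: mulr_ge0|].
  move=> s y sj Ay; rewrite (cderiv_lin _ _ (bf_smooth bT VL) (bf_smooth bT Vg)).
  rewrite DL Hg// mulN1r [- _ + _]addrC -wn mulrBr mulr_sumr.
  have wne : ((1 + `|y|) ^+ k)%:C != 0 :> R[i].
    by apply/eqP => -[] /eqP; rewrite gt_eqF// weightX_gt0.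
  have -> : ((1 + `|y|) ^+ k)%:C * cintegral (fun x => cderiv s (f x) y) =
      cintegral (fun x => ((1 + `|y|) ^+ k)%:C * cderiv s (f x) y).
    have := cintegralZ (((1 + `|y|) ^+ k)%:C)^-1 (Hf s y sj Ay).
    under eq_fun do rewrite mulKf//.
    by move=> ->; rewrite mulVKf.
  under eq_bigr do rewrite mulrCA.
  exact: HL (Hf s y sj Ay).
have H2 := HL _ _ cw.
have -> : T g - cintegral (fun x => T (f x)) =
   (T g - \sum_(p <- L) (p.1)%:C * T (f p.2)) -
   (cintegral (fun x => T (f x)) - \sum_(p <- L) (p.1)%:C * T (f p.2)).
  by rewrite opprB addrA subrK.
apply: (le_trans (le_normcD _ _)); rewrite normcN.
apply: (le_trans (lerD H1 H2)).
have -> : C * (d * M) + d * (C * M) = e * ((2 * (C * M)) / (2 * (C * M) + 1)).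
  rewrite /d; move: (_^-1) => q; ring.
rewrite ler_piMr ?(ltW e0)// ler_pdivrMr// mul1r lerDl//.
Qed.

End Interchange.

(** * Smoothing by a test function *)

Section Smoothing.
Context {R : realType} {n : nat}.
Local Notation Rn := 'rV[R]_n.
Local Notation fct := (Rn -> R[i]).
Implicit Types (f g h u v rho phi : fct) (x y z d : Rn) (s : seq 'I_n) (i : 'I_n) (m : nat) (B C M r l : R).

(** Weaker than smoothness, so as to include the plateau function that [exists_cutoff] smooths
    out. *)
Definition loc_lipschitz v : Prop := forall r, exists2 M : R, 0 <= M &
  (forall x, `|x| <= r -> normc (v x) <= M) /\
  (forall x x', `|x| <= r -> `|x'| <= r -> normc (v x - v x') <= M * `|x - x'|).

Lemma smooth_loc_lipschitz v : smooth v -> loc_lipschitz v.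
Proof.
move=> sv r; have [M M0 HM] := smooth_seminorm 1 (r + (r + r)) sv.
have nM0 : 0 <= 2 * (n%:R * M) by rewrite !mulr_ge0.
exists (M + 2 * (n%:R * M)); first exact: addr_ge0.
split=> [x xr|x x' xr xr'].
  have -> : v x = cderiv [::] v x by rewrite cderiv0.
  apply: (@le_trans _ _ M); last by rewrite lerDl.
  apply: HM => //; apply: (le_trans xr); have := le_trans (normr_ge0 x) xr.
  by move=> r0; rewrite lerDl addr_ge0.
have xx : `|x - x'| <= r + r by apply: (le_trans (ler_normB _ _)); exact: lerD.
have := @smooth_incr R n v x' (x - x') M sv M0; rewrite [x' + _]addrC subrK => H.
apply: (@le_trans _ _ (2 * (n%:R * M * `|x - x'|))).
  apply: H => i z zx; apply: HM => //.
  rewrite -[z](subrK x') addrC (le_trans (ler_normD _ _))// lerD//.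
  exact: le_trans xx.
have -> : 2 * (n%:R * M * `|x - x'|) = 2 * (n%:R * M) * `|x - x'| by ring.
by apply: ler_wpM2r; rewrite // lerDr.
Qed.

Definition bounded_lip r B h : Prop := [/\ 0 <= B, forall x, r < `|x| -> h x = 0,
  forall x, normc (h x) <= B &
  forall x x', `|x - x'| <= 1 -> normc (h x - h x') <= B * `|x - x'|].

(** [C] depends on [v] and [r] only, so that the estimate is uniform in [h]. *)
Lemma bounded_lip_prod v r : loc_lipschitz v -> exists2 C : R, 0 <= C &
  forall h B, bounded_lip r B h -> cwlip (C * B) (fun x => v x * h x).
Proof.
move=> /(_ (r + 1))[M M0 [Mv Lv]]; have [C C0 HC] := @cwlip_support R n r.
exists (C * (3 * M)) => [|h B [B0 hr hB hL]]; first by rewrite !mulr_ge0.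
have -> : C * (3 * M) * B = C * (M * B + (M * B + M * B)) by ring.
have MB : 0 <= M * B by rewrite mulr_ge0.
apply: HC => [||x rx|x|x x' xx].
- by [].
- exact: addr_ge0.
- by rewrite hr// mulr0.
- have [xr|rx] := leP `|x| r; last by rewrite hr// mulr0 normc0.
  by rewrite normcM ler_pM ?normc_ge0// Mv// (le_trans xr)// lerDl.
have far z z' : `|z - z'| <= 1 -> r + 1 < `|z| -> r < `|z'|.
  move=> zz rz; rewrite -(ltrD2r 1); apply: (lt_le_trans rz).
  by rewrite -[X in `|X|](subrK z') (le_trans (ler_normD _ _))// addrC lerD2l.
have zero z : r + 1 < `|z| -> h z = 0.
  by move=> rz; apply: hr; apply: le_lt_trans rz; rewrite lerDl.
have MBx : 0 <= (M * B + M * B) * `|x - x'| by rewrite mulr_ge0// addr_ge0.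
have [xr|rx] := leP `|x| (r + 1); last first.
  by rewrite (zero x)// (hr x' (far _ _ xx rx)) !mulr0 subrr normc0.
have [xr'|rx'] := leP `|x'| (r + 1); last first.
  have xx' : `|x' - x| <= 1 by rewrite distrC.
  by rewrite (zero x')// (hr x (far _ _ xx' rx')) !mulr0 subrr normc0.
have -> : v x * h x - v x' * h x' = v x * (h x - h x') + (v x - v x') * h x'.
  by rewrite mulrBr mulrBl addrA subrK.
apply: (le_trans (le_normcD _ _)); rewrite !normcM mulrDl -!mulrA; apply: lerD.
  by rewrite ler_pM ?normc_ge0// ?Mv ?hL.
by rewrite [B * _]mulrC mulrA ler_pM ?normc_ge0// Lv.
Qed.

Lemma test_bounded_lip phi r : smooth phi -> (forall x, r < `|x| -> phi x = 0) ->
  forall m, exists2 B : R, 0 <= B & forall s, (size s <= m)%N -> bounded_lip r B (cderiv s phi).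
Proof.
move=> sp pr m; have [M M0 HM] := smooth_seminorm m.+1 r sp.
have nM0 : 0 <= 2 * (n%:R * M) by rewrite !mulr_ge0.
have HM' s z : (size s <= m.+1)%N -> normc (cderiv s phi z) <= M.
  move=> sm; have [zr|rz] := leP `|z| r; first exact: HM.
  by rewrite (cderiv_support s pr rz) normc0.
exists (M + 2 * (n%:R * M)) => [|s sm]; first exact: addr_ge0.
split=> [|||x x' xx].
- exact: addr_ge0.
- exact: cderiv_support.
- move=> x; apply: (@le_trans _ _ M); last by rewrite lerDl.
  by apply: HM'; exact: leq_trans sm _.
have := @smooth_incr R n _ x' (x - x') M (smooth_cderiv s sp) M0.
rewrite [x' + _]addrC subrK => H; apply: (@le_trans _ _ (2 * (n%:R * M * `|x - x'|))).
  by apply: H => i z zx; rewrite cderiv_cat; apply: HM'.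
have -> : 2 * (n%:R * M * `|x - x'|) = 2 * (n%:R * M) * `|x - x'| by ring.
by apply: ler_wpM2r; rewrite // lerDr.
Qed.

Lemma bounded_lip_reflect r B h y : bounded_lip r B h ->
  bounded_lip (r + `|y|) B (fun x => h (y - x)).
Proof.
move=> [B0 hr hB hL]; split=> // [x rx|x x' xx].
  apply: hr; rewrite -(ltrD2r `|y|); apply: (lt_le_trans rx).
  by have := ler_normB y (y - x); rewrite subKr addrC.
have E : (y - x) - (y - x') = x' - x by rewrite opprB addrC addrA subrK.
by have := hL (y - x) (y - x'); rewrite E distrC; apply.
Qed.

Lemma cintegral_support r : exists2 C : R, 0 <= C & forall F (M M' : R), cwlip M' F -> 0 <= M ->
  (forall x, r < `|x| -> F x = 0) -> (forall x, `|x| <= r -> normc (F x) <= M) ->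
  normc (cintegral F) <= C * M.
Proof.
have [k k0 Hk] := @kappa_compact R n r.
have c0 : 0 <= kappa1_mass ^+ n :> R by rewrite exprn_ge0// kappa1_mass_ge0.
exists (2 * (k^-1 * kappa1_mass ^+ n)) => [|F M M' cF M0 F0 FM].
  by rewrite !mulr_ge0// invr_ge0 ltW.
have -> : 2 * (k^-1 * kappa1_mass ^+ n) * M = 2 * (k^-1 * M * kappa1_mass ^+ n) by ring.
apply: (cintegral_bound cF) => x.
have [xr|rx] := leP `|x| r; last by rewrite F0// normc0 !mulr_ge0 ?kappa_ge0// invr_ge0 ltW.
apply: (le_trans (FM x xr)); rewrite mulrAC ler_peMl// mulrC ler_pdivlMr// mul1r.
exact: Hk.
Qed.

Lemma lee_mul_bound (a C : R) (S : \bar R) : 0 < C -> (0 <= S)%E ->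
  (forall M, 0 <= M -> (S <= M%:E)%E -> a <= C * M) -> (a%:E <= C%:E * S)%E.
Proof.
move=> C0; case: S => [M M0 H|_ _|//].
  by rewrite -EFinM lee_fin; apply: H.
by rewrite gt0_muley ?lte_fin// leey.
Qed.

Definition smear phi v y : R[i] := cintegral (fun x => v x * phi (y - x)).

(** The regular distribution with density [v]. Through it [smear phi v] is the convolution of [phi]
    with a distribution, and differentiation under the integral sign becomes an instance of
    [conv_smooth]. *)
Lemma distribution_density v : loc_lipschitz v ->
  Defs.distribution (fun h => cintegral (fun x => v x * h x)).
Proof.
move=> lv; split.
  move=> c f g /test_functionP[sf [r r0 fr]] /test_functionP[sg [r' r0' gr]].
  have [B B0 HB] := test_bounded_lip sf fr 0; have := HB [::] (leqnn _); rewrite cderiv0 => Bf.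
  have [B' B0' HB'] := test_bounded_lip sg gr 0; have := HB' [::] (leqnn _); rewrite cderiv0 => Bg.
  have [C _ HC] := bounded_lip_prod r lv; have [C' _ HC'] := bounded_lip_prod r' lv.
  rewrite -(cintegral_lin c (HC _ _ Bf) (HC' _ _ Bg)); congr cintegral; apply/funext => x.
  by rewrite mulrDr mulrCA.
move=> K cK; have [r r0 Kr] := compact_cball cK.
have [M M0 [Mv _]] := lv r; have [C C0 HC] := cintegral_support r.
exists 0%N, (C * M + 1) => f [sf fK].
have fr : forall x, r < `|x| -> f x = 0.
  by apply/fsupport_cball; exact: subset_trans fK Kr.
apply: lee_mul_bound; [by rewrite ltr_wpDl// mulr_ge0|exact: wsup_ge0|].
move=> N N0 /(sup_upto_le _ _ sf N0) HN.
have [B B0 HB] := test_bounded_lip sf fr 0; have := HB [::] (leqnn _); rewrite cderiv0 => Bf.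
have [C' _ HC'] := bounded_lip_prod r lv.
apply: (@le_trans _ _ (C * (M * N))).
  apply: (HC _ _ _ (HC' _ _ Bf)) => [|x rx|x xr]; first exact: mulr_ge0.
    by rewrite fr// mulr0.
  rewrite normcM ler_pM ?normc_ge0 ?Mv//.
  have [Kx|nKx] := pselect (K x).
    by have := HN [::] x (leqnn _) Kx; rewrite expr0 mul1r cderiv0.
  by have -> := (fsupport_subset f (compact_closed (@norm_hausdorff _ _) cK)).1 fK x nKx; rewrite normc0.
by rewrite mulrA ler_wpM2r// lerDl.
Qed.

Lemma smear_smooth phi v : test_function phi -> loc_lipschitz v ->
  smooth (smear phi v) /\ forall s, cderiv s (smear phi v) = smear (cderiv s phi) v.
Proof.
move=> tp lv; have sp : smooth phi by case: tp.
exact: (conv_smooth sp (convolvable_distribution (distribution_density lv) tp)).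
Qed.

(* [blur rho l] is the transpose of the convolution with [rho_l]. *)
Definition blur rho l v y : R[i] := cintegral (fun z => rho z * v (y + l *: z)).

(** The image of the density [rho] under z -> - l z. The convolution of [v] with it is
    [blur rho l v], so that this time the derivatives fall on [v]. The form [0 + (- l) *: z] fits
    the lemmas on affine substitutions. *)
Lemma compact_distribution_blur rho l : test_function rho ->
  compact_distribution (fun h => cintegral (fun z => rho z * h (0 + (- l) *: z))).
Proof.
move=> /test_functionP[sr [r r0 rr]].
have [B B0 HB] := test_bounded_lip sr rr 0; have := HB [::] (leqnn _); rewrite cderiv0 => Br.
have cw h : smooth h -> exists M, cwlip M (fun z => rho z * h (0 + (- l) *: z)).
  move=> sh; have lh := smooth_loc_lipschitz (smooth_affine 0 (- l) sh).
  have [C C0 HC] := bounded_lip_prod r lh; exists (C * B).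
  by apply: cwlip_ext (HC _ _ Br) => z; rewrite mulrC.
split.
  move=> c f g sf sg; have [Mf Hf] := cw f sf; have [Mg Hg] := cw g sg.
  rewrite -(cintegral_lin c Hf Hg); congr cintegral; apply/funext => z.
  by rewrite mulrDr mulrCA.
exists (cball (`|l| * r)); split; first exact: cball_compact.
have [C C0 HC] := cintegral_support r.
exists 0%N, (C * B + 1) => f sf.
apply: lee_mul_bound; [by rewrite ltr_wpDl// mulr_ge0|exact: wsup_ge0|].
move=> N N0 /(sup_upto_le _ _ sf N0) HN; have [Mf Hf] := cw f sf.
apply: (@le_trans _ _ (C * (B * N))).
  apply: (HC _ _ _ Hf) => [|x rx|x xr]; first exact: mulr_ge0.
    by rewrite rr// mul0r.
  rewrite normcM ler_pM ?normc_ge0//; first by case: Br.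
  have := HN [::] (0 + (- l) *: x) (leqnn _); rewrite expr0 mul1r cderiv0; apply.
  by rewrite /cball /= add0r normrZ normrN ler_wpM2l.
by rewrite mulrA ler_wpM2r// lerDl.
Qed.

Lemma blur_smooth rho l v : test_function rho -> smooth v ->
  smooth (blur rho l v) /\ forall s, cderiv s (blur rho l v) = blur rho l (cderiv s v).
Proof.
move=> tr_ sv; have E w : blur rho l w = fun x => cintegral (fun z => rho z * tr x w (0 + (- l) *: z)).
  apply/funext => y; congr cintegral; apply/funext => z.
  by rewrite /tr add0r scaleNr opprK.
have [s1 s2] := conv_smooth sv (convolvable_compact (compact_distribution_blur l tr_) sv).
by rewrite E; split=> // s; rewrite s2 E.
Qed.

(** As [rho] has integral 1, the error is the integral of rho(z) (w(y + l z) - w(y)), where w is the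
    derivative of [v] along [s]; the mean value estimate on the support of [rho] yields the factor
    [l]. *)
Lemma blur_error rho : test_function rho -> cintegral rho = 1 ->
  exists r C, [/\ 0 <= r, 0 <= C & forall v l, smooth v -> 0 <= l <= 1 ->
    forall s y B, 0 <= B -> (forall i z, `|z - y| <= r -> normc (cderiv (i :: s) v z) <= B) ->
    normc (cderiv s (fun y => blur rho l v y - v y) y) <= C * (l * B)].
Proof.
move=> tr_ irho; have /test_functionP[sr [r r0 rr]] := tr_.
have [B B0 HB] := test_bounded_lip sr rr 0; have := HB [::] (leqnn _); rewrite cderiv0 => Br.
have [C C0 HC] := cintegral_support r.
(* [C] bounds integrals over the ball of radius [r], [B] bounds [rho], 2 n comes from the mean value
   estimate and [r] from |l z| <= l r. *)
exists r, (C * (B * (2 * (n%:R * r)))); split=> //; first by rewrite !mulr_ge0.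
move=> v l sv /andP[l0 l1] s y D D0 HD.
have [sb Eb] := blur_smooth l tr_ sv.
rewrite (cderivB s sb sv) Eb; have sw := smooth_cderiv s sv.
set w := cderiv s v in sw *.
have [Cw _ HCw] := bounded_lip_prod r (smooth_loc_lipschitz (smooth_affine y l sw)).
have cw1 : cwlip (Cw * B) (fun z => rho z * w (y + l *: z)).
  by apply: cwlip_ext (HCw _ _ Br) => z; rewrite mulrC.
have [C2 _ HC2] := @cwlip_support R n r.
have [_ _ rB rL] := Br; have cr := HC2 rho B B B0 B0 rr rB rL.
have -> : blur rho l w y - w y = cintegral (fun z => - w y * rho z + rho z * w (y + l *: z)).
  by rewrite (cintegral_lin (- w y) cr cw1) irho mulr1 addrC.
have -> : C * (B * (2 * (n%:R * r))) * (l * D) = C * (B * (2 * (n%:R * D * (l * r)))) by ring.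
have [M HM] : exists M, cwlip M (fun z => - w y * rho z + rho z * w (y + l *: z)).
  have [C3 _ HC3] := bounded_lip_prod r
    (smooth_loc_lipschitz (smooth_lin 1 (smooth_affine y l sw) (smooth_affine y 0 (smoothZ (-1) sw)))).
  exists (C3 * B); apply: cwlip_ext (HC3 _ _ Br) => z.
  by rewrite scale0r addr0 mul1r mulN1r mulrDl addrC [rho z * _]mulrC.
apply: (HC _ _ _ HM) => [|z rz|z zr].
- by rewrite !mulr_ge0.
- by rewrite rr// mulr0 mul0r addr0.
have -> : - w y * rho z + rho z * w (y + l *: z) = rho z * (w (y + l *: z) - w y).
  by rewrite mulrBr addrC mulNr [w y * _]mulrC.
have lz : `|l *: z| <= l * r by rewrite normrZ ger0_norm// ler_wpM2l.
rewrite normcM ler_pM ?normc_ge0//.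
apply: (@le_trans _ _ (2 * (n%:R * D * `|l *: z|))).
  apply: (smooth_incr sw D0) => i z' zz'; rewrite cderiv_cat; apply: HD.
  apply: (le_trans zz'); apply: (le_trans lz).
  by rewrite ler_piMl.
by rewrite ler_wpM2l// ler_wpM2l// mulr_ge0.
Qed.

(** Substitution x = y + l z. In [blur] the variable [y] sits in [v], in [smear] it sits in the
    kernel, where a functional can act on it. *)
Lemma blur_smear rho l v y : test_function rho -> smooth v -> 0 < l ->
  blur rho l v y = smear (fun w => (l ^- n)%:C * rho (l^-1 *: (- w))) v y.
Proof.
move=> tr_ sv l0; have /test_functionP[sr [r r0 rr]] := tr_.
pose phi w := (l ^- n)%:C * rho (l^-1 *: (- w)).
have phiE : phi = fun w => (l ^- n)%:C * rho (0 + (- l^-1) *: w).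
  by apply/funext => w; rewrite /phi add0r scalerN scaleNr.
have sp : smooth phi by rewrite phiE; exact: smoothZ (smooth_affine _ _ sr).
have pr w : l * r < `|w| -> phi w = 0.
  move=> lw; rewrite /phi rr ?mulr0// scalerN normrN normrZ normfV (gtr0_norm l0).
  by rewrite ltr_pdivlMl.
have [B B0 HB] := test_bounded_lip sp pr 0; have := HB [::] (leqnn _); rewrite cderiv0 => Bp.
have [C _ HC] := bounded_lip_prod (l * r + `|y|) (smooth_loc_lipschitz sv).
have cw := HC _ _ (bounded_lip_reflect y Bp).
rewrite /smear -/phi (cintegral_affine y l0 cw) /blur.
have [C' _ HC'] := bounded_lip_prod r (smooth_loc_lipschitz (smooth_affine y l sv)).
have [B' B0' HB'] := test_bounded_lip sr rr 0; have := HB' [::] (leqnn _); rewrite cderiv0 => Br.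
have ln : (l ^+ n)%:C != 0 :> R[i].
  by apply/eqP => -[] /eqP; rewrite gt_eqF// exprn_gt0.
have -> : (fun x => v (y + l *: x) * phi (y - (y + l *: x))) =
  fun x => (l ^- n)%:C * (v (y + l *: x) * rho x).
  apply/funext => x; rewrite /phi opprB addrAC subrr add0r scalerA.
  by rewrite mulVf ?gt_eqF// scale1r mulrCA.
rewrite (cintegralZ _ (HC' _ _ Br)) mulrA -rmorphM /= divff ?mul1r; last first.
  by rewrite expf_neq0// gt_eqF.
by congr cintegral; apply/funext => z; rewrite mulrC.
Qed.

Definition clamp (t : R) : R := Num.max 0 (Num.min 1 t).

Lemma clampP t : [\/ t <= 0 /\ clamp t = 0, 0 <= t <= 1 /\ clamp t = t | 1 <= t /\ clamp t = 1].
Proof.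
case: (boolP (t <= 0)) => [t0|].
  by apply: Or31; split=> //; rewrite /clamp min_r ?max_l// (le_trans t0).
rewrite -ltNge => /ltW t0; case: (boolP (t <= 1)) => [t1|].
  by apply: Or32; split; [rewrite t0|rewrite /clamp min_r// max_r].
by rewrite -ltNge => /ltW t1; apply: Or33; split=> //; rewrite /clamp min_l ?max_r.
Qed.

Lemma clamp_lipschitz p q : `|clamp p - clamp q| <= `|p - q|.
Proof.
have : p - q <= `|p - q| := ler_norm _.
have : q - p <= `|p - q| by rewrite distrC; exact: ler_norm.
move: `|p - q| => N A B; rewrite ler_norml; apply/andP.
by case: (clampP p) => -[+ ->]; case: (clampP q) => -[+ ->]; split; lra.
Qed.

(** [rho] itself provides the smoothing: a Lipschitz plateau, equal to 1 up to radius a + r and to 0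
    beyond a + r + 1, is averaged against [rho], whose integral is 1 and whose support has radius
    [r]. The real part is taken because [rho] may be complex-valued. *)
Lemma exists_cutoff rho (a : R) : test_function rho -> cintegral rho = 1 -> 0 <= a ->
  exists chi : Rn -> R, exists2 b : R, a <= b & [/\ rsmooth chi,
    forall x, `|x| <= a -> chi x = 1 & forall x, b < `|x| -> chi x = 0].
Proof.
move=> tr_ irho a0; have /test_functionP[sr [r r0 rr]] := tr_.
pose v x : R[i] := (clamp (a + r + 1 - `|x|))%:C.
have v1 x : `|x| <= a + r -> v x = 1.
  move=> xr; rewrite /v /clamp min_l ?max_r ?ler01//.
  by rewrite lerBrDl lerD2r.
have v0 x : a + r + 1 < `|x| -> v x = 0.
  move=> rx; have lt0 : a + r + 1 - `|x| <= 0 by rewrite subr_le0 ltW.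
  by rewrite /v /clamp min_r ?max_l// (le_trans lt0).
have vL x x' : normc (v x - v x') <= `|x - x'|.
  rewrite -rmorphB normc_real; apply: (le_trans (clamp_lipschitz _ _)).
  have -> : a + r + 1 - `|x| - (a + r + 1 - `|x'|) = `|x'| - `|x| by ring.
  by rewrite distrC ler_dist_dist.
have vb x : normc (v x) <= 1.
  rewrite normc_real ger0_norm /clamp; first by rewrite ge_max ler01 ge_min lexx.
  by rewrite le_max lexx.
have lv : loc_lipschitz v.
  move=> r'; exists 1 => //; split=> [x _|x x' _ _]; first exact: vb.
  by rewrite mul1r.
pose phi w := (1 : R[i]) * rho (0 + (- 1) *: w).
have sp : smooth phi by exact: smoothZ (smooth_affine _ _ sr).
have pr w : r < `|w| -> phi w = 0.
  by move=> rw; rewrite /phi rr ?mulr0// add0r scaleN1r normrN.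
have tp : test_function phi by apply/test_functionP; split=> //; exists r.
have [ss _] := smear_smooth tp lv.
have [B B0 HB] := test_bounded_lip sp pr 0; have := HB [::] (leqnn _); rewrite cderiv0 => Bp.
have E y : smear phi v y = cintegral (fun z => v (y + z) * rho z).
  have [C _ HC] := bounded_lip_prod (r + `|y|) lv.
  rewrite /smear (cintegral_affine y ltr01 (HC _ _ (bounded_lip_reflect y Bp))).
  rewrite expr1n mul1r; congr cintegral; apply/funext => z.
  by rewrite /phi scale1r mul1r opprD addNKr add0r scaleN1r opprK.
exists (fun x => complex.Re (smear phi v x)), (a + r + 1 + r).
  by rewrite -!addrA lerDl !addr_ge0.
split=> [|x xa|x xb].
- by case: ss.
- rewrite E; have -> : (fun z => v (x + z) * rho z) = rho; last by rewrite irho.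
  apply/funext => z; have [zr|rz] := leP `|z| r; last by rewrite rr// mulr0.
  by rewrite v1 ?mul1r// (le_trans (ler_normD _ _))// lerD.
- rewrite E; have -> : (fun z => v (x + z) * rho z) = fun=> 0; last by rewrite cintegral0.
  apply/funext => z; have [zr|rz] := leP `|z| r; last by rewrite rr// mulr0.
  rewrite v0 ?mul0r//; move: xb; rewrite -[x in `|x|](addrK z) => xb.
  have := lt_le_trans xb (ler_normB _ _) => H.
  by rewrite -(ltrD2r r); apply: (lt_le_trans H); rewrite lerD2l.
Qed.

End Smoothing.

(** * Multiplication by a cutoff *)

Section Cutoff.
Context {R : realType} {n : nat}.
Local Notation Rn := 'rV[R]_n.
Implicit Types (chi : Rn -> R) (f : Rn -> R[i]) (s : seq 'I_n).

Lemma smooth_cutoff chi f : rsmooth chi -> smooth f ->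
  smooth (fun x => (chi x)%:C * f x) /\
  forall s x, cderiv s (fun x => (chi x)%:C * f x) x =
    \sum_(p <- leibniz s) (foldr pderiv chi p.1 x)%:C * cderiv p.2 f x.
Proof.
move=> sc [sr si].
have Er : (fun x => complex.Re ((chi x)%:C * f x)) = fun x => chi x * complex.Re (f x).
  by apply/funext => x; rewrite cReZ.
have Ei : (fun x => complex.Im ((chi x)%:C * f x)) = fun x => chi x * complex.Im (f x).
  by apply/funext => x; rewrite cImZ.
have [Dr Sr] := rsmoothM sc sr; have [Di Si] := rsmoothM sc si.
split; first by rewrite /smooth Er Ei; exact: conj Sr Si.
move=> s x; rewrite /cderiv Er Ei Dr Di /lsum; apply: complex_eq => /=.
  elim: (leibniz s) => [|p L IH]; first by rewrite !big_nil.
  by rewrite !big_cons IH cReD cReZ.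
elim: (leibniz s) => [|p L IH]; first by rewrite !big_nil.
by rewrite !big_cons IH cImD cImZ.
Qed.

Lemma rsmooth_complex chi : rsmooth chi -> smooth (fun x => (chi x)%:C : R[i]).
Proof.
move=> sc; split => /=; first exact: sc.
by have [] := @smooth0 R n.
Qed.

Lemma foldr_pderiv_bounded chi m (r : R) : rsmooth chi -> exists2 M : R, 0 <= M &
  forall s x, (size s <= m)%N -> `|x| <= r -> `|foldr pderiv chi s x| <= M.
Proof.
move=> /rsmooth_complex/(smooth_seminorm m r)[M M0 HM]; exists M => // s x sm xr.
apply: le_trans (HM s x sm xr); exact: (abs_Re_le (cderiv s (fun x => (chi x)%:C) x)).
Qed.

Lemma cutoff_bound chi m (r : R) : rsmooth chi -> exists2 C : R, 0 <= C &
  forall f (M : R), smooth f -> 0 <= M -> forall x, `|x| <= r ->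
  (forall s, (size s <= m)%N -> normc (cderiv s f x) <= M) ->
  forall s, (size s <= m)%N -> normc (cderiv s (fun x => (chi x)%:C * f x) x) <= C * M.
Proof.
move=> sc; have [B B0 HB] := foldr_pderiv_bounded m r sc.
have [||D D0 HD] := @words_uniform R n (fun s D => (size (leibniz s))%:R <= D) m.
- by move=> s M M' _ MM /le_trans; apply.
- by move=> s _; exists (size (leibniz s))%:R.
(* [D] bounds the number of Leibniz terms and [B] the derivatives of [chi], so the constant does not
   depend on [f]. *)
exists (D * B) => [|f M sf M0 x xr HM s sm]; first exact: mulr_ge0.
rewrite (smooth_cutoff sc sf).2.
apply: (@le_trans _ _ ((size (leibniz s))%:R * (B * M))); last first.
  by rewrite -mulrA ler_wpM2r ?mulr_ge0// HD.
have : {subset leibniz s <= leibniz s} by [].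
(* The sum is generalized to sublists of [leibniz s], whose members keep their length bounds. *)
move: {1 3 4}(leibniz s) => L; elim: L => [|p L IH] sub.
  by rewrite big_nil normc0 mul0r.
have /leibniz_size[p1 p2] : p \in leibniz s by apply: sub; rewrite mem_head.
rewrite big_cons; apply: (le_trans (le_normcD _ _)).
have -> : (size (p :: L))%:R * (B * M) = B * M + (size L)%:R * (B * M).
  by rewrite -natr1 mulrDl mul1r addrC.
apply: lerD; last first.
  by apply: IH => q qL; apply: sub; rewrite inE qL orbT.
rewrite normcM normc_real ler_pM ?normc_ge0//.
  by apply: HB => //; exact: leq_trans sm.
by apply: HM; exact: leq_trans sm.
Qed.

End Cutoff.

(** * Valuations and classes of nets *)

Section ExpVal.
Context {R : realType}.
Local Notation I := (eps01 R).
Implicit Types (f g h : I -> \bar R) (a b c : R).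

Lemma expval_ge0 f : 0 <= expval f.
Proof. by apply: fine_ge0; exact: expeR_ge0. Qed.

Lemma Oeps_valuation f b : Oeps f b -> (b%:E <= valuation f)%E.
Proof. by move=> fb; apply: ereal_sup_ubound; exists b. Qed.

Lemma expval_le f b : Oeps f b -> expval f <= expR (- b).
Proof.
move=> /Oeps_valuation; rewrite /expval; case: (valuation f) => [v|_|//] /=.
  by rewrite lee_fin => bv; rewrite ler_expR lerN2.
exact: expR_ge0.
Qed.

Lemma expval_le_eps f c : (forall b, b < - ln c -> Oeps f b) -> 0 < c -> expval f <= c.
Proof.
move=> H c0; apply/ler_addgt0Pr => e e0.
have ce : 0 < c + e by exact: addr_gt0.
rewrite -[leRHS](lnK ce) -[X in expR X]opprK; apply: expval_le; apply: H.
by rewrite ltrN2 ltr_ln ?posrE// ltrDl.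
Qed.

Lemma expval_eq0 f : (forall b, Oeps f b) -> expval f = 0.
Proof.
move=> H; apply: le_anti; rewrite expval_ge0 andbT; apply: ler0_eps => e e0.
by apply: expval_le_eps => // b _; exact: H.
Qed.

Lemma OepsS f a b : b <= a -> Oeps f a -> Oeps f b.
Proof. by move=> ba; exact: Oeps_mono. Qed.

(** The strict bound on [b] accounts for a supremum that need not be attained. The hypothesis
    [Oeps f b0] rules out the valuation -oo, at which [expval] takes the default value 0 through
    [fine]. *)
Lemma Oeps_expval f b0 c b : Oeps f b0 -> expval f <= c -> 0 < c -> b < - ln c -> Oeps f b.
Proof.
move=> fb0 fc c0 bc.
have [b' fb' bb'] : exists2 b', Oeps f b' & b < b'.
  apply: contrapT => H.
  have vb : (valuation f <= b%:E)%E.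
    apply: ge_ereal_sup => _ [b' fb' <-]; rewrite lee_fin leNgt; apply/negP => bb'.
    by apply: H; exists b'.
  have := Oeps_valuation fb0; move: vb fc; rewrite /expval.
  case: (valuation f) => [v|//|//] /=; rewrite !lee_fin => vb fc _.
  have : c < expR (- v).
    rewrite -[ltLHS](lnK c0) ltr_expR ltrNr; exact: le_lt_trans bc.
  by rewrite ltNge fc.
by apply: OepsS fb'; exact: ltW.
Qed.

Lemma expval_max f g h bf bg : Oeps f bf -> Oeps g bg ->
  (forall b, Oeps f b -> Oeps g b -> Oeps h b) ->
  expval h <= Num.max (expval f) (expval g).
Proof.
move=> fb gb H; apply/ler_addgt0Pr => e e0.
set c := Num.max _ _ + e.
have c0 : 0 < c by rewrite ltr_wpDl// le_max expval_ge0.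
apply: expval_le_eps => // b bc; apply: H.
  apply: Oeps_expval fb _ c0 bc; rewrite /c (le_trans (_ : _ <= Num.max (expval f) (expval g)))//.
    by rewrite le_max lexx.
  by rewrite lerDl ltW.
apply: Oeps_expval gb _ c0 bc; rewrite /c (le_trans (_ : _ <= Num.max (expval f) (expval g)))//.
  by rewrite le_max lexx orbT.
by rewrite lerDl ltW.
Qed.

Lemma ler_mul_eps (x p q : R) : 0 <= p -> 0 <= q ->
  (forall t, 0 < t -> x <= (p + t) * (q + t)) -> x <= p * q.
Proof.
move=> p0 q0 H; apply/ler_addgt0Pr => e e0.
have D0 : 0 < p + q + 1 by rewrite ltr_wpDl// addr_ge0.
pose t : R := Num.min 1 (e / (p + q + 1)).
have t0 : 0 < t by rewrite lt_min ltr01 divr_gt0.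
have t1 : t <= 1 by rewrite ge_min lexx.
have te : t * (p + q + 1) <= e by rewrite -ler_pdivlMr// ge_min lexx orbT.
apply: (le_trans (H t t0)).
have -> : (p + t) * (q + t) = p * q + t * (p + q + t) by ring.
rewrite lerD2l; apply: le_trans te; rewrite ler_pM2l//.
by rewrite lerD2l.
Qed.

Lemma expval_mul f g h bf bg : Oeps f bf -> Oeps g bg ->
  (forall a b, Oeps f a -> Oeps g b -> Oeps h (a + b)) ->
  expval h <= expval f * expval g.
Proof.
move=> fb gb H; apply: ler_mul_eps => [||t t0]; [exact: expval_ge0..|].
have cf : 0 < expval f + t by rewrite ltr_wpDl// expval_ge0.
have cg : 0 < expval g + t by rewrite ltr_wpDl// expval_ge0.
apply: expval_le_eps; last exact: mulr_gt0.
move=> b; rewrite lnM ?posrE// => bc.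
(* Half of the slack in the exponent goes to each factor. *)
pose d : R := (- (ln (expval f + t) + ln (expval g + t)) - b) / 2.
have d0 : 0 < d by rewrite divr_gt0// subr_gt0.
have -> : b = (- ln (expval f + t) - d) + (- ln (expval g + t) - d).
  by rewrite /d; field.
apply: H.
  by apply: Oeps_expval fb _ cf _; rewrite ?lerDl ?ltW// ltrBlDr ltrDl.
by apply: Oeps_expval gb _ cg _; rewrite ?lerDl ?ltW// ltrBlDr ltrDl.
Qed.

Lemma insubd_mscal (z : snet R) : smoderate z -> val (insubd (0 : mscal R) z) = z.
Proof. by move=> mz; apply: insubdK; rewrite inE. Qed.

Lemma snorm_repr (z : snet R) (Z : Ct R) b : crepresents z Z ->
  Oeps (snorm z) b -> Oeps (snorm (val (repr Z))) b.
Proof.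
move=> [mz <-] zb; set Z' := repr _.
have Hz := insubd_mscal mz.
have : snegligible (val (Z' - insubd (0 : mscal R) z)).
  by apply/CtP; rewrite /Z' reprK.
have [q bq] : exists q : nat, b <= q%:R by exists (Num.truncn b).+1; rewrite ltW// truncnS_gt.
move=> /(_ q)/(OepsS bq) H.
have -> : val Z' = val (Z' - insubd (0 : mscal R) z) + z.
  by rewrite raddfB /= Hz subrK.
exact: snormD.
Qed.

Lemma sharp_norm_le (z : snet R) (Z : Ct R) b : crepresents z Z ->
  Oeps (snorm z) b -> sharp_norm Z <= expR (- b).
Proof. by move=> zZ zb; apply: expval_le; exact: snorm_repr zZ zb. Qed.

Lemma cclsP (y z : snet R) : smoderate z -> snegligible (y - z) -> smoderate y /\ ccls y = ccls z.
Proof.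
move=> mz nyz.
have mn : smoderate (y - z).
  by exists 0%N; apply: OepsS (nyz 0%N); rewrite mulr0n oppr0.
have my : smoderate y by have := smoderateD mn mz; rewrite subrK.
split=> //; apply/CtP; rewrite raddfB /=.
by rewrite (insubd_mscal my) (insubd_mscal mz).
Qed.

Lemma crepresentsB (y z : snet R) (Y Z : Ct R) : crepresents y Y -> crepresents z Z ->
  crepresents (y - z) (Y - Z).
Proof.
move=> [my <-] [mz <-]; have myz : smoderate (y - z).
  by apply: smoderateD => //; exact: smoderateN.
split=> //; rewrite /ccls -(raddfB (\pi_(Ct R))%qT); congr (\pi_(Ct R))%qT.
apply: val_inj; rewrite raddfB /=.
by rewrite (insubd_mscal my) (insubd_mscal mz) (insubd_mscal myz).
Qed.

End ExpVal.

Section Quotient.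
Context {R : realType} {n : nat}.
Local Notation Rn := 'rV[R]_n.
Implicit Types (S : net_space R n) (u v : net R n).

Lemma insubd_mnet S u : ns_moderate S u -> val (insubd (0 : mnet S) u) = u.
Proof. by move=> mu; apply: insubdK; rewrite inE. Qed.

Lemma cls_eq S u v : ns_moderate S u -> ns_moderate S v -> ns_negligible S (u - v) ->
  cls S u = cls S v.
Proof.
move=> mu mv nuv; apply/GenP; rewrite raddfB /=.
by rewrite (insubd_mnet mu) (insubd_mnet mv).
Qed.

Lemma repr_represents S (U : Gen S) : represents (val (repr U)) U.
Proof. by split; [exact: moderateP|rewrite /cls valKd reprK]. Qed.

Lemma represents_negligible S u v (U : Gen S) : represents u U -> represents v U ->
  ns_negligible S (u - v).
Proof.
move=> [mu <-] [mv /esym E]; move/GenP: E; rewrite raddfB /=.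
by rewrite (insubd_mnet mu) (insubd_mnet mv).
Qed.

End Quotient.

(** * Uniform bounds on nets *)

Section NetBounds.
Context {R : realType} {n : nat}.
Local Notation Rn := 'rV[R]_n.
Local Notation I := (eps01 R).
Implicit Types (u v : net R n) (A : set Rn) (m k : nat) (b r : R) (s : seq 'I_n).

(** One constant and one threshold serve all derivatives up to order [m] and all points of [A],
    which is what a functional of order [m] requires. *)
Definition netO A m k u b : Prop := exists C eta : R, [/\ 0 < eta, 0 <= C &
  forall e : I, val e <= eta -> seminorm_le A m k (u e) (C * val e `^ b)].

Lemma eps_powR_le (e : I) (a b : R) : b <= a -> val e `^ a <= val e `^ b.
Proof. by move=> ba; apply: ger_powR => //; rewrite eps_gt0 eps_le1. Qed.

Lemma netO_mono A A' m m' k k' u b b' : A' `<=` A -> (m' <= m)%N -> (k' <= k)%N -> b' <= b ->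
  netO A m k u b -> netO A' m' k' u b'.
Proof.
move=> AA mm kk bb [C [eta [eta0 C0 H]]]; exists C, eta; split=> // e /H.
by apply: seminorm_le_mono => //; rewrite ler_wpM2l// eps_powR_le.
Qed.

Lemma netO_sup_upto A m u b : (forall e, smooth (u e)) ->
  Oeps (fun e => sup_upto A m (u e)) b <-> netO A m 0 u b.
Proof.
move=> su; split=> [/OepsW|] [C [eta [eta0]]].
  move=> C0 H; exists C, eta; split=> // e /H.
  by move/(sup_upto_le _ _ (su e) (mulr_ge0 C0 (powR_ge0 _ _))).
move=> C0 H; exists C, eta; split=> // e /H.
by move/(sup_upto_le _ _ (su e) (mulr_ge0 C0 (powR_ge0 _ _))).
Qed.

Lemma netO_schwartz k u b : (forall e, smooth (u e)) ->
  Oeps (fun e => schwartz_norm k (u e)) b <-> netO setT k k u b.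
Proof.
move=> su; split=> [/OepsW|] [C [eta [eta0]]].
  move=> C0 H; exists C, eta; split=> // e /H.
  exact: schwartz_norm_ge (su e) (mulr_ge0 C0 (powR_ge0 _ _)).
move=> C0 H; exists (n.+1%:R ^+ k * C), eta; split=> // e /H.
by move/(schwartz_norm_le (su e) (mulr_ge0 C0 (powR_ge0 _ _))); rewrite mulrA.
Qed.

(** The derivatives come with their own constants, thresholds and exponents. One number [M] replaces
    all of them, as constant [M], threshold 1 / (M + 1) and exponent [expo M]; [expo] is the
    opposite for moderate nets and constant for negligible ones. *)
Lemma netO_words (expo : R -> R) A m k u : (forall M M', M <= M' -> expo M' <= expo M) ->
  (forall s, (size s <= m)%N -> exists C eta N : R, [/\ 0 < eta, 0 <= C, 0 <= N &
    forall e : I, val e <= eta -> forall x, A x ->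
      (1 + `|x|) ^+ k * normc (cderiv s (u e) x) <= C * val e `^ (expo N)]) ->
  exists2 M : R, 0 <= M & netO A m k u (expo M).
Proof.
move=> He H.
have [|s sm|M M0 HM] := @words_uniform R n (fun s M => forall e : I, val e <= (M + 1)^-1 ->
   forall x, A x -> (1 + `|x|) ^+ k * normc (cderiv s (u e) x) <= M * val e `^ (expo M)) m.
- move=> s M M' M0 MM HM e eM x Ax.
  have M1 : 0 < M + 1 by rewrite ltr_wpDl.
  apply: (le_trans (HM e _ x Ax)).
    by apply: (le_trans eM); rewrite lef_pV2 ?posrE ?lerD2r// (lt_le_trans M1)// lerD2r.
  by apply: ler_pM => //; [exact: powR_ge0|apply: eps_powR_le; exact: He].
- have [C [eta [N [eta0 C0 N0 HC]]]] := H s sm.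
  have ie : 0 <= eta^-1 by rewrite invr_ge0 ltW.
  exists (N + C + eta^-1) => [|e eM x Ax]; first by rewrite !addr_ge0.
  have M1 : 0 < N + C + eta^-1 + 1 by rewrite ltr_wpDl// !addr_ge0.
  apply: (le_trans (HC e _ x Ax)).
    apply: (le_trans eM); rewrite -[leRHS]invrK lef_pV2 ?posrE ?invr_gt0//.
    by rewrite -addrA addrCA lerDl !addr_ge0.
  apply: ler_pM => //; first exact: powR_ge0.
    by rewrite addrAC lerDr addr_ge0.
  by apply: eps_powR_le; apply: He; rewrite -addrA lerDl addr_ge0.
exists M => //; exists M, (M + 1)^-1; split=> [||e eM s x sm Ax].
- by rewrite invr_gt0 ltr_wpDl.
- by [].
- exact: HM.
Qed.

Lemma sup_on_netO A a u b : (forall e, smooth (u e)) -> Oeps (fun e => sup_on A a (u e)) b ->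
  exists C eta : R, [/\ 0 < eta, 0 <= C &
    forall e : I, val e <= eta -> forall x, A x -> normc (partial a (u e) x) <= C * val e `^ b].
Proof.
move=> su /OepsW[C [eta [eta0 C0 H]]]; exists C, eta; split=> // e /H.
move=> /(wsup_le _ _ _ _ (mulr_ge0 C0 (powR_ge0 _ _))).1 H2 x Ax.
by have := H2 x a Ax erefl; rewrite mul1r.
Qed.

Lemma netO_sup_on A a u b : netO A (mlength a) 0 u b -> Oeps (fun e => sup_on A a (u e)) b.
Proof.
move=> [C [eta [eta0 C0 H]]]; exists C, eta; split=> // e /H Hs.
apply/wsup_le => [|x a' Ax ->]; first by rewrite mulr_ge0// powR_ge0.
rewrite mul1r partial_cderiv; have := Hs (word a) x.
by rewrite expr0 mul1r size_word; apply.
Qed.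

Lemma G_moderateP u : G_moderate u <->
  (forall e, smooth (u e)) /\ forall r m, exists N : nat, netO (cball r) m 0 u (- N%:R).
Proof.
split=> -[su H].
  split; [exact: su|move=> r m].
  have [|s sm|M M0 HM] := @netO_words (fun M => - M) (cball r) m 0 u.
  - by move=> M M'; rewrite lerN2.
  - have [N HN] := H (cball r) (word_index s) (cball_compact r).
    have [C [eta [eta0 C0 Hs]]] := sup_on_netO su HN.
    exists C, eta, N%:R; split=> // e ee x Ax.
    by rewrite expr0 mul1r cderiv_partial//; exact: Hs.
  exists (Num.truncn M).+1; apply: netO_mono HM => //.
  by rewrite lerN2 ltW// truncnS_gt.
split; [exact: su|move=> K a cK].
have [r r0 Kr] := compact_cball cK; have [N HN] := H r (mlength a).
by exists N; apply: netO_sup_on; apply: netO_mono HN.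
Qed.

Lemma G_negligibleP u : G_negligible u <->
  (forall e, smooth (u e)) /\ forall r m (q : nat), netO (cball r) m 0 u q%:R.
Proof.
split=> -[su H].
  split; [exact: su|move=> r m q].
  have [|s sm|M M0 HM] := @netO_words (fun=> q%:R) (cball r) m 0 u.
  - by [].
  - have [C [eta [eta0 C0 Hs]]] := sup_on_netO su (H (cball r) (word_index s) (cball_compact r) q).
    exists C, eta, 0; split=> // e ee x Ax.
    by rewrite expr0 mul1r cderiv_partial//; exact: Hs.
  exact: HM.
split; [exact: su|move=> K a cK q].
have [r r0 Kr] := compact_cball cK.
by apply: netO_sup_on; apply: netO_mono (H r (mlength a) q).
Qed.

Lemma GS_moderateP u : GS_moderate u <->
  (forall e, schwartz (u e)) /\ forall m k, exists N : nat, netO setT m k u (- N%:R).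
Proof.
have su' : (forall e, schwartz (u e)) -> forall e, smooth (u e) by move=> su e; case: (su e).
split=> -[su H].
  split; [exact: su|move=> m k].
  have [N /(netO_schwartz _ _ (su' su)) HN] := H (maxn m k); exists N.
  by apply: netO_mono HN => //; rewrite ?leq_maxl ?leq_maxr.
split; [exact: su|move=> k].
by have [N HN] := H k k; exists N; apply/(netO_schwartz _ _ (su' su)).
Qed.

Lemma GS_negligibleP u : GS_negligible u <->
  (forall e, schwartz (u e)) /\ forall m k (q : nat), netO setT m k u q%:R.
Proof.
have su' : (forall e, schwartz (u e)) -> forall e, smooth (u e) by move=> su e; case: (su e).
split=> -[su H].
  split; [exact: su|move=> m k q].
  have /(netO_schwartz _ _ (su' su)) := H (maxn m k) q.
  by apply: netO_mono => //; rewrite ?leq_maxl ?leq_maxr.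
split; [exact: su|move=> k q].
by apply/(netO_schwartz _ _ (su' su)).
Qed.

Lemma netO_combine A m k u v b (w : net R n) : netO A m k u b -> netO A m k v b ->
  (forall e s x, A x -> (size s <= m)%N -> normc (cderiv s (w e) x) <=
     normc (cderiv s (u e) x) + normc (cderiv s (v e) x)) -> netO A m k w b.
Proof.
move=> [C [eta [eta0 C0 H]]] [C' [eta' [eta0' C0' H']]] Hw.
exists (C + C'), (Num.min eta eta'); split=> [||e].
- by rewrite lt_min eta0.
- exact: addr_ge0.
rewrite le_min => /andP[/H Hu /H' Hv] s x sm Ax.
apply: (le_trans (ler_wpM2l (ltW (weightX_gt0 x k)) (Hw e s x Ax sm))).
by rewrite mulrDr mulrDl lerD ?Hu ?Hv.
Qed.

Lemma netOD A m k u v b : (forall e, smooth (u e)) -> (forall e, smooth (v e)) ->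
  netO A m k u b -> netO A m k v b -> netO A m k (u + v) b.
Proof.
move=> su sv Hu Hv; apply: netO_combine Hu Hv _ => e s x _ _.
rewrite (_ : (u + v) e = fun y => u e y + v e y)// (cderivD s (su e) (sv e)).
exact: le_normcD.
Qed.

Lemma netOB A m k u v b : (forall e, smooth (u e)) -> (forall e, smooth (v e)) ->
  netO A m k u b -> netO A m k v b -> netO A m k (u - v) b.
Proof.
move=> su sv Hu Hv; apply: netO_combine Hu Hv _ => e s x _ _.
rewrite (_ : (u - v) e = fun y => u e y - v e y)// (cderivB s (su e) (sv e)).
by apply: (le_trans (le_normcD _ _)); rewrite normcN.
Qed.

End NetBounds.

(** * Pairing a convolution with a function *)

Section Pairing.
Context {R : realType} {n : nat}.
Local Notation Rn := 'rV[R]_n.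
Local Notation fct := (Rn -> R[i]).
Implicit Types (f g u v rho phi : fct) (x y z d : Rn) (s t : seq 'I_n) (A K : set Rn)
  (V : set fct) (T : fct -> R[i]) (j k m : nat) (C M r l : R).

Lemma conv_bound V A j k C T u x s M : bounded_functional V A j k C T -> smooth u ->
  V (tr x (cderiv s u)) -> 0 <= M ->
  (forall t y, (size t <= j)%N -> A y ->
    (1 + `|y|) ^+ k * normc (cderiv (t ++ s) u (x - y)) <= M) ->
  normc (T (tr x (cderiv s u))) <= C * M.
Proof.
move=> bT su Vx M0 HM; apply: (bf_bound bT) => // t y tj Ay.
by rewrite (normc_cderiv_tr _ _ _ (smooth_cderiv s su)) cderiv_cat; exact: HM.
Qed.

Lemma conv_bound_schwartz j C T u m M : bounded_functional (@schwartz R n) setT j j C T ->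
  schwartz u -> 0 <= M -> seminorm_le setT (j + m) j u M ->
  forall s x, (size s <= m)%N -> normc (T (tr x (cderiv s u))) <= C * ((1 + `|x|) ^+ j * M).
Proof.
move=> bT Su M0 HM s x sm; have su : smooth u by case: Su.
apply: (conv_bound bT su).
- by apply: schwartz_tr; exact: schwartz_cderiv.
- by rewrite mulr_ge0// ltW// weightX_gt0.
move=> t y tj _; apply: (le_trans (ler_wpM2r (normc_ge0 _) (weight_sub x y j))).
rewrite -mulrA ler_wpM2l ?(ltW (weightX_gt0 _ _))//; apply: HM => //.
by rewrite size_cat leq_add.
Qed.

Lemma conv_bound_cball V r j C T u r' m M : bounded_functional V (cball r) j 0 C T ->
  smooth u -> 0 <= M -> seminorm_le (cball (r' + r)) (j + m) 0 u M ->
  forall s x, (size s <= m)%N -> `|x| <= r' -> V (tr x (cderiv s u)) ->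
  normc (T (tr x (cderiv s u))) <= C * M.
Proof.
move=> bT su M0 HM s x sm xr Vx; apply: (conv_bound bT) => // t y tj yr.
rewrite expr0 mul1r; have := HM (t ++ s) (x - y); rewrite expr0 mul1r; apply.
  by rewrite size_cat leq_add.
by apply: (le_trans (ler_normB _ _)); rewrite lerD.
Qed.

Definition dilate l rho : fct := fun x => (l ^- n)%:C * rho (l^-1 *: x).

Lemma dilate_support l rho r : 0 < l <= 1 -> 0 <= r -> (forall x, r < `|x| -> rho x = 0) ->
  forall x, r < `|x| -> dilate l rho x = 0.
Proof.
move=> /andP[l0 l1] r0 rr x rx; rewrite /dilate rr ?mulr0//.
rewrite normrZ normfV (gtr0_norm l0) ltr_pdivlMl//; apply: le_lt_trans rx.
by rewrite ler_piMl.
Qed.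

Lemma smooth_dilate l rho : smooth rho -> smooth (dilate l rho).
Proof.
move=> sr; have -> : dilate l rho = fun x => (l ^- n)%:C * rho (0 + l^-1 *: x).
  by apply/funext => x; rewrite add0r.
exact: smoothZ (smooth_affine _ _ sr).
Qed.

Lemma cderiv_dilate l rho s : smooth rho ->
  cderiv s (dilate l rho) = fun x => (l ^- n)%:C * ((l^-1 ^+ size s)%:C * cderiv s rho (l^-1 *: x)).
Proof.
move=> sr; have -> : dilate l rho = fun x => (l ^- n)%:C * rho (0 + l^-1 *: x).
  by apply/funext => x; rewrite add0r.
rewrite (cderivZ s _ (smooth_affine _ _ sr)) cderiv_affine//.
by apply/funext => x; rewrite add0r.
Qed.

Lemma bf_scale V A j k C T (c : R[i]) f : bounded_functional V A j k C T -> V f ->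
  V (fun y => c * f y) /\ T (fun y => c * f y) = c * T f.
Proof.
move=> bT Vf; have [V0 T0] := bf_zero bT Vf.
have E : (fun y => c * f y) = (fun y => c * f y + (fun=> 0) y).
  by apply/funext => y; rewrite addr0.
rewrite E; split; first exact: (bf_closed bT).
by rewrite (bf_linear bT)// T0 addr0.
Qed.

(* The integral against [v] moves inside [T], where it becomes the smoothing
   [blur] of [v]. *)
Lemma conv_pairing V A j k C T rho l v M : bounded_functional V A j k C T ->
  test_function rho -> 0 < l -> smooth v -> V (blur rho l v) ->
  (forall x, v x != 0 -> V (tr x (dilate l rho))) -> 0 <= M ->
  (forall s y, (size s <= j)%N -> A y ->
    cwlip M (fun x => ((1 + `|y|) ^+ k)%:C * (v x * cderiv s (tr x (dilate l rho)) y))) ->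
  cintegral (fun x => T (tr x (dilate l rho)) * v x) = T (blur rho l v) /\
  cwlip (C * M) (fun x => T (tr x (dilate l rho)) * v x).
Proof.
move=> bT tr_ l0 sv Vb Vt M0 HM; have sr : smooth rho by case: tr_.
have sd := smooth_dilate l sr.
pose f x y := v x * tr x (dilate l rho) y.
pose phi w := dilate l rho (0 + (-1) *: w).
have sp : smooth phi by exact: smooth_affine.
have phiE x y : phi (y - x) = tr x (dilate l rho) y.
  by rewrite /phi add0r scaleN1r opprB.
have tp : test_function phi.
  have /test_functionP[_ [r r0 rr]] := tr_.
  apply/test_functionP; split=> //; exists (l * r) => [|w lw]; first by rewrite mulr_ge0// ltW.
  rewrite /phi /dilate rr ?mulr0// add0r scaleN1r scalerN normrN normrZ normfV (gtr0_norm l0).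
  by rewrite ltr_pdivlMl.
(* Where [v] vanishes the translate need not lie in [V], but there [f x] is the zero function. *)
have [Vf Tf] : (forall x, V (f x)) /\ forall x, T (f x) = T (tr x (dilate l rho)) * v x.
  have H x : V (f x) /\ T (f x) = T (tr x (dilate l rho)) * v x.
    rewrite /f; have [->|vx] := eqVneq (v x) 0; last first.
      by have [H1 H2] := bf_scale (v x) bT (Vt x vx); rewrite mulrC -H2.
    have [V0 T0] := bf_zero bT Vb; rewrite mulr0.
    have -> : (fun y => 0 * tr x (dilate l rho) y) = fun=> 0.
      by apply/funext => y; rewrite mul0r.
    by split; [exact: V0|exact: T0].
  by split=> x; have [] := H x.
have df x s : cderiv s (f x) = fun y => v x * cderiv s (tr x (dilate l rho)) y.
  exact: (cderivZ s (v x) (smooth_tr x sd)).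
have blurE : blur rho l v = smear phi v.
  apply/funext => y; rewrite (blur_smear y tr_ sv l0) /smear; congr cintegral.
  apply/funext => x; congr (_ * _); rewrite /phi /dilate add0r.
  by rewrite scaleN1r.
have dphi x s y : cderiv s phi (y - x) = cderiv s (tr x (dilate l rho)) y.
  have := cderiv_affine s (- x) 1 sp; rewrite expr1n => H.
  have -> : tr x (dilate l rho) = fun y => phi (- x + 1 *: y).
    by apply/funext => w; rewrite -phiE scale1r addrC.
  by rewrite H scale1r mul1r addrC.
have Hf s y : (size s <= j)%N -> A y ->
    cwlip M (fun x => ((1 + `|y|) ^+ k)%:C * cderiv s (f x) y).
  by move=> sj Ay; apply: cwlip_ext (HM s y sj Ay) => x; rewrite df.
have Hg s y : cderiv s (blur rho l v) y = cintegral (fun x => cderiv s (f x) y).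
  rewrite blurE (smear_smooth tp (smooth_loc_lipschitz sv)).2 /smear.
  by congr cintegral; apply/funext => x; rewrite dphi df.
have [E cw] := functional_cintegral bT Vf Vb M0 Hf (fun s y _ _ => Hg s y).
split; last by apply: cwlip_ext cw => x; rewrite Tf.
by rewrite E; congr cintegral; apply/funext => x; rewrite Tf.
Qed.

Lemma bounded_lip_mono r r' B (h : fct) : r <= r' -> bounded_lip r B h -> bounded_lip r' B h.
Proof. by move=> rr [B0 hr hB hL]; split=> // x rx; apply: hr; exact: le_lt_trans rx. Qed.

Lemma cderiv_tr_reflect u x s y : smooth u ->
  cderiv s (tr x u) y = cderiv s (fun w => u (0 + (-1) *: w)) (y - x).
Proof.
move=> su; have := cderiv_affine s (- x) 1 (smooth_affine 0 (-1) su); rewrite expr1n => H.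
have -> : tr x u = fun y => u (0 + (-1) *: (- x + 1 *: y)).
  by apply/funext => w; rewrite /tr scale1r add0r scaleN1r opprD opprK.
by rewrite H scale1r mul1r addrC.
Qed.

(** The hypothesis of [conv_pairing] for a functional that sees only a ball: for [y] in this ball
    the kernel, as a function of [x], is supported in a fixed ball. [M] may depend on [l], as it
    serves only to justify an identity. *)
Lemma pairing_hyp_cball rho l v : test_function rho -> 0 < l <= 1 -> smooth v ->
  forall r j, exists2 M : R, 0 <= M & forall s y, (size s <= j)%N -> cball r y ->
    cwlip M (fun x => ((1 + `|y|) ^+ 0)%:C * (v x * cderiv s (tr x (dilate l rho)) y)).
Proof.
move=> /test_functionP[sr [r0 r00 rr]] l01 sv r j.
have sd := smooth_dilate l sr; have dr := dilate_support l01 r00 rr.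
have sp : smooth (fun w => dilate l rho (0 + (-1) *: w)) by exact: smooth_affine.
have pr w : r0 < `|w| -> dilate l rho (0 + (-1) *: w) = 0.
  by move=> rw; apply: dr; rewrite add0r scaleN1r normrN.
have [B B0 HB] := test_bounded_lip sp pr j.
have [C C0 HC] := bounded_lip_prod (r0 + r) (smooth_loc_lipschitz sv).
exists (C * B) => [|s y sj yr]; first exact: mulr_ge0.
have := bounded_lip_reflect y (HB s sj).
move=> /(bounded_lip_mono (_ : _ <= r0 + r)) H.
have {}H := H (lerD (lexx _) yr).
apply: cwlip_ext (HC _ _ H) => x; rewrite expr0 mul1r.
by rewrite cderiv_tr_reflect.
Qed.

Definition weight_lip (W : Rn -> R) M f : Prop := [/\ 0 <= M,
  forall x, normc (f x) <= M * W x &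
  forall x x', `|x - x'| <= 1 -> normc (f x - f x') <= M * `|x - x'| * W x].

(** The weight at [x] must also serve for [f x'], which is bounded through its increment from [f x]
    at the cost of a factor 2; hence 3 in total. *)
Lemma weight_lip_prod (W W' : Rn -> R) M M' f g : (forall x, 0 <= W x) ->
  (forall x, W x * W' x <= kappa x) -> weight_lip W M f -> weight_lip W' M' g ->
  cwlip (3 * (M * M')) (fun x => f x * g x).
Proof.
move=> W0 WW [M0 f0 f1] [M0' g0 g1]; have MM : 0 <= M * M' by rewrite mulr_ge0.
split=> [x|x x' xx].
  rewrite normcM; apply: (le_trans (ler_pM (normc_ge0 _) (normc_ge0 _) (f0 x) (g0 x))).
  have -> : M * W x * (M' * W' x) = M * M' * (W x * W' x) by ring.
  apply: (le_trans (ler_wpM2l MM (WW x))); rewrite ler_wpM2r ?kappa_ge0//.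
  by rewrite ler_peMl// ler1n.
have fx' : normc (f x') <= 2 * M * W x.
  have -> : f x' = f x - (f x - f x') by rewrite subKr.
  apply: (le_trans (le_normcD _ _)); rewrite normcN.
  have -> : 2 * M * W x = M * W x + M * 1 * W x by ring.
  apply: lerD => //; apply: (le_trans (f1 x x' xx)).
  by rewrite ler_wpM2r// ler_wpM2l.
have -> : f x * g x - f x' * g x' = (f x - f x') * g x + f x' * (g x - g x').
  by rewrite mulrBl mulrBr addrA subrK.
apply: (le_trans (le_normcD _ _)); rewrite !normcM.
have := lerD (ler_pM (normc_ge0 _) (normc_ge0 _) (f1 x x' xx) (g0 x))
  (ler_pM (normc_ge0 _) (normc_ge0 _) fx' (g1 x x' xx)).
move=> /le_trans; apply.
have -> : M * `|x - x'| * W x * (M' * W' x) + 2 * M * W x * (M' * `|x - x'| * W' x) =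
  3 * (M * M') * `|x - x'| * (W x * W' x) by ring.
by apply: ler_wpM2l (WW x); rewrite !mulr_ge0.
Qed.

Lemma weight_near x z k : `|z - x| <= 1 -> (1 + `|x|) ^+ k <= 2 ^+ k * (1 + `|z|) ^+ k.
Proof.
move=> zx; apply: (le_trans (weight_sub z x k)); rewrite mulrC.
rewrite ler_wpM2r ?(ltW (weightX_gt0 _ _))// lerXn2r ?nnegrE ?addr_ge0//.
by rewrite lerD2l.
Qed.

Lemma smooth_weight_lip (W : Rn -> R) M f : smooth f -> 0 <= M -> (forall x, 0 <= W x) ->
  (forall x, normc (f x) <= M * W x) ->
  (forall i x z, `|z - x| <= 1 -> normc (cderiv [:: i] f z) <= M * W x) ->
  weight_lip W (M + 2 * (n%:R * M)) f.
Proof.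
move=> sf M0 W0 f0 f1; have nM0 : 0 <= 2 * (n%:R * M) by rewrite !mulr_ge0.
split=> [|x|x x' xx]; first exact: addr_ge0.
  by apply: (le_trans (f0 x)); rewrite ler_wpM2r// lerDl.
have MW : 0 <= M * W x by rewrite mulr_ge0.
have := @smooth_incr R n f x (x' - x) (M * W x) sf MW; rewrite [x + _]addrC subrK distrC => H.
rewrite -opprB normcN; apply: (@le_trans _ _ (2 * (n%:R * (M * W x) * `|x - x'|))).
  by apply: H => i z zx; apply: f1; exact: le_trans zx xx.
have -> : 2 * (n%:R * (M * W x) * `|x - x'|) = 2 * (n%:R * M) * `|x - x'| * W x by ring.
by rewrite ler_wpM2r// ler_wpM2r// lerDr.
Qed.

Lemma schwartz_weight_lip f k : schwartz f ->
  exists M, weight_lip (fun x => (1 + `|x|) ^- k) M f.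
Proof.
move=> /schwartzP[sf H]; have [M M0 HM] := H 1%N k.
have W0 x : 0 <= (1 + `|x|) ^- k by rewrite invr_ge0 ltW// weightX_gt0.
have B s x z : (size s <= 1)%N -> `|z - x| <= 1 -> normc (cderiv s f z) <= 2 ^+ k * M * (1 + `|x|) ^- k.
  move=> s1 zx; rewrite ler_pdivlMr ?weightX_gt0// mulrC.
  apply: (le_trans (ler_wpM2r (normc_ge0 _) (weight_near k zx))).
  by rewrite -mulrA ler_wpM2l ?exprn_ge0//; exact: HM.
eexists; apply: (@smooth_weight_lip _ (2 ^+ k * M)) => //.
- by rewrite mulr_ge0// exprn_ge0.
- by move=> x; have := B [::] x x isT; rewrite subrr normr0 cderiv0; apply.
- by move=> i x z; exact: B.
Qed.

Lemma slow_weight_lip f : slowly_increasing f ->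
  exists N M, weight_lip (fun x => (1 + `|x|) ^+ N) M f.
Proof.
move=> [sf H].
have H' s : exists N, exists2 M : R, 0 <= M & forall x, normc (cderiv s f x) <= M * (1 + `|x|) ^+ N.
  have [N /wsup_fin[M M0 /(wsup_le _ _ _ _ M0) HM]] := H (word_index s).
  exists N, (n.+1%:R ^+ N * M) => [|x]; first by rewrite mulr_ge0// exprn_ge0.
  have := HM x (word_index s) I erefl; rewrite -cderiv_partial// mulrC.
  rewrite ler_pdivrMr ?exprn_gt0 ?ltr_wpDr ?enorm_ge0// => /le_trans; apply.
  by rewrite [_ * M]mulrC -mulrA ler_wpM2l// weight_enorm.
(* The integer part of [M] serves as growth exponent, so that a single number has to be made uniform
   over the words. *)
have [||M M0 HM] := @words_uniform R n
    (fun s M => forall x, normc (cderiv s f x) <= M * (1 + `|x|) ^+ Num.truncn M) 1.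
- move=> s M M' M0 MM HM x; apply: (le_trans (HM x)).
  apply: ler_pM => //.
  apply: ler_weXn2l; first by rewrite lerDl.
  rewrite truncn_ge_nat; last exact: le_trans MM.
  by apply: le_trans MM; rewrite truncn_le.
- move=> s _; have [N [M M0 HM]] := H' s; exists (M + N%:R) => [|x]; first exact: addr_ge0.
  apply: (le_trans (HM x)); apply: ler_pM => //.
    by rewrite lerDl.
  apply: ler_weXn2l; first by rewrite lerDl.
  by rewrite truncn_ge_nat ?addr_ge0// lerDr.
set N := Num.truncn M in HM *; exists N.
have W0 x : 0 <= (1 + `|x|) ^+ N by rewrite ltW// weightX_gt0.
have B s x z : (size s <= 1)%N -> `|z - x| <= 1 -> normc (cderiv s f z) <= 2 ^+ N * M * (1 + `|x|) ^+ N.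
  move=> s1 zx; apply: (le_trans (HM s s1 z)).
  rewrite -mulrA mulrCA ler_wpM2l//; apply: weight_near.
  by rewrite distrC.
eexists; apply: (@smooth_weight_lip _ (2 ^+ N * M)) => //.
- by rewrite mulr_ge0// exprn_ge0.
- by move=> x; have := B [::] x x isT; rewrite subrr normr0 cderiv0; apply.
- by move=> i x z; exact: B.
Qed.

Lemma weight_kappa N x : (1 + `|x|) ^+ N * (1 + `|x|) ^- (N + 2 * n) <= kappa x.
Proof.
rewrite exprD invfM mulrA divff ?gt_eqF ?weightX_gt0// mul1r.
exact: kappa_weight.
Qed.

(** The kernel vanishes unless [y] is within [r] of [x], so Peetre's inequality trades the weight in
    [y] for one in [x]; the decay of [v] of order [j + 2 * n] absorbs it and leaves [kappa]. *)
Lemma pairing_hyp_schwartz rho l v : test_function rho -> 0 < l <= 1 -> schwartz v ->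
  forall j, exists2 M : R, 0 <= M & forall s y, (size s <= j)%N -> setT y ->
    cwlip M (fun x => ((1 + `|y|) ^+ j)%:C * (v x * cderiv s (tr x (dilate l rho)) y)).
Proof.
move=> /test_functionP[sr [r r0 rr]] l01 Sv j.
have sd := smooth_dilate l sr; have dr := dilate_support l01 r0 rr.
have sp : smooth (fun w => dilate l rho (0 + (-1) *: w)) by exact: smooth_affine.
have pr w : r < `|w| -> dilate l rho (0 + (-1) *: w) = 0.
  by move=> rw; apply: dr; rewrite add0r scaleN1r normrN.
have [B B0 HB] := test_bounded_lip sp pr j.
have [Q HQ] := schwartz_weight_lip (j + 2 * n) Sv; have [Q0 _ _] := HQ.
pose P : R := (2 + r) ^+ j * B.
have P0 : 0 <= P by rewrite mulr_ge0// exprn_ge0// addr_ge0.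
exists (3 * (P * Q)) => [|s y sj _].
  by apply: mulr_ge0 => //; apply: mulr_ge0.
have [_ hr hB hL] := HB s sj; set h := cderiv s _ in hr hB hL.
have near x : `|y - x| <= r + 1 -> (1 + `|y|) ^+ j <= (1 + `|x|) ^+ j * (2 + r) ^+ j.
  move=> yx; apply: (le_trans (weight_sub x y j)).
  rewrite ler_wpM2l ?(ltW (weightX_gt0 _ _))// lerXn2r ?nnegrE ?addr_ge0//.
  by rewrite distrC -[2]/(1 + 1) -addrA lerD2l addrC.
have W0 x : 0 <= (1 + `|x|) ^+ j by rewrite ltW// weightX_gt0.
have H : weight_lip (fun x => (1 + `|x|) ^+ j) P (fun x => ((1 + `|y|) ^+ j)%:C * h (y - x)).
  split=> [//|x|x x' xx].
    rewrite normcM normc_real ger0_norm ?(ltW (weightX_gt0 _ _))//.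
    have [yx|yx] := leP `|y - x| r; last first.
      by rewrite hr// normc0 mulr0 mulr_ge0.
    have -> : P * (1 + `|x|) ^+ j = (1 + `|x|) ^+ j * (2 + r) ^+ j * B by rewrite /P; ring.
    apply: ler_pM => //; first exact: normc_ge0.
    by apply: near; rewrite (le_trans yx)// lerDl.
  rewrite -mulrBr normcM normc_real ger0_norm ?(ltW (weightX_gt0 _ _))//.
  have E : (y - x) - (y - x') = x' - x by rewrite opprB addrC addrA subrK.
  have [yx|yx] := leP `|y - x| (r + 1); last first.
    have yx' : r < `|y - x'|.
      rewrite -(ltrD2r 1); apply: (lt_le_trans yx).
      rewrite -[y - x](subrK (y - x')) E (le_trans (ler_normD _ _))// addrC lerD2l.
      by rewrite distrC.
    have yx2 : r < `|y - x| by apply: le_lt_trans yx; rewrite lerDl.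
    rewrite (hr _ yx') (hr _ yx2) subrr normc0 mulr0.
    by apply: mulr_ge0 => //; apply: mulr_ge0.
  have -> : P * `|x - x'| * (1 + `|x|) ^+ j = (1 + `|x|) ^+ j * (2 + r) ^+ j * (B * `|x - x'|).
    by rewrite /P; ring.
  apply: ler_pM => //; [exact: normc_ge0|exact: near|].
  by have := hL (y - x) (y - x'); rewrite E distrC; apply.
apply: cwlip_ext (weight_lip_prod W0 (weight_kappa j) H HQ) => x.
by rewrite cderiv_tr_reflect// mulrAC -mulrA.
Qed.

End Pairing.

(** * Convolution of nets *)

Section NetConvolution.
Context {R : realType} {n : nat}.
Local Notation Rn := 'rV[R]_n.
Local Notation fct := (Rn -> R[i]).
Local Notation I := (eps01 R).
Implicit Types (u v w a : net R n) (Te : I -> fct -> R[i]) (rho f : fct) (x y : Rn) (s t : seq 'I_n)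
  (A K : set Rn) (V : set fct) (j k m N q : nat) (b C M r eta : R).

Lemma lee_mul_le (c C : R) (S : \bar R) M : 0 <= C -> (c%:E <= C%:E * S)%E ->
  (S <= M%:E)%E -> c <= C * M.
Proof.
move=> C0 H SM; rewrite -lee_fin; apply: (le_trans H).
by rewrite EFinM; apply: lee_wpmul2l => //; rewrite lee_fin.
Qed.

Lemma test_function_in_closed r (c : R[i]) f g : test_function_in (cball r) f ->
  test_function_in (cball r) g -> test_function_in (cball r) (fun x => c * f x + g x).
Proof.
move=> [sf /fsupport_cball fr] [sg /fsupport_cball gr]; split; first exact: smooth_lin.
by apply/fsupport_cball => x rx; rewrite fr// gr// mulr0 addr0.
Qed.

Lemma test_function_in_test r f : test_function_in (cball r) f -> test_function f.
Proof.
move=> [sf /fsupport_cball fr]; apply/test_functionP; split=> //.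
exists (Num.max r 0) => [|x]; first by rewrite le_max lexx orbT.
by rewrite gt_max => /andP[rx _]; exact: fr.
Qed.

Lemma basic_G_bounded Te : basic_net_G Te -> exists r j N eta, [/\ 0 <= r, 0 < eta &
  forall e : I, val e <= eta ->
    bounded_functional (@smooth R n) (cball r) j 0 (val e `^ (- N%:R)) (Te e)].
Proof.
move=> [dT [K [cK [j [N [eta [/andP[eta0 _] H]]]]]]].
have [r r0 Kr] := compact_cball cK.
exists r, j, N, eta; split; [exact: r0|exact: eta0|move=> e ee]; split.
- by [].
- by move=> c f g; exact: smooth_lin.
- exact: (dT e).1.
- exact: powR_ge0.
move=> f M sf M0 Hf; apply: (lee_mul_le (powR_ge0 _ _) (H f sf e ee)).
by apply/(sup_upto_le K j sf M0); apply: seminorm_le_mono Hf.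
Qed.

Lemma basic_Gc_bounded Te r : basic_net_Gc Te -> exists j N eta, 0 < eta /\
  forall e : I, val e <= eta ->
    bounded_functional (test_function_in (cball r)) (cball r) j 0 (val e `^ (- N%:R)) (Te e).
Proof.
move=> [dT HT]; have [j [N [eta [/andP[eta0 _] H]]]] := HT _ (cball_compact r).
exists j, N, eta; split=> // e ee; split.
- by move=> f [].
- exact: test_function_in_closed.
- by move=> c f g /test_function_in_test tf /test_function_in_test tg; exact: (dT e).1.
- exact: powR_ge0.
move=> f M Vf M0 Hf; apply: (lee_mul_le (powR_ge0 _ _) (H f Vf e ee)).
by have [sf _] := Vf; apply/(sup_upto_le _ j sf M0).
Qed.

Lemma basic_GS_bounded Te : basic_net_GS Te -> exists j N eta, 0 < eta /\
  forall e : I, val e <= eta ->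
    bounded_functional (@schwartz R n) setT j j (n.+1%:R ^+ j * val e `^ (- N%:R)) (Te e).
Proof.
move=> [dT [j [N [eta [/andP[eta0 _] H]]]]].
exists j, N, eta; split=> // e ee; split.
- by move=> f [].
- by move=> c f g Sf Sg; exact: schwartzD (schwartzZ c Sf) Sg.
- exact: (dT e).1.
- by rewrite mulr_ge0 ?exprn_ge0// powR_ge0.
move=> f M Sf M0 Hf; have [sf _] := Sf.
rewrite [n.+1%:R ^+ j * _]mulrC -mulrA.
by apply: (lee_mul_le (powR_ge0 _ _) (H f Sf e ee)); exact: schwartz_norm_le.
Qed.

Lemma conv_net_smooth u Te : (forall e, smooth (u e)) ->
  (forall e, convolvable (Te e) (u e)) ->
  (forall e, smooth (conv_net u Te e)) /\
  forall e s, cderiv s (conv_net u Te e) = fun x => Te e (tr x (cderiv s (u e))).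
Proof.
by move=> su cu; split=> e; have [] := conv_smooth (su e) (cu e).
Qed.

Lemma powR_mulD (e : I) (C b c : R) : C * val e `^ (b + c) = val e `^ c * (C * val e `^ b).
Proof.
rewrite powRD; last by rewrite (lt0r_neq0 (eps_gt0 e)) implybT.
by ring.
Qed.

Lemma netO_conv_cball V r0 j N eta u Te r m b : 0 < eta ->
  (forall e, smooth (u e)) -> (forall e, convolvable (Te e) (u e)) ->
  (forall e : I, val e <= eta ->
    bounded_functional V (cball r0) j 0 (val e `^ (- N%:R)) (Te e)) ->
  (forall e s x, `|x| <= r -> V (tr x (cderiv s (u e)))) ->
  netO (cball (r + r0)) (j + m) 0 u b -> netO (cball r) m 0 (conv_net u Te) (b - N%:R).
Proof.
move=> eta0 su cu bT HV [C [eta' [eta0' C0 H]]].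
have [_ dc] := conv_net_smooth su cu.
exists C, (Num.min eta eta'); split=> [||e]; [by rewrite lt_min eta0|by []|].
rewrite le_min => /andP[ee ee'] s x sm xr.
rewrite expr0 mul1r dc powR_mulD.
apply: (conv_bound_cball (bT e ee) (su e) _ (H e ee') sm xr); last exact: HV.
by rewrite mulr_ge0// powR_ge0.
Qed.

Lemma eps_exp01 (e : I) q : 0 < val e ^+ q <= 1.
Proof. by rewrite exprn_gt0 ?eps_gt0//= exprn_ile1 ?eps_le1// ltW// eps_gt0. Qed.

Lemma mollifier_dilate rho q e : mollifier rho q e = dilate (val e ^+ q) rho.
Proof. by []. Qed.

Lemma mollifier_support rho q r : 0 <= r -> (forall x, r < `|x| -> rho x = 0) ->
  forall e x, r < `|x| -> mollifier rho q e x = 0.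
Proof. by move=> r0 rr e; exact: dilate_support (eps_exp01 e q) r0 rr. Qed.

Lemma mollifier_test rho q e : test_function rho -> test_function (mollifier rho q e).
Proof.
move=> /test_functionP[sr [r r0 rr]]; apply/test_functionP; split.
  exact: smooth_dilate.
by exists r => // x; exact: mollifier_support.
Qed.

Lemma mollifier_netO rho q m k : test_function rho ->
  exists N, netO setT m k (mollifier rho q) (- N%:R).
Proof.
move=> tr_; have /test_functionP[sr [r r0 rr]] := tr_.
have [B B0 HB] := test_bounded_lip sr rr m.
(* The normalization of the mollifier contributes e^(- q n), each derivative at most e^(- q). *)
exists (q * (n + m))%N, ((1 + r) ^+ k * B), 1; split=> // [|e _ s x sm _].
  by rewrite mulr_ge0// exprn_ge0// addr_ge0.
have st := mollifier_test q e tr_.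
have [xr|rx] := leP `|x| r; last first.
  rewrite (cderiv_support s (mollifier_support q r0 rr e) rx) normc0 mulr0.
  by rewrite !mulr_ge0 ?powR_ge0// exprn_ge0// addr_ge0.
rewrite -mulrA; apply: ler_pM; rewrite ?normc_ge0 ?exprn_ge0 ?addr_ge0//.
  by rewrite lerXn2r ?nnegrE ?addr_ge0// lerD2l.
rewrite mollifier_dilate cderiv_dilate//; have /andP[l0 l1] := eps_exp01 e q.
have -> : val e `^ (- (q * (n + m))%:R) = (val e ^+ q)^-1 ^+ n * (val e ^+ q)^-1 ^+ m.
  by rewrite -exprD !exprVn -exprM powRN powR_mulrn//; exact/ltW/eps_gt0.
move: (val e ^+ q) l0 l1 => l l0 l1.
have li : 1 <= l^-1 by rewrite invf_ge1.
have l1m k' : 0 <= l^-1 ^+ k' by rewrite exprn_ge0// invr_ge0 ltW.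
have El k' : l ^- k' = l^-1 ^+ k' by rewrite exprVn.
have [_ _ hB _] := HB s sm.
rewrite !normcM !normc_real !El !ger0_norm ?l1m//.
rewrite mulrA mulrC; apply: ler_pM; [exact: normc_ge0|by rewrite mulr_ge0|exact: hB|].
by rewrite ler_wpM2l// ler_weXn2l.
Qed.

Lemma pairing_compact u v r b c : (forall e, smooth (u e)) -> (forall e, smooth (v e)) ->
  (exists2 eta, 0 < eta & forall e : I, val e <= eta -> forall x, r < `|x| -> v e x = 0) ->
  netO (cball r) 0 0 u b -> netO (cball r) 0 0 v c ->
  Oeps (snorm (integral_net u v)) (b + c).
Proof.
move=> su sv [eta eta0 vr] [B [eB [eB0 B0 HB]]] [D [eD [eD0 D0 HD]]].
have [C C0 HC] := @cintegral_support R n r.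
exists (C * (B * D)), (Num.min eta (Num.min eB eD)); split.
  by rewrite !lt_min eta0 eB0.
move=> e; rewrite !le_min => /and3P[ee /HB He /HD He'].
rewrite /snorm lee_fin powRD; last by rewrite (lt0r_neq0 (eps_gt0 e)) implybT.
have -> : C * (B * D) * (val e `^ b * val e `^ c) = C * ((B * val e `^ b) * (D * val e `^ c)) by ring.
have [P P0 HP] := test_bounded_lip (sv e) (vr e ee) 0; have := HP [::] (leqnn _); rewrite cderiv0 => Bv.
have [Q _ HQ] := bounded_lip_prod r (smooth_loc_lipschitz (su e)).
apply: (HC _ _ _ (HQ _ _ Bv)) => [|x rx|x xr].
- by rewrite !mulr_ge0 ?powR_ge0.
- by rewrite (vr e ee)// mulr0.
have := He [::] x (leqnn _) xr; have := He' [::] x (leqnn _) xr.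
rewrite expr0 !mul1r !cderiv0 normcM => H1 H2.
by apply: ler_pM => //; exact: normc_ge0.
Qed.


End NetConvolution.

(** * Smoothing of nets *)

Section NetEstimates.
Context {R : realType} {n : nat}.
Local Notation Rn := 'rV[R]_n.
Local Notation fct := (Rn -> R[i]).
Local Notation I := (eps01 R).
Implicit Types (u v w : net R n) (Te : I -> fct -> R[i]) (rho f : fct) (x y z : Rn) (s t : seq 'I_n)
  (A K : set Rn) (V : set fct) (j k m N q : nat) (b C M l r eta : R).

Definition blur_net rho q v : net R n := fun e => blur rho (val e ^+ q) (v e).

Lemma blur_net_smooth rho q v : test_function rho -> (forall e, smooth (v e)) ->
  forall e, smooth (blur_net rho q v e).
Proof. by move=> tr_ sv e; exact: (blur_smooth _ tr_ (sv e)).1. Qed.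

(** The first-order expansion loses one derivative. The factor [(1 + r) ^+ k] is Peetre's inequality
    between [y] and the points within [r] of it, where the derivatives of [f] are bounded. *)
Lemma blur_seminorm rho : test_function rho -> cintegral rho = 1 ->
  exists r C, [/\ 0 <= r, 0 <= C & forall f l A A' m k M, smooth f -> 0 <= l <= 1 -> 0 <= M ->
    (forall y z, A y -> `|z - y| <= r -> A' z) -> seminorm_le A' m.+1 k f M ->
    seminorm_le A m k (fun y => blur rho l f y - f y) (C * (1 + r) ^+ k * (l * M))].
Proof.
move=> tr_ rho1; have [r [C [r0 C0 HC]]] := blur_error tr_ rho1.
exists r, C; split=> // f l A A' m k M sf l01 M0 AA Hf s y sm Ay.
have r1 : 0 <= 1 + r by rewrite addr_ge0.
have W0 : 0 <= (1 + r) ^+ k by rewrite exprn_ge0.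
have wy := weightX_gt0 y k.
pose B : R := M * (1 + r) ^+ k / (1 + `|y|) ^+ k.
have B0 : 0 <= B by apply: divr_ge0; [exact: mulr_ge0|exact: ltW].
have H : normc (cderiv s (fun y => blur rho l f y - f y) y) <= C * (l * B).
  apply: (HC f _ sf l01 s y B B0) => i z zy.
  rewrite /B ler_pdivlMr// mulrC.
  have Hz := Hf (i :: s) z sm (AA y z Ay zy).
  apply: (@le_trans _ _ (((1 + `|z|) ^+ k * (1 + r) ^+ k) * normc (cderiv (i :: s) f z))).
    apply: (ler_wpM2r (normc_ge0 _)); apply: (le_trans (weight_sub z y k)).
    rewrite ler_wpM2l ?(ltW (weightX_gt0 _ _))// lerXn2r ?nnegrE ?addr_ge0//.
    by rewrite lerD2l.
  by rewrite mulrAC; apply: ler_wpM2r.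
apply: (le_trans (ler_wpM2l (ltW wy) H)).
rewrite /B le_eqVlt; apply/orP; left; apply/eqP; field.
by rewrite gt_eqF// weight_gt0.
Qed.

(** With l = e^q the factor [l] becomes the gain [q] in the exponent, whereas the radius [r] and the
    order required of [v] do not depend on [q], because l <= 1. *)
Lemma blur_net_error rho : test_function rho -> cintegral rho = 1 ->
  exists2 r, 0 <= r & forall A A' m k q v b, (forall e, smooth (v e)) ->
    (forall y z, A y -> `|z - y| <= r -> A' z) ->
    netO A' m.+1 k v b -> netO A m k (blur_net rho q v - v) (b + q%:R).
Proof.
move=> tr_ rho1; have [r [C [r0 C0 HC]]] := blur_seminorm tr_ rho1.
exists r => // A A' m k q v b sv AA [D [eta [eta0 D0 HD]]].
exists (C * (1 + r) ^+ k * D), eta; split=> [||e ee]; first by [].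
  by rewrite !mulr_ge0// exprn_ge0// addr_ge0.
have /andP[l0 l1] := eps_exp01 e q.
have l01 : 0 <= val e ^+ q <= 1 by rewrite l1 ltW.
have Db : 0 <= D * val e `^ b by rewrite mulr_ge0// powR_ge0.
have := HC _ _ A A' m k _ (sv e) l01 Db AA (HD e ee).
apply: seminorm_le_mono => //; rewrite powRD; last by rewrite (lt0r_neq0 (eps_gt0 e)) implybT.
rewrite powR_mulrn; last exact/ltW/eps_gt0.
by rewrite le_eqVlt; apply/orP; left; apply/eqP; ring.
Qed.

Lemma schwartz_blur rho l f : test_function rho -> cintegral rho = 1 -> 0 <= l <= 1 ->
  schwartz f -> schwartz (blur rho l f).
Proof.
move=> tr_ rho1 l01 /schwartzP[sf Hf]; have [r [C [r0 C0 HC]]] := blur_seminorm tr_ rho1.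
have sb := (blur_smooth l tr_ sf).1.
apply/schwartzP; split=> // m k; have [M M0 HM] := Hf m.+1 k.
have H := HC f l setT setT m k M sf l01 M0 (fun _ _ _ _ => Logic.I) HM.
have /andP[l0 _] := l01.
exists (C * (1 + r) ^+ k * (l * M) + M) => [|s y sm _].
  by rewrite addr_ge0// !mulr_ge0// exprn_ge0// addr_ge0.
have := lerD (H s y sm Logic.I) (HM s y (leqW sm) Logic.I).
rewrite -mulrDr (cderivB s sb sf); apply: le_trans.
rewrite ler_wpM2l ?(ltW (weightX_gt0 _ _))//.
by have := le_normcD (cderiv s (blur rho l f) y - cderiv s f y) (cderiv s f y); rewrite subrK.
Qed.

Lemma netO_blur rho q v A A' m k b r : (forall e, smooth (v e)) ->
  test_function rho -> A `<=` A' ->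
  netO A' m.+1 k v b -> netO A m k (blur_net rho q v - v) (b + q%:R) ->
  netO A m k (blur_net rho q v) b.
Proof.
move=> sv tr_ AA Hv He.
have sb := blur_net_smooth q tr_ sv.
have sd e : smooth ((blur_net rho q v - v) e) by exact: smoothB (sb e) (sv e).
rewrite -(subrK v (blur_net rho q v)); apply: (netOD sd sv).
  by apply: netO_mono He; rewrite ?lerDl.
by apply: netO_mono Hv => //; exact: leqnSn.
Qed.

Lemma bf_net V A j k N eta C u Te b : 0 < eta -> (forall e, V (u e)) ->
  (forall e : I, val e <= eta ->
    bounded_functional V A j k (C * val e `^ (- N%:R)) (Te e)) ->
  netO A j k u b -> Oeps (snorm (fun e => Te e (u e))) (b - N%:R).
Proof.
move=> eta0 Vu bT [D [eta' [eta0' D0 H]]].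
exists (C * D), (Num.min eta eta'); split; first by rewrite lt_min eta0.
move=> e; rewrite le_min => /andP[ee ee']; rewrite /snorm lee_fin.
rewrite powRD; last by rewrite (lt0r_neq0 (eps_gt0 e)) implybT.
have -> : C * D * (val e `^ b * val e `^ (- N%:R)) = C * val e `^ (- N%:R) * (D * val e `^ b) by ring.
apply: (bf_bound (bT e ee) (Vu e) _ (H e ee')).
by rewrite mulr_ge0// powR_ge0.
Qed.

End NetEstimates.

(** * Independence of the representatives *)

Section ConvolutionNets.
Context {R : realType} {n : nat}.
Local Notation Rn := 'rV[R]_n.
Local Notation fct := (Rn -> R[i]).
Local Notation I := (eps01 R).
Implicit Types (u v w c : net R n) (Te : I -> fct -> R[i]) (rho f : fct) (x y z : Rn) (s t : seq 'I_n)
  (A K : set Rn) (V : set fct) (j k m N q : nat) (b C M r eta : R).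

(** Only small parameters are considered, since a basic net on [G] controls supports only below its
    threshold. *)
Definition supported r eta v : Prop :=
  forall e : I, val e <= eta -> forall x, r < `|x| -> v e x = 0.

Lemma supportedB r eta u v : supported r eta u -> supported r eta v -> supported r eta (u - v).
Proof.
move=> ur vr e ee x rx; rewrite (_ : (u - v) e x = u e x - v e x)//.
by rewrite (ur e ee x rx) (vr e ee x rx) subr0.
Qed.

Lemma supported_mono r r' eta eta' v : r <= r' -> eta' <= eta -> supported r eta v -> supported r' eta' v.
Proof. by move=> rr ee vr e He x rx; apply: vr; [exact: le_trans ee|exact: le_lt_trans rx]. Qed.

Lemma smooth_netB u v : (forall e, smooth (u e)) -> (forall e, smooth (v e)) ->
  forall e, smooth ((u - v) e).
Proof. by move=> su sv e; exact: smoothB (su e) (sv e). Qed.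

Lemma G_negligible_moderate u : G_negligible u -> G_moderate u.
Proof.
move=> /G_negligibleP[su H]; apply/G_moderateP; split=> // r m.
by exists 0%N; apply: netO_mono (H r m 0%N) => //; rewrite oppr0.
Qed.

Lemma G_moderateB u v : G_moderate u -> G_negligible (u - v) -> G_moderate v.
Proof.
move=> mu /G_negligible_moderate nuv.
have [sd _] := nuv; have [su _] := mu.
have sv e : smooth (v e).
  have := smoothB (su e) (sd e).
  by congr smooth; apply/funext => x; rewrite !fctE opprB addrC subrK.
move: mu nuv => /G_moderateP[_ Hu] /G_moderateP[_ Hd]; apply/G_moderateP; split=> // r m.
have [N HN] := Hu r m; have [M HM] := Hd r m; exists (maxn N M).
have -> : v = u - (u - v) by rewrite opprB addrC subrK.
apply: (netOB su sd).
  by apply: netO_mono HN => //; rewrite lerN2 ler_nat leq_maxl.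
by apply: netO_mono HM => //; rewrite lerN2 ler_nat leq_maxr.
Qed.

Lemma G_negligibleN u v : G_negligible (u - v) -> G_negligible (v - u).
Proof.
move=> [sd H]; rewrite -[v - u]opprB.
have -> : - (u - v) = net_scale (-1) (u - v).
  by apply/funext => e; apply/funext => x; rewrite /net_scale !fctE mulN1r.
apply: (@ns_negligibleZ _ _ (G_space R n)) => //.
by apply: smoderateN; exact: smoderate1.
Qed.

Lemma G_negligibleD u v : G_negligible u -> G_negligible v -> G_negligible (u + v).
Proof. exact: (@ns_negligibleD _ _ (G_space R n) u v). Qed.

Lemma cwlip_supported u v r eta e : (forall e, smooth (u e)) -> (forall e, smooth (v e)) ->
  supported r eta v -> val e <= eta -> exists M, cwlip M (fun x => u e x * v e x).
Proof.
move=> su sv vr ee.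
have [P P0 HP] := test_bounded_lip (sv e) (vr e ee) 0; have := HP [::] (leqnn _).
rewrite cderiv0 => Bv; have [Q _ HQ] := bounded_lip_prod r (smooth_loc_lipschitz (su e)).
by exists (Q * P); exact: HQ.
Qed.

Lemma cintegralB M M' (F H : fct) : cwlip M F -> cwlip M' H ->
  cintegral (fun x => F x - H x) = cintegral F - cintegral H.
Proof.
move=> MF MH; rewrite -[RHS]addrC -mulN1r -(cintegral_lin _ MH MF).
by congr cintegral; apply/funext => x; rewrite mulN1r addrC.
Qed.

Lemma integral_netBl u u' v r eta e : (forall e, smooth (u e)) -> (forall e, smooth (u' e)) ->
  (forall e, smooth (v e)) -> supported r eta v -> val e <= eta ->
  integral_net (u - u') v e = integral_net u v e - integral_net u' v e.
Proof.
move=> su su' sv vr ee.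
have [M HM] := cwlip_supported su sv vr ee; have [M' HM'] := cwlip_supported su' sv vr ee.
rewrite /integral_net -(cintegralB HM HM').
by congr cintegral; apply/funext => x; rewrite !fctE mulrBl.
Qed.

Lemma integral_netBr u v v' r eta e : (forall e, smooth (u e)) -> (forall e, smooth (v e)) ->
  (forall e, smooth (v' e)) -> supported r eta v -> supported r eta v' -> val e <= eta ->
  integral_net u (v - v') e = integral_net u v e - integral_net u v' e.
Proof.
move=> su sv sv' vr vr' ee.
have [M HM] := cwlip_supported su sv vr ee; have [M' HM'] := cwlip_supported su sv' vr' ee.
rewrite /integral_net -(cintegralB HM HM').
by congr cintegral; apply/funext => x; rewrite !fctE mulrBr.
Qed.

Lemma snegligible_eventually (y z : snet R) eta : 0 < eta ->
  (forall e : I, val e <= eta -> y e = z e) -> snegligible y -> snegligible z.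
Proof.
move=> eta0 yz Hy q; have [C [eta' [eta0' H]]] := Hy q.
exists C, (Num.min eta eta'); split; first by rewrite lt_min eta0.
by move=> e; rewrite le_min => /andP[ee /H]; rewrite /snorm yz.
Qed.

Lemma snegligibleD (y z : snet R) : snegligible y -> snegligible z -> snegligible (y + z).
Proof. by move=> Hy Hz q; exact: snormD. Qed.

Lemma pairing_negligible_l u v r eta : 0 < eta -> G_negligible u -> G_moderate v ->
  supported r eta v -> snegligible (integral_net u v).
Proof.
move=> eta0 /G_negligibleP[su Hu] /G_moderateP[sv Hv] vr q.
have [N HN] := Hv r 0%N.
have -> : q%:R = (q + N)%:R + - N%:R :> R by rewrite natrD addrK.
by apply: (@pairing_compact _ _ u v r) => //; exists eta.
Qed.

Lemma pairing_negligible_r u v r eta : 0 < eta -> G_moderate u -> G_negligible v ->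
  supported r eta v -> snegligible (integral_net u v).
Proof.
move=> eta0 /G_moderateP[su Hu] /G_negligibleP[sv Hv] vr q.
have [N HN] := Hu r 0%N.
have -> : q%:R = - N%:R + (N + q)%:R :> R by rewrite natrD addKr.
by apply: (@pairing_compact _ _ u v r) => //; exists eta.
Qed.

(** The difference splits as the integral of (u - u') v + u' (v - v'), where each product has a
    negligible factor. *)
Lemma pairing_negligible u u' v v' r eta : 0 < eta -> G_moderate u' -> G_moderate v ->
  G_negligible (u - u') -> G_negligible (v - v') -> supported r eta v -> supported r eta v' ->
  snegligible (integral_net u v - integral_net u' v').
Proof.
move=> eta0 mu' mv nu nv vr vr'.
have mv' := G_moderateB mv nv.
have mu : G_moderate u by apply: G_moderateB mu' _; exact: G_negligibleN.
have Hl := pairing_negligible_l eta0 nu mv vr.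
have Hr := pairing_negligible_r eta0 mu' nv (supportedB vr vr').
apply: snegligible_eventually eta0 _ (snegligibleD Hl Hr) => e ee.
rewrite !fctE (integral_netBl mu.1 mu'.1 mv.1 vr ee) (integral_netBr mu'.1 mv.1 mv'.1 vr vr' ee).
by rewrite addrA subrK.
Qed.

Lemma integral_netC u v : integral_net u v = integral_net v u.
Proof.
by apply/funext => e; congr cintegral; apply/funext => x; rewrite mulrC.
Qed.

Lemma conv_netB V Te u u' : (forall e, linear_on V (Te e)) ->
  (forall e x, V (tr x (u e))) -> (forall e x, V (tr x (u' e))) ->
  conv_net (u - u') Te = conv_net u Te - conv_net u' Te.
Proof.
move=> lT Vu Vu'; apply/funext => e; apply/funext => x.
rewrite !fctE -[RHS]addrC -mulN1r /conv_net -(lT e (-1) _ _ (Vu' e x) (Vu e x)).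
by congr (Te e); apply/funext => y; rewrite mulN1r addrC.
Qed.

(** Radius, order and loss [N] are chosen before the exponent [b], so that the same estimate
    preserves both moderateness and negligibility. *)
Definition conv_estimate u c : Prop := forall r m, exists r' m' N, forall b,
  netO (cball r') m' 0 u b -> netO (cball r) m 0 c (b - N%:R).

Lemma conv_estimate_moderate u c : (forall e, smooth (c e)) -> conv_estimate u c ->
  G_moderate u -> G_moderate c.
Proof.
move=> sc H /G_moderateP[_ Hu]; apply/G_moderateP; split=> // r m.
have [r' [m' [N HN]]] := H r m; have [M HM] := Hu r' m'; exists (M + N)%N.
by rewrite natrD opprD; exact: HN.
Qed.

Lemma conv_estimate_negligible u c : (forall e, smooth (c e)) -> conv_estimate u c ->
  G_negligible u -> G_negligible c.
Proof.
move=> sc H /G_negligibleP[_ Hu]; apply/G_negligibleP; split=> // r m q.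
have [r' [m' [N HN]]] := H r m.
have -> : q%:R = (q + N)%:R - N%:R :> R by rewrite natrD addrK.
exact: HN.
Qed.

Lemma conv_estimate_G Te u : basic_net_G Te -> (forall e, smooth (u e)) ->
  conv_estimate u (conv_net u Te).
Proof.
move=> bT su r m; have [r0 [j [N [eta [r0_ eta0 HT]]]]] := basic_G_bounded bT.
exists (r + r0), (j + m)%N, N => b Hb.
have cT e : convolvable (Te e) (u e) by exact: convolvable_compact (bT.1 e) (su e).
apply: (netO_conv_cball eta0 su cT HT _ Hb) => e s x _.
exact: smooth_tr (smooth_cderiv s (su e)).
Qed.

Lemma test_function_tr r f s x r' : smooth f -> (forall y, r < `|y| -> f y = 0) ->
  `|x| <= r' -> test_function_in (cball (r' + r)) (tr x (cderiv s f)).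
Proof.
move=> sf fr xr; split; first exact: smooth_tr (smooth_cderiv s sf).
apply/fsupport_cball => y ry; apply: (cderiv_support s fr).
rewrite -(ltrD2l r'); apply: (lt_le_trans ry).
rewrite -[y in `|y|](subKr x) (le_trans (ler_normB _ _))// lerD2r.
exact: xr.
Qed.

Lemma supported_test u r : (forall e, smooth (u e)) -> (forall e x, r < `|x| -> u e x = 0) ->
  forall e, test_function (u e).
Proof.
by move=> su ur e; apply: (@test_function_in_test _ _ r); split; [exact: su|exact/fsupport_cball/ur].
Qed.

Lemma conv_estimate_Gc Te u r : basic_net_Gc Te -> (forall e, smooth (u e)) ->
  (forall e x, r < `|x| -> u e x = 0) -> conv_estimate u (conv_net u Te).
Proof.
move=> bT su ur r' m.
have [j [N [eta [eta0 HT]]]] := @basic_Gc_bounded _ _ Te (r' + r) bT.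
exists (r' + (r' + r)), (j + m)%N, N => b Hb.
have cT e : convolvable (Te e) (u e).
  exact: convolvable_distribution (bT.1 e) (supported_test su ur e).
apply: (netO_conv_cball eta0 su cT HT _ Hb) => e s x xr.
exact: (test_function_tr s (su e) (ur e)).
Qed.

End ConvolutionNets.

(** * Generalized functions with compact support *)

Section CompactSupport.
Context {R : realType} {n : nat}.
Local Notation Rn := 'rV[R]_n.
Local Notation fct := (Rn -> R[i]).
Local Notation I := (eps01 R).
Implicit Types (u v w : net R n) (U : G R n) (V : Gc R n) (f rho : fct) (x y z : Rn) (s t : seq 'I_n)
  (A K : set Rn) (j k m N q : nat) (a b C M r eta : R).

Lemma gsupport_cls u r eta : 0 < eta -> G_moderate u -> supported r eta u ->
  gsupport (cls (G_space R n) u) `<=` cball r.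
Proof.
move=> eta0 mu ur x Hx; apply: contrapT => /negP; rewrite -ltNge => rx.
apply: (Hx (~` cball r)).
- by apply: closed_openC; exact: cball_closed.
- by move=> /=; apply/negP; rewrite -ltNge.
apply: vanishes_on_pi => K a cK Kr q; rewrite (insubd_mnet (S := G_space R n) mu).
apply: netO_sup_on; exists 0, eta; split=> // e ee s y _ Ky.
rewrite mul0r (cderiv_support s (ur e ee)) ?normc0 ?mulr0//.
by have /negP := Kr y Ky; rewrite -ltNge.
Qed.

Lemma val_Gc_cls u r eta : 0 < eta -> G_moderate u -> supported r eta u ->
  val (Gc_cls u) = cls (G_space R n) u.
Proof.
move=> eta0 mu ur; apply: insubdK; apply/asboolP.
apply: (subclosed_compact _ (cball_compact r)); last exact: gsupport_cls ur.
exact: gsupport_closed.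
Qed.

Lemma Gc_clsP u r : G_moderate u -> (forall e x, r < `|x| -> u e x = 0) ->
  Gc_represents u (Gc_cls u).
Proof.
move=> mu ur; split; last first.
  by exists (cball r); [exact: cball_compact|move=> e; exact/fsupport_cball/ur].
have ur1 : supported r 1 u by move=> e _ x; exact: ur.
by split; [exact: mu|rewrite (val_Gc_cls ltr01 mu ur1)].
Qed.

Lemma Gc_represents_supported v V : Gc_represents v V ->
  exists2 r, 0 <= r & forall e x, r < `|x| -> v e x = 0.
Proof.
move=> [_ [K cK Kv]]; have [r r0 Kr] := compact_cball cK; exists r => // e x.
exact/(iffLR (fsupport_cball _ _))/(subset_trans (Kv e)).
Qed.

(** Each point off the support has a ball on which the net is negligible, with its own constants;
    compactness of [K] makes them uniform. In the covering argument [M] tends to infinity and stands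
    for the constant as well as for the inverse of the threshold. *)
Lemma netO_vanishing U K m q : compact K -> K `&` gsupport U `<=` set0 ->
  netO K m 0 (val (repr U)) q%:R.
Proof.
move=> cK KU; have su : forall e, smooth (val (repr U) e) by case: (moderateP (repr U)).
have [|s _|M M0 HM] := @netO_words R n (fun=> q%:R) K m 0 (val (repr U)).
- by [].
- have /compact_near_coveringP/(_ R (pinfty_nbhs R)
    (fun M x => forall e : I, val e <= M^-1 ->
       normc (cderiv s (val (repr U) e) x) <= M * val e `^ q%:R) _) := cK.
  move=> /(_ _)[x Kx|M0 [_ HM]].
    have /existsNP[V /not_implyP[oV /not_implyP[Vx /contrapT UV]]] : ~ gsupport U x.
      by move=> Ux; apply: (KU x).
    have [d Hd] : exists d : {posnum R}, closed_ball x d%:num `<=` V.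
      by apply/nbhs_closedballP; exact: open_nbhs_nbhs.
    have cB : compact (closed_ball x d%:num).
      apply: (subclosed_compact _ (cball_compact (`|x| + d%:num))).
        exact: closed_ball_closed.
      rewrite closed_ballE// => y /= xy; rewrite /cball /=.
      by rewrite -[y](subKr x) (le_trans (ler_normB _ _))// lerD2l.
    have [C [eta [eta0 C0 H]]] := sup_on_netO su (UV _ (word_index s) cB Hd q).
    exists (ball x d%:num, [set M | Num.max C eta^-1 < M]).
      split=> /=; first exact: nbhsx_ballx.
      by exists (Num.max C eta^-1); split=> //; exact: num_real.
    move=> [y M] [xy CeM] e ee; have /andP[CM eM] : (C < M) && (eta^-1 < M).
      by rewrite -gt_max.
    have iM : 0 < eta^-1 by rewrite invr_gt0.
    rewrite (cderiv_partial s (su e)); apply: (le_trans (H e _ y _)).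
    + apply: (le_trans ee); rewrite -[leRHS]invrK lef_pV2 ?posrE ?ltW//.
      exact: lt_trans eM.
    + exact: subset_closed_ball.
    + by rewrite ler_wpM2r ?powR_ge0// ltW.
  pose M : R := Num.max 1 (M0 + 1).
  have M1 : 0 < M by rewrite lt_max ltr01.
  exists M, M^-1, 0; split=> [||//|e ee x Kx]; [by rewrite invr_gt0|exact: ltW|].
  rewrite expr0 mul1r; apply: HM => //.
  by rewrite lt_max; apply/orP; right; rewrite ltrDl.
exact: HM.
Qed.

(** [b] depends on [a] only: all elements with support in the ball of radius [a] get representatives
    supported in one ball, without loss in their estimates. *)
Lemma Gc_representative rho (a : R) : test_function rho -> cintegral rho = 1 -> 0 <= a ->
  exists2 b, 0 <= b & forall V, gsupport (val V) `<=` cball a -> exists v,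
    [/\ Gc_represents v V, forall e x, b < `|x| -> v e x = 0 &
      forall m c, netO (cball b) m 0 (val (repr (val V))) c -> netO setT m 0 v c].
Proof.
move=> tr_ rho1 a0; have a2 : 0 <= a + 2 by rewrite addr_ge0.
have [chi [b ab [schi chi1 chi0]]] := exists_cutoff tr_ rho1 a2.
exists b => [|V Va]; first exact: le_trans ab.
set u := val (repr (val V)); have mu : G_moderate u := moderateP (repr (val V)).
have [su _] := mu.
pose v : net R n := fun e x => (chi x)%:C * u e x.
have sv e : smooth (v e) by exact: (smooth_cutoff schi (su e)).1.
have vb e x : b < `|x| -> v e x = 0.
  by move=> /chi0 E; rewrite /v E mul0r.
have vO A m c r : A `<=` cball r -> netO A m 0 u c -> netO A m 0 v c.
  move=> Ar [D [eta [eta0 D0 HD]]]; have [C C0 HC] := cutoff_bound m r schi.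
  exists (C * D), eta; split=> [//||e ee s x sm Ax]; first exact: mulr_ge0.
  rewrite expr0 mul1r -mulrA; apply: (HC _ _ (su e)) => //.
  - by rewrite mulr_ge0// powR_ge0.
  - exact: Ar.
  by move=> t tm; have := HD e ee t x tm Ax; rewrite expr0 mul1r.
have local e s x : `|x| < a + 2 -> cderiv s (v e) x = cderiv s (u e) x.
  move=> xa; apply: (@cderiv_local _ _ _ _ _ _ (a + 2 - `|x|)); first by rewrite subr_gt0.
  move=> y xy; rewrite /v chi1 ?mul1r//.
  rewrite -[y](subKr x) (le_trans (ler_normB _ _))// -lerBrDl.
  exact: ltW.
have nuv : G_negligible (v - u).
  apply/G_negligibleP; split=> [|r m q]; first exact: smooth_netB.
  (* Beyond radius a + 1 the net [u] is negligible on compact sets, and hence so is [v]; below a + 1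
     both have the same derivatives, the cutoff being 1 up to radius a + 2. *)
  pose K : set Rn := cball r `&` [set x | a + 1 <= `|x|].
  have cK : compact K.
    apply: (subclosed_compact _ (cball_compact r)); last by move=> x [].
    apply: closedI; first exact: cball_closed.
    apply: (@preimage_closed _ _ (fun x : Rn => `|x|) [set t | a + 1 <= t]).
    - by move=> x _; exact: norm_continuous.
    - exact: closed_ge.
  have HK : netO K m 0 u q%:R.
    apply: netO_vanishing => // x [[_ /= ax] /Va]; rewrite /cball /= => xa.
    by have := le_trans ax xa; rewrite gerDl ler10.
  have [D [eta [eta0 D0 HD]]] := netOB sv su (vO K m q%:R r (@subIsetl _ _ _) HK) HK.
  exists D, eta; split=> // e ee s x sm xr.
  have [ax|xa] := leP (a + 1) `|x|; first exact: HD.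
  rewrite (cderivB s (sv e) (su e)) local; last by rewrite (lt_trans xa)// ltrD2l ltr1n.
  by rewrite subrr normc0 mulr0 mulr_ge0// powR_ge0.
have mv : G_moderate v by apply: G_moderateB mu _; exact: G_negligibleN.
exists v; split=> //.
- split; last by exists (cball b); [exact: cball_compact|move=> e; exact/fsupport_cball/vb].
  split=> //; rewrite (cls_eq (S := G_space R n) mv mu nuv).
  by rewrite /cls valKd reprK.
move=> m c /(vO _ _ _ b (@subset_refl _ _))[D [eta [eta0 D0 HD]]].
exists D, eta; split=> // e ee s x sm _.
have [xb|bx] := leP `|x| b; first exact: HD.
by rewrite (cderiv_support s (vb e) bx) normc0 mulr0 mulr_ge0// powR_ge0.
Qed.

(** Ensures that the choice in [Gc_repr] does not fall back on its default value 0. *)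
Lemma Gc_reprP rho V : test_function rho -> cintegral rho = 1 -> Gc_represents (Gc_repr V) V.
Proof.
move=> tr_ rho1; have /asboolP cV := valP V.
have [a a0 Va] := compact_cball cV.
have [b _ Hb] := Gc_representative tr_ rho1 a0.
have [v [vV _ _]] := Hb V Va.
exact: (@xgetPex _ 0 [set u | Gc_represents u V] (ex_intro _ v vV)).
Qed.

End CompactSupport.

(** * Functionals on G_c *)

Section CaseGc.
Context {R : realType} {n : nat}.
Local Notation Rn := 'rV[R]_n.
Local Notation fct := (Rn -> R[i]).
Local Notation I := (eps01 R).
Implicit Types (u v w : net R n) (Te : I -> fct -> R[i]) (f rho : fct) (x y z : Rn) (s t : seq 'I_n)
  (A K : set Rn) (j k m N q : nat) (a b C M r eta : R).

Lemma blur_support rho l f r r' : 0 <= l <= 1 -> (forall x, r < `|x| -> rho x = 0) ->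
  (forall x : Rn, r' < `|x| -> f x = 0) -> forall x : Rn, r' + r < `|x| -> blur rho l f x = 0.
Proof.
move=> /andP[l0 l1] rr fr x rx; rewrite /blur -[RHS](@cintegral0 R n); congr cintegral.
apply/funext => z; have [zr|rz] := leP `|z| r; last by rewrite rr// mul0r.
rewrite fr ?mulr0// -(ltrD2r r); apply: (lt_le_trans rx).
rewrite -[x in `|x| <= _](addrK (l *: z)) (le_trans (ler_normB _ _))// lerD2l.
by rewrite normrZ (ger0_norm l0) (le_trans _ zr)// ler_piMl.
Qed.

Lemma mollifier_moderate rho q : test_function rho -> G_moderate (mollifier rho q).
Proof.
move=> tr_; apply/G_moderateP; split=> [e|r m].
  by case: (mollifier_test q e tr_).
have [N HN] := mollifier_netO q m 0 tr_; exists N.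
exact: netO_mono HN.
Qed.

Lemma mollifier_Gc rho q : test_function rho ->
  Gc_represents (mollifier rho q) (Gc_cls (mollifier rho q)).
Proof.
move=> tr_; have /test_functionP[_ [r r0 rr]] := tr_.
by apply: (@Gc_clsP _ _ _ r); [exact: mollifier_moderate|exact: mollifier_support].
Qed.

Lemma conv_Gc_smooth Te u r : basic_net_Gc Te -> (forall e, smooth (u e)) ->
  (forall e x, r < `|x| -> u e x = 0) -> forall e, smooth (conv_net u Te e).
Proof.
move=> bT su ur; apply: (conv_net_smooth su _).1 => e.
exact: convolvable_distribution (bT.1 e) (supported_test su ur e).
Qed.

Lemma conv_Gc_moderate Te u r : basic_net_Gc Te -> G_moderate u ->
  (forall e x, r < `|x| -> u e x = 0) -> G_moderate (conv_net u Te).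
Proof.
move=> bT mu ur; apply: (conv_estimate_moderate _ _ mu); first exact: conv_Gc_smooth bT mu.1 ur.
exact: conv_estimate_Gc bT mu.1 ur.
Qed.

Lemma conv_Gc_negligible Te u u' r : basic_net_Gc Te -> (forall e, smooth (u e)) ->
  (forall e, smooth (u' e)) -> (forall e x, r < `|x| -> u e x = 0) ->
  (forall e x, r < `|x| -> u' e x = 0) -> G_negligible (u - u') ->
  G_negligible (conv_net u Te - conv_net u' Te).
Proof.
move=> bT su su' ur ur' nu.
have tt w (sw : forall e, smooth (w e)) (wr : forall e x, r < `|x| -> w e x = 0) e x :
    test_function (tr x (w e)).
  apply: (@test_function_in_test _ _ (`|x| + r)).
  by have := test_function_tr [::] (sw e) (wr e) (lexx `|x|); rewrite cderiv0.
rewrite -(conv_netB (fun e => (bT.1 e).1) (tt u su ur) (tt u' su' ur')).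
have sd := smooth_netB su su'.
have dr e x : r < `|x| -> (u - u') e x = 0.
  by move=> rx; rewrite !fctE ur// ur'// subrr.
apply: conv_estimate_negligible nu; first exact: conv_Gc_smooth bT sd dr.
exact: conv_estimate_Gc bT sd dr.
Qed.

Lemma pairing_Gc rho q Te v r : test_function rho -> basic_net_Gc Te ->
  (forall e, smooth (v e)) -> (forall e x, r < `|x| -> v e x = 0) ->
  exists2 eta, 0 < eta & forall e : I, val e <= eta ->
    integral_net (conv_net (mollifier rho q) Te) v e = Te e (blur_net rho q v e).
Proof.
move=> tr_ bT sv vr; have /test_functionP[sr [r' r0 rr]] := tr_.
have [j [N [eta [eta0 HT]]]] := @basic_Gc_bounded _ _ Te (r + r') bT.
exists eta => // e ee; have /andP[l0 l1] := eps_exp01 e q.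
have l01 : 0 <= val e ^+ q <= 1 by rewrite l1 ltW.
have [M M0 HM] := pairing_hyp_cball tr_ (eps_exp01 e q) (sv e) (r + r') j.
apply: (conv_pairing (HT e ee) tr_ l0 (sv e) _ _ M0 HM).1.
  split; first exact: blur_net_smooth.
  by apply/fsupport_cball; exact: blur_support l01 rr (vr e).
move=> x vx; have xr : `|x| <= r by rewrite leNgt; apply: contra_neqN vx => /vr.
have := test_function_tr [::] (smooth_dilate (val e ^+ q) sr)
  (dilate_support (eps_exp01 e q) r0 rr) xr.
by rewrite cderiv0.
Qed.

Lemma blur_G_moderate rho q v : test_function rho -> cintegral rho = 1 -> G_moderate v ->
  G_moderate (blur_net rho q v).
Proof.
move=> tr_ rho1 /G_moderateP[sv Hv]; apply/G_moderateP; split=> [|r m].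
  exact: blur_net_smooth.
have [r0 r00 He] := blur_net_error tr_ rho1.
have [N HN] := Hv (r + r0) m.+1; exists N.
apply: (netO_blur (A' := cball (r + r0)) r sv tr_ _ HN).
  by move=> x; rewrite /cball /= => /le_trans; apply; rewrite lerDl.
apply: He HN => // y z; rewrite /cball /= => yr zy.
by rewrite -[z](subrK y) (le_trans (ler_normD _ _))// addrC lerD.
Qed.

Lemma blur_Gc rho q v V : test_function rho -> cintegral rho = 1 -> Gc_represents v V ->
  Gc_represents (blur_net rho q v) (Gc_cls (blur_net rho q v)).
Proof.
move=> tr_ rho1 vV; have [r _ vr] := Gc_represents_supported vV; have [[mv _] _] := vV.
have /test_functionP[_ [r' _ rr]] := tr_.
apply: (@Gc_clsP _ _ _ (r + r')); first exact: blur_G_moderate.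
move=> e; apply: blur_support rr (vr e).
by have /andP[l0 ->] := eps_exp01 e q; rewrite ltW.
Qed.

(** The representatives hidden in [is_conv_Gc], [repr] and [Gc_repr] change the integral by a
    negligible net only. With the mollifier and [v] themselves, the integral is [Te] of the smoothed
    net for small parameters, which represents a value of [T] whatever the net [Te] was. *)
Lemma embed_conv_Gc rho q (T : Gc R n -> Ct R) W v V : test_function rho -> cintegral rho = 1 ->
  is_conv_Gc (Gc_cls (mollifier rho q)) T W -> Gc_represents v V ->
  embed_G W V = T (Gc_cls (blur_net rho q v)).
Proof.
move=> tr_ rho1 [u [Te [uU [bT HT] cW]]] vV.
have [r1 _ vr] := Gc_represents_supported vV.
have vV' := Gc_reprP V tr_ rho1; have [r2 _ vr'] := Gc_represents_supported vV'.
have [r3 _ ur] := Gc_represents_supported uU.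
have mU := mollifier_Gc q tr_; have [r4 _ mr] := Gc_represents_supported mU.
have [[mm _] _] := mU; have [[mu _] _] := uU; have [[mv _] _] := vV; have [[mv' _] _] := vV'.
have ncc : G_negligible (conv_net u Te - conv_net (mollifier rho q) Te).
  apply: (@conv_Gc_negligible Te _ _ (Num.max r3 r4)) => //.
  - exact: mu.1.
  - exact: mm.1.
  - by move=> e x; rewrite gt_max => /andP[/ur].
  - by move=> e x; rewrite gt_max => /andP[_ /mr].
  exact: (represents_negligible uU.1 mU.1).
set c0 := conv_net (mollifier rho q) Te in ncc.
have nwc : G_negligible (val (repr W) - c0).
  have H := represents_negligible (repr_represents W) cW.
  by have := G_negligibleD H ncc; rewrite addrA subrK.
have mc : G_moderate c0 by exact: conv_Gc_moderate bT mm mr.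
have nvv : G_negligible (Gc_repr V - v) by exact: (represents_negligible vV'.1 vV.1).
have nT : snegligible (integral_net (val (repr W)) (Gc_repr V) - integral_net c0 v).
  apply: (@pairing_negligible _ _ _ _ _ _ (Num.max r1 r2) 1) => //.
  - by move=> e _ x; rewrite gt_max => /andP[_ /vr'].
  - by move=> e _ x; rewrite gt_max => /andP[/vr].
have [eta eta0 HE] := pairing_Gc q tr_ bT mv.1 vr.
have [sm E] := HT _ _ (blur_Gc q tr_ rho1 vV).
rewrite -E; apply: (cclsP sm _).2.
by apply: snegligible_eventually eta0 _ nT => e ee; rewrite !fctE (HE e ee).
Qed.

End CaseGc.

(** * Functionals on G *)

Section CaseG.
Context {R : realType} {n : nat}.
Local Notation Rn := 'rV[R]_n.
Local Notation fct := (Rn -> R[i]).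
Local Notation I := (eps01 R).
Implicit Types (u v w : net R n) (Te : I -> fct -> R[i]) (f rho : fct) (x y z : Rn) (s t : seq 'I_n)
  (A K : set Rn) (j k m N q : nat) (a b C M r eta : R).

Lemma conv_G_smooth Te u : basic_net_G Te -> (forall e, smooth (u e)) ->
  forall e, smooth (conv_net u Te e).
Proof.
move=> bT su; apply: (conv_net_smooth su _).1 => e.
exact: convolvable_compact (bT.1 e) (su e).
Qed.

Lemma conv_G_moderate Te u : basic_net_G Te -> G_moderate u -> G_moderate (conv_net u Te).
Proof.
move=> bT mu; apply: (conv_estimate_moderate _ _ mu); first exact: conv_G_smooth bT mu.1.
exact: conv_estimate_G bT mu.1.
Qed.

Lemma conv_G_negligible Te u u' : basic_net_G Te -> (forall e, smooth (u e)) ->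
  (forall e, smooth (u' e)) -> G_negligible (u - u') ->
  G_negligible (conv_net u Te - conv_net u' Te).
Proof.
move=> bT su su' nu; have sd := smooth_netB su su'.
rewrite -(conv_netB (fun e => (bT.1 e).1) (fun e x => smooth_tr x (su e))
  (fun e x => smooth_tr x (su' e))).
apply: (conv_estimate_negligible _ _ nu); first exact: conv_G_smooth bT sd.
exact: conv_estimate_G bT sd.
Qed.

(** Far from the origin all derivatives of the translate vanish on the ball that [Te] sees, so the
    seminorm bound applies with value 0. *)
Lemma conv_G_supported Te u r : basic_net_G Te -> (forall e, smooth (u e)) ->
  (forall e x, r < `|x| -> u e x = 0) ->
  exists r' eta, 0 < eta /\ supported r' eta (conv_net u Te).
Proof.
move=> bT su ur; have [r0 [j [N [eta [r00 eta0 HT]]]]] := basic_G_bounded bT.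
exists (r0 + r), eta; split=> // e ee x rx.
have H : normc (Te e (tr x (u e))) <= val e `^ (- N%:R) * 0.
  apply: (bf_bound (HT e ee) (smooth_tr x (su e)) (lexx 0)) => s y _ yr.
  rewrite (normc_cderiv_tr _ _ _ (su e)) (cderiv_support s (ur e)) ?normc0 ?mulr0//.
  rewrite -(ltrD2l r0); apply: (lt_le_trans rx).
  rewrite -[x in `|x| <= _](subrK y) addrC (le_trans (ler_normD _ _))// lerD2r.
  exact: yr.
by apply: eq0_normc; apply/le_anti; rewrite normc_ge0 andbT; rewrite mulr0 in H.
Qed.

Lemma pairing_G rho q Te v : test_function rho -> basic_net_G Te -> (forall e, smooth (v e)) ->
  exists2 eta, 0 < eta & forall e : I, val e <= eta ->
    integral_net v (conv_net (mollifier rho q) Te) e = Te e (blur_net rho q v e).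
Proof.
move=> tr_ bT sv; have /test_functionP[sr [r' r0 rr]] := tr_.
have [r [j [N [eta [_ eta0 HT]]]]] := basic_G_bounded bT.
exists eta => // e ee; have /andP[l0 l1] := eps_exp01 e q.
have [M M0 HM] := pairing_hyp_cball tr_ (eps_exp01 e q) (sv e) r j.
rewrite integral_netC; apply: (conv_pairing (HT e ee) tr_ l0 (sv e) _ _ M0 HM).1.
  exact: blur_net_smooth.
by move=> x _; apply: smooth_tr; exact: smooth_dilate.
Qed.

Lemma represents_cls u : G_moderate u -> represents u (cls (G_space R n) u).
Proof. by split. Qed.

Lemma conv_G_exists rho q Te (T : G R n -> Ct R) : test_function rho -> defines_G Te T ->
  is_conv_G (cls (G_space R n) (mollifier rho q)) T (val (Gc_cls (conv_net (mollifier rho q) Te))).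
Proof.
move=> tr_ dT; have mm := mollifier_moderate q tr_; have [bT _] := dT.
exists (mollifier rho q), Te; split=> //.
have /test_functionP[_ [r r0 rr]] := tr_.
have [r' [eta [eta0 cr]]] := conv_G_supported bT mm.1 (mollifier_support q r0 rr).
have mc := conv_G_moderate bT mm.
by rewrite (val_Gc_cls eta0 mc cr); split.
Qed.

Lemma embed_conv_G rho q (T : G R n -> Ct R) (W : Gc R n) v V :
  test_function rho -> cintegral rho = 1 ->
  is_conv_G (cls (G_space R n) (mollifier rho q)) T (val W) -> represents v V ->
  embed_Gc W V = T (cls (G_space R n) (blur_net rho q v)).
Proof.
move=> tr_ rho1 [u [Te [uU [bT HT] cW]]] vV.
have wW := Gc_reprP W tr_ rho1; have [r1 _ wr] := Gc_represents_supported wW.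
have mm := mollifier_moderate q tr_; have [mu _] := uU; have [mv _] := vV.
have /test_functionP[_ [r r0 rr]] := tr_.
have [r' [eta [eta0 cr]]] := conv_G_supported bT mm.1 (mollifier_support q r0 rr).
have ncc : G_negligible (conv_net u Te - conv_net (mollifier rho q) Te).
  apply: (conv_G_negligible bT mu.1 mm.1).
  exact: (represents_negligible uU (represents_cls mm)).
set c0 := conv_net (mollifier rho q) Te in ncc cr.
have [[mw _] _] := wW.
have nwc : G_negligible (Gc_repr W - c0).
  have H := represents_negligible wW.1 cW.
  by have := G_negligibleD H ncc; rewrite addrA subrK.
have mc : G_moderate c0 by exact: conv_G_moderate bT mm.
have nvv : G_negligible (val (repr V) - v) by exact: (represents_negligible (repr_represents V) vV).
have eta1 : 0 < Num.min 1 eta by rewrite lt_min ltr01.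
have nT : snegligible (integral_net (val (repr V)) (Gc_repr W) - integral_net v c0).
  apply: (@pairing_negligible _ _ _ _ _ _ (Num.max r1 r') _ eta1) => //.
  - by move=> e _ x; rewrite gt_max => /andP[/wr].
  - by apply: supported_mono cr; rewrite ?le_max ?ge_min lexx orbT.
have [eta' eta0' HE] := pairing_G q tr_ bT mv.1.
have mb := blur_G_moderate q tr_ rho1 mv.
have [sm E] := HT _ _ (represents_cls mb).
rewrite -E /embed_Gc integral_netC; apply: (cclsP sm _).2.
by apply: snegligible_eventually eta0' _ nT => e ee; rewrite !fctE (HE e ee).
Qed.

End CaseG.

(** * Functionals on G_S *)

Section CaseGS.
Context {R : realType} {n : nat}.
Local Notation Rn := 'rV[R]_n.
Local Notation fct := (Rn -> R[i]).
Local Notation I := (eps01 R).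
Implicit Types (u v w c : net R n) (Te : I -> fct -> R[i]) (f rho : fct) (x y z : Rn) (s t : seq 'I_n)
  (A K : set Rn) (j k m N q : nat) (a : multi_index n) (b C M r eta : R).

Lemma slow_norm_le N a f M : 0 <= M ->
  (forall x, normc (partial a f x) <= M * (1 + `|x|) ^+ N) -> (slow_norm N a f <= M%:E)%E.
Proof.
move=> M0 H; apply/wsup_le => // x a' _ ->.
rewrite mulrC ler_pdivrMr ?exprn_gt0 ?ltr_wpDr ?enorm_ge0//.
by apply: (le_trans (H x)); rewrite ler_wpM2l// enorm_weight.
Qed.

Lemma conv_slow_norm j m C T f a M : tempered_distribution T ->
  bounded_functional (@schwartz R n) setT j j C T -> schwartz f -> 0 <= M ->
  seminorm_le setT (j + m) j f M -> (mlength a <= m)%N ->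
  (slow_norm j a (fun x => T (tr x f)) <= (C * M)%:E)%E.
Proof.
move=> tT bT Sf M0 HM am; have sf : smooth f by case: Sf.
apply: slow_norm_le => [|x]; first by rewrite mulr_ge0// (bf_ge0 bT).
rewrite partial_cderiv (conv_smooth sf (convolvable_tempered tT Sf)).2.
have := @conv_bound_schwartz _ _ j C T f m M bT Sf M0 HM (word a) x.
by rewrite size_word mulrAC -mulrA => /(_ am).
Qed.

Lemma conv_slowly_increasing T f : tempered_distribution T -> schwartz f ->
  slowly_increasing (fun x => T (tr x f)).
Proof.
move=> tT Sf; have sf : smooth f by case: Sf.
split=> [|a]; first exact: (conv_smooth sf (convolvable_tempered tT Sf)).1.
have [j [C bT]] := bounded_functional_tempered tT; exists j.
have /schwartzP[_ /(_ (j + mlength a)%N j)[M M0 HM]] := Sf.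
exact: le_lt_trans (conv_slow_norm tT bT Sf M0 HM (leqnn _)) (ltry _).
Qed.

(** The growth exponent [j] and the loss [N] are chosen before [b], as [Gt_negligible] demands one
    growth exponent for all powers of the parameter. *)
Lemma conv_GS_slow Te u : basic_net_GS Te -> (forall e, schwartz (u e)) ->
  exists j N, forall a b, netO setT (j + mlength a) j u b ->
    Oeps (fun e => slow_norm j a (conv_net u Te e)) (b - N%:R).
Proof.
move=> bT Su; have [j [N [eta [eta0 HT]]]] := basic_GS_bounded bT.
exists j, N => a b [D [eta' [eta0' D0 HD]]].
exists (n.+1%:R ^+ j * D), (Num.min eta eta'); split; first by rewrite lt_min eta0.
move=> e; rewrite le_min => /andP[ee ee'].
rewrite powRD; last by rewrite (lt0r_neq0 (eps_gt0 e)) implybT.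
have -> : n.+1%:R ^+ j * D * (val e `^ b * val e `^ (- N%:R)) =
  n.+1%:R ^+ j * val e `^ (- N%:R) * (D * val e `^ b) by ring.
apply: (conv_slow_norm (bT.1 e) (HT e ee) (Su e) _ (HD e ee') (leqnn _)).
by rewrite mulr_ge0// powR_ge0.
Qed.

Lemma conv_GS_moderate Te u : basic_net_GS Te -> GS_moderate u -> Gt_moderate (conv_net u Te).
Proof.
move=> bT /GS_moderateP[Su Hu]; split=> [e|a].
  exact: conv_slowly_increasing (bT.1 e) (Su e).
have [j [N H]] := conv_GS_slow bT Su.
(* [Gt_moderate] uses one integer both as growth exponent and as power of the parameter, hence the
   maximum. *)
have [M HM] := Hu (j + mlength a)%N j; exists (maxn j (M + N)).
apply: (slow_Oeps (leq_maxl _ _)).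
apply: (Oeps_negW (leq_maxr _ _)).
by rewrite natrD opprD; exact: H.
Qed.

Lemma conv_GS_negligible Te u u' : basic_net_GS Te -> (forall e, schwartz (u e)) ->
  (forall e, schwartz (u' e)) -> GS_negligible (u - u') ->
  Gt_negligible (conv_net u Te - conv_net u' Te).
Proof.
move=> bT Su Su' /GS_negligibleP[Sd Hd].
rewrite -(conv_netB (fun e => (bT.1 e).1) (fun e x => schwartz_tr x (Su e))
  (fun e x => schwartz_tr x (Su' e))).
split=> [e|a]; first exact: conv_slowly_increasing (bT.1 e) (Sd e).
have [j [N H]] := conv_GS_slow bT Sd; exists j => q.
have -> : q%:R = (q + N)%:R - N%:R :> R by rewrite natrD addrK.
exact: H.
Qed.

Lemma cwlip_slow f g : slowly_increasing f -> schwartz g -> exists M, cwlip M (fun x => f x * g x).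
Proof.
move=> Sf Sg; have [N [P HP]] := slow_weight_lip Sf.
have [Q HQ] := schwartz_weight_lip (N + 2 * n) Sg.
exists (3 * (P * Q)); apply: weight_lip_prod HP HQ => x; last exact: weight_kappa.
by rewrite ltW// weightX_gt0.
Qed.

(** The growth [N] of [u] is fixed before the exponent, so one decay order [N + 2 * n] of [v], with
    one loss [M], compensates it for all [q] and leaves [kappa] to be integrated. *)
Lemma pairing_negligible_GS u v : Gt_negligible u -> GS_moderate v -> snegligible (integral_net u v).
Proof.
move=> [su Hu] /GS_moderateP[Sv Hv] q.
have [N HN] := Hu (word_index [::]).
have [M [D [eD [eD0 D0 HD]]]] := Hv 0%N (N + 2 * n)%N.
have /OepsW[B [eB [eB0 B0 HB]]] := HN (q + M)%N.
exists (2 * (n.+1%:R ^+ N * B * D * (@kappa1_mass R) ^+ n)), (Num.min eB eD); split.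
  by rewrite lt_min eB0.
move=> e; rewrite le_min => /andP[/HB Be /HD De]; rewrite /snorm lee_fin.
have [P HP] := cwlip_slow (su e) (Sv e).
have epos := eps_gt0 e.
have -> : val e `^ q%:R = val e `^ (q + M)%:R * val e `^ (- M%:R).
  rewrite -powRD; last by rewrite (lt0r_neq0 epos) implybT.
  by rewrite natrD addrK.
set p1 := val e `^ _ in Be *; set p2 := val e `^ _ in De *.
have p10 : 0 <= p1 by exact: powR_ge0.
have p20 : 0 <= p2 by exact: powR_ge0.
apply: (@le_trans _ _ (2 * (n.+1%:R ^+ N * (B * p1) * (D * p2) * (@kappa1_mass R) ^+ n))); last first.
  by rewrite le_eqVlt; apply/orP; left; apply/eqP; ring.
apply: (cintegral_bound HP) => x.
move/(wsup_le _ _ _ _ (mulr_ge0 B0 p10)) : Be => /(_ x _ Logic.I erefl).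
have sx := (su e).1.
rewrite -(cderiv_partial [::] sx) cderiv0 mulrC ler_pdivrMr ?exprn_gt0 ?ltr_wpDr ?enorm_ge0// => Be.
have := De [::] x (leqnn _) Logic.I; rewrite cderiv0 => {}De.
have wx := weightX_gt0 x (N + 2 * n).
have Dx : normc (v e x) <= D * p2 / (1 + `|x|) ^+ (N + 2 * n) by rewrite ler_pdivlMr// mulrC.
have Bx : normc (u e x) <= n.+1%:R ^+ N * (B * p1) * (1 + `|x|) ^+ N.
  apply: (le_trans Be); apply: (le_trans (ler_wpM2l _ (weight_enorm x N))); first exact: mulr_ge0.
  by rewrite mulrCA mulrA.
rewrite normcM; apply: (le_trans (ler_pM (normc_ge0 _) (normc_ge0 _) Bx Dx)).
have -> : n.+1%:R ^+ N * (B * p1) * (1 + `|x|) ^+ N * (D * p2 / (1 + `|x|) ^+ (N + 2 * n)) =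
  n.+1%:R ^+ N * (B * p1) * (D * p2) * ((1 + `|x|) ^+ N * (1 + `|x|) ^- (N + 2 * n)) by ring.
by rewrite ler_wpM2l ?weight_kappa// !mulr_ge0// exprn_ge0.
Qed.

Lemma mollifier_GS_moderate rho q : test_function rho -> GS_moderate (mollifier rho q).
Proof.
move=> tr_; apply/GS_moderateP; split=> [e|m k].
  exact: test_function_schwartz (mollifier_test q e tr_).
exact: mollifier_netO.
Qed.

Lemma blur_GS_moderate rho q v : test_function rho -> cintegral rho = 1 -> GS_moderate v ->
  GS_moderate (blur_net rho q v).
Proof.
move=> tr_ rho1 /GS_moderateP[Sv Hv]; apply/GS_moderateP.
have sv e : smooth (v e) by case: (Sv e).
split=> [e|m k].
  apply: schwartz_blur => //.
  by have /andP[l0 ->] := eps_exp01 e q; rewrite ltW.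
have [r0 r00 He] := blur_net_error tr_ rho1.
have [N HN] := Hv m.+1 k; exists N.
apply: (netO_blur (A' := setT) r0 sv tr_ _ HN) => //.
exact: He HN.
Qed.

Lemma pairing_GS rho q Te v : test_function rho -> cintegral rho = 1 -> basic_net_GS Te ->
  (forall e, schwartz (v e)) ->
  exists2 eta, 0 < eta & forall e : I, val e <= eta ->
    integral_net (conv_net (mollifier rho q) Te) v e = Te e (blur_net rho q v e).
Proof.
move=> tr_ rho1 bT Sv; have sr : smooth rho by case: tr_.
have [j [N [eta [eta0 HT]]]] := basic_GS_bounded bT.
exists eta => // e ee; have /andP[l0 l1] := eps_exp01 e q.
have l01 : 0 <= val e ^+ q <= 1 by rewrite l1 ltW.
have [M M0 HM] := pairing_hyp_schwartz tr_ (eps_exp01 e q) (Sv e) j.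
apply: (conv_pairing (HT e ee) tr_ l0 (Sv e).1 _ _ M0 HM).1.
  exact: schwartz_blur.
move=> x _; apply: schwartz_tr.
exact: test_function_schwartz (mollifier_test q e tr_).
Qed.

Lemma conv_GS_exists rho q Te (T : GS R n -> Ct R) : test_function rho -> defines_GS Te T ->
  is_conv_GS (cls (GS_space R n) (mollifier rho q)) T
    (cls (Gt_space R n) (conv_net (mollifier rho q) Te)).
Proof.
move=> tr_ dT; have mm := mollifier_GS_moderate q tr_; have [bT _] := dT.
exists (mollifier rho q), Te; split=> //; split=> //.
exact: conv_GS_moderate.
Qed.

Lemma embed_conv_GS rho q (T : GS R n -> Ct R) (W : Gt R n) V :
  test_function rho -> cintegral rho = 1 ->
  is_conv_GS (cls (GS_space R n) (mollifier rho q)) T W ->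
  embed_Gt W V = T (cls (GS_space R n) (blur_net rho q (val (repr V)))).
Proof.
move=> tr_ rho1 [u [Te [uU [bT HT] cW]]].
have mv : GS_moderate (val (repr V)) := moderateP (repr V).
have mm := mollifier_GS_moderate q tr_; have [mu _] := uU.
have ncc : Gt_negligible (conv_net u Te - conv_net (mollifier rho q) Te).
  apply: (conv_GS_negligible bT mu.1 mm.1).
  by apply: (represents_negligible uU); split.
set c0 := conv_net (mollifier rho q) Te in ncc.
have nwc : Gt_negligible (val (repr W) - c0).
  have H := represents_negligible (repr_represents W) cW.
  by have := @ns_negligibleD _ _ (Gt_space R n) _ _ H ncc; rewrite addrA subrK.
have mc : Gt_moderate c0 by exact: conv_GS_moderate bT mm.
have mw : Gt_moderate (val (repr W)) := moderateP (repr W).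
have nT := pairing_negligible_GS nwc mv.
have [eta eta0 HE] := pairing_GS q tr_ rho1 bT mv.1.
have mb := blur_GS_moderate q tr_ rho1 mv.
have [|sm E] := HT (blur_net rho q (val (repr V))) (cls (GS_space R n) (blur_net rho q (val (repr V)))).
  by split.
rewrite -E; apply: (cclsP sm _).2.
apply: snegligible_eventually eta0 _ nT => e ee.
have [P HP] := cwlip_slow (mw.1 e) (mv.1 e); have [Q HQ] := cwlip_slow (mc.1 e) (mv.1 e).
rewrite !fctE -(HE e ee) /integral_net -(cintegralB HP HQ).
by congr cintegral; apply/funext => x; rewrite !fctE mulrBl.
Qed.

End CaseGS.

(** * Seminorms and bounded sets *)

Section Seminorms.
Context {R : realType} {n : nat}.
Local Notation Rn := 'rV[R]_n.
Local Notation I := (eps01 R).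
Local Open Scope quotient_scope.

Lemma sharp_norm_N1 : sharp_norm (-1 : Ct R) <= 1.
Proof.
have r0 : crepresents (0 : snet R) 0.
  have m0 : smoderate (0 : snet R).
    by exists 0%N, 0, 1; split=> // e _; rewrite mul0r /snorm normc0.
  split=> //; rewrite /ccls -[RHS](raddf0 (\pi_(Ct R))); congr (\pi_(Ct R) _).
  by apply: val_inj; rewrite (insubd_mscal m0) raddf0.
have r1 : crepresents (1 : snet R) 1.
  split; first exact: smoderate1.
  rewrite /ccls -[RHS](rmorph1 (\pi_(Ct R))); congr (\pi_(Ct R) _).
  by apply: val_inj; rewrite (insubd_mscal smoderate1) rmorph1.
have := crepresentsB r0 r1; rewrite !sub0r => H.
rewrite -expR0 -[X in expR X]oppr0; apply: (sharp_norm_le H).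
exists 1, 1; split=> // e _; rewrite /snorm powRr0 mulr1 lee_fin.
by rewrite (_ : (- 1 : snet R) e = - 1)// normcN normc1.
Qed.

Lemma ultra_pseudo_seminormN (M : lmodType (Ct R)) (P : M -> R) u :
  ultra_pseudo_seminorm P -> P (- u) <= P u.
Proof.
move=> [P0 _ PZ _]; rewrite -scaleN1r; apply: (le_trans (PZ _ _)).
by rewrite -[leRHS]mul1r ler_wpM2r// sharp_norm_N1.
Qed.

(** The ultrametric inequality, used from [x] to [y] and back, bounds the difference of [P x] and
    [P y] by [P (y - x)]. *)
Lemma ultra_continuous (M : lmodType (Ct R)) (F : set (M -> R)) (P : M -> R) :
  F P -> ultra_pseudo_seminorm P -> continuous (P : lcspace F -> R).
Proof.
move=> FP uP x U /nbhs_ballP[d /= d0 dU].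
have := lcball_nbhs x FP uP d0; rewrite /nbhs /=.
apply: (@filterS _ _ (nbhs_filter (x : lcspace F))) => y /= yx; apply: dU.
rewrite /ball /=.
have [_ _ _ PD] := uP.
have H1 : P y <= Num.max (P ((y : M) - x)) (P x).
  by have := PD ((y : M) - x) x; rewrite subrK.
have H2 : P x <= Num.max (P ((y : M) - x)) (P y).
  have := PD ((x : M) - y) y; rewrite subrK => /le_trans; apply.
  by rewrite ge_max !le_max -[X in P X]opprB (ultra_pseudo_seminormN _ uP) lexx orbT.
have [P0 _ _ _] := uP; have := P0 x; have := P0 y.
move: H1 H2; rewrite !le_max ltr_norml.
by move=> /orP[] h1 /orP[] h2 py px; apply/andP; split; lra.
Qed.

Lemma lcbounded_seminorm (M : lmodType (Ct R)) (F : set (M -> R)) (B : set M) (P : M -> R) :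
  lcbounded F B -> F P -> ultra_pseudo_seminorm P -> exists c, forall u, B u -> P u <= c.
Proof. by move=> bB FP uP; apply: bB => //; exact: ultra_continuous. Qed.

Variables (S : net_space R n) (w : Rn -> R) (A : set Rn) (D : set (multi_index n)).
Local Notation p := (wsup w A D).
Hypothesis w0 : forall x, 0 <= w x.
Hypothesis sm : forall u, ns_moderate S u -> forall e, smooth (u e).
Hypothesis Hm : forall u, ns_moderate S u -> exists N : nat, Oeps (fun e => p (u e)) (- N%:R).
Hypothesis Hn : forall u, ns_negligible S u -> forall q : nat, Oeps (fun e => p (u e)) q%:R.

Lemma represents_pi (m : mnet S) : represents (val m) (\pi_(Gen S) m).
Proof. by split; [exact: moderateP|rewrite /cls valKd]. Qed.

Lemma wsup_repr u (U : Gen S) b : represents u U -> Oeps (fun e => p (u e)) b ->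
  Oeps (fun e => p (val (repr U) e)) b.
Proof.
move=> uU Hu; have [mu _] := uU.
have nd := represents_negligible (repr_represents U) uU.
have md : ns_moderate S (val (repr U) - u).
  have -> : val (repr U) - u = val (repr U - insubd (0 : mnet S) u).
    by rewrite raddfB /= (insubd_mnet mu).
  exact: moderateP.
have [q bq] : exists q : nat, b <= q%:R by exists (Num.truncn b).+1; rewrite ltW// truncnS_gt.
rewrite -(subrK u (val (repr U))); apply: wsup_OepsD => //; [exact: sm|exact: sm|].
by apply: OepsS bq _; exact: Hn.
Qed.

Lemma net_seminorm_ultra : ultra_pseudo_seminorm (net_seminorm p : Gen S -> R).
Proof.
have mr (U : Gen S) : exists N : nat, Oeps (fun e => p (val (repr U) e)) (- N%:R).
  by apply: Hm; exact: moderateP.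
split=> [U||Z U|U V].
- exact: expval_ge0.
- apply: expval_eq0 => b; apply: (@wsup_repr 0); last exact: wsup_Oeps0.
  have := represents_pi 0; rewrite raddf0 (_ : \pi_(Gen S) 0 = 0)//.
  exact: raddf0.
- have [N HN] := mr U; have [M HM] := smoderateP (repr Z).
  apply: (expval_mul HM HN) => a b Ha Hb.
  have H : represents (net_scale (val (repr Z)) (val (repr U))) (Z *: U).
    exact: (represents_pi (Defs.mscale (repr Z) (repr U))).
  apply: (wsup_repr H).
  by apply: wsup_OepsZ => //; apply: sm; exact: moderateP.
- have [N HN] := mr U; have [M HM] := mr V.
  apply: (expval_max HN HM) => b Hb Hb'.
  have H : represents (val (repr U + repr V)) (U + V).
    rewrite -[in U + V](reprK U) -[in _ + V](reprK V) -(raddfD (\pi_(Gen S))).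
    exact: represents_pi.
  apply: (wsup_repr H); rewrite raddfD.
  by apply: wsup_OepsD => //; apply: sm; exact: moderateP.
Qed.

Lemma net_seminorm_uniform (B : set (Gen S)) c : (forall U, B U -> net_seminorm p U <= c) ->
  exists b, forall U, B U -> Oeps (fun e => p (val (repr U) e)) b.
Proof.
move=> HB; have c1 : 0 < Num.max c 1 by rewrite lt_max ltr01 orbT.
(* The maximum with 1 makes the argument of the logarithm positive; the subtracted 1 gives the
   strict inequality that [Oeps_expval] requires. *)
exists (- ln (Num.max c 1) - 1) => U BU.
have [N HN] := Hm (moderateP (repr U)).
apply: (Oeps_expval HN _ c1); last by rewrite gtrDl ltrN10.
by apply: (le_trans (HB U BU)); rewrite le_max lexx.
Qed.

End Seminorms.

(** * Continuous seminorms on the inductive limit *)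

Section GcSeminorms.
Context {R : realType} {n : nat}.
Local Notation Rn := 'rV[R]_n.
Local Notation I := (eps01 R).
Implicit Types (U V : Gc R n) (A K L : set Rn) (k m : nat) (r b : R).

Lemma G_seminorm_moderate A k r (u : net R n) : A `<=` cball r -> G_moderate u ->
  exists N : nat, Oeps (fun e => sup_upto A k (u e)) (- N%:R).
Proof.
move=> Ar /G_moderateP[su Hu]; have [N HN] := Hu r k; exists N.
by apply/(netO_sup_upto A k _ su); apply: netO_mono HN.
Qed.

Lemma G_seminorm_negligible A k r (u : net R n) : A `<=` cball r -> G_negligible u ->
  forall q : nat, Oeps (fun e => sup_upto A k (u e)) q%:R.
Proof.
move=> Ar /G_negligibleP[su Hu] q.
by apply/(netO_sup_upto A k _ su); apply: netO_mono (Hu r k q).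
Qed.

Lemma G_seminorm_ultra A k : compact A ->
  ultra_pseudo_seminorm (net_seminorm (sup_upto A k) : G R n -> R).
Proof.
move=> /compact_cball[r r0 Ar].
apply: (@net_seminorm_ultra _ _ (G_space R n) (fun=> 1) A (upto k)).
- by move=> x; exact: ler01.
- by move=> u [].
- by move=> u; exact: G_seminorm_moderate Ar.
- by move=> u; exact: G_seminorm_negligible Ar.
Qed.

Definition Gc_seminorm A k U : R := net_seminorm (sup_upto A k) (val U).

Lemma Gc_seminorm_ultra A k : compact A -> ultra_pseudo_seminorm (Gc_seminorm A k).
Proof.
move=> /(G_seminorm_ultra k)[P0 P00 PZ PD]; split=> [U||Z U|U V].
- exact: P0.
- by rewrite /Gc_seminorm raddf0.
- by rewrite /Gc_seminorm linearZ; exact: PZ.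
- by rewrite /Gc_seminorm raddfD; exact: PD.
Qed.

Lemma netO_setU A A' m k (u : net R n) b : netO A m k u b -> netO A' m k u b ->
  netO (A `|` A') m k u b.
Proof.
move=> [C [eta [eta0 C0 H]]] [C' [eta' [eta0' C0' H']]].
exists (C + C'), (Num.min eta eta'); split=> [||e].
- by rewrite lt_min eta0.
- exact: addr_ge0.
rewrite le_min => /andP[/H Hu /H' Hv] s x sm.
rewrite mulrDl; case=> Ax; [apply: (le_trans (Hu s x sm Ax))|apply: (le_trans (Hv s x sm Ax))].
  by rewrite lerDl mulr_ge0// powR_ge0.
by rewrite lerDr mulr_ge0// powR_ge0.
Qed.

(** The part of [L] outside the interior of [K'] is compact and disjoint from the support, so the
    net is negligible there; the rest of [L] lies in [K']. *)
Lemma GK_dominated K K' L U k k' : K `<=` K'° -> compact K' -> compact L -> GK K U ->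
  (k <= k')%N -> Gc_seminorm L k U <= Gc_seminorm K' k' U.
Proof.
move=> KK' cK' cL UK kk.
have [r r0 K'r] := compact_cball cK'.
have mU : G_moderate (val (repr (val U))) := moderateP (repr (val U)).
have su := mU.1; have [N HN] := G_seminorm_moderate k' K'r mU.
rewrite -[leRHS]maxxx; apply: (expval_max HN HN) => b /(netO_sup_upto _ _ _ su) Hb _.
apply/(netO_sup_upto _ _ _ su).
pose L' := L `&` ~` K'°.
have cL' : compact L'.
  apply: (subclosed_compact _ cL); last by move=> x [].
  apply: closedI; first exact: compact_closed.
  by apply: open_closedC; exact: open_interior.
have [q bq] : exists q : nat, b <= q%:R by exists (Num.truncn b).+1; rewrite ltW// truncnS_gt.
have HL : netO L' k 0 (val (repr (val U))) b.
  apply: netO_mono bq (netO_vanishing k q cL' _) => //.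
  by move=> x [[_ nx] /UK/KK'].
have HK : netO K' k 0 (val (repr (val U))) b by apply: netO_mono Hb.
apply: netO_mono (netO_setU HL HK) => // x Lx.
have [Kx|nKx] := pselect (K'° x); last by left.
by right; exact: interior_subset.
Qed.

Lemma GKB K U V : GK K U -> GK K V -> GK K (U - V).
Proof.
move=> UK VK x; have -> : val (U - V) = val U + (-1) *: val V by rewrite raddfB scaleN1r.
by move=> /gsupportD[/UK//|/gsupportZ/VK].
Qed.

(** A criterion for continuity on the inductive limit: on each [GK K] the seminorm is dominated by
    one of those defining the topology of this subspace. *)
Lemma dominated_inductive (P : Gc R n -> R) : ultra_pseudo_seminorm P ->
  (forall K K', compact K -> compact K' -> K `<=` K'° -> exists k c,
    forall U, GK K U -> P U <= c * Gc_seminorm K' k U) ->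
  inductive_family [set P].
Proof.
move=> uP HP; split=> [_ ->//|K K' cK cK' KK' x U [B [oB Bx BU]]].
have [D [d [fD DF d0 HD]]] := oB x Bx.
suff H : nbhs (x : subspace (GK K : set (lcspace (GK_family K'))))
    [set y | P ((y : Gc R n) - (x : Gc R n)) < d].
  apply: filterS H => y /= Hy; apply: BU; apply: HD => Q /DF ->; exact: Hy.
change (@nbhs_subspace (lcspace (GK_family K')) (GK K) x [set y | P (y - x) < d]).
(* The subspace topology isolates the points outside [GK K], where only [P 0 < d] is left to
   check. *)
have [Kx|Kx] := pselect (GK K x); last first.
  rewrite -(@nbhs_subspace_out (lcspace (GK_family K')) _ _ Kx) => _ ->.
  by rewrite /= subrr; case: uP => _ ->.
rewrite -(@nbhs_subspace_in (lcspace (GK_family K')) _ _ Kx).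
have [k [c Hc]] := HP K K' cK cK' KK'.
have c1 : 0 < Num.max c 1 by rewrite lt_max ltr01 orbT.
have := @lcball_nbhs R _ (GK_family K') (Gc_seminorm K' k) x (d / Num.max c 1) _
  (Gc_seminorm_ultra k cK') (divr_gt0 d0 c1).
move=> /(_ (ex_intro _ k erefl)).
apply: (@filterS _ _ (nbhs_filter (x : lcspace (GK_family K')))) => y /= yx Ky.
have Kyx : GK K ((y : Gc R n) - x) by exact: GKB.
apply: (le_lt_trans (Hc _ Kyx)).
have [Q0 _ _ _] := Gc_seminorm_ultra k cK'.
apply: (@le_lt_trans _ _ (Num.max c 1 * Gc_seminorm K' k ((y : Gc R n) - x))).
  by rewrite ler_wpM2r// le_max lexx.
by rewrite mulrC -ltr_pdivlMr.
Qed.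

Lemma Gc_bounded_seminorm (B : set (Gc R n)) (P : Gc R n -> R) :
  lcbounded (@Gc_family R n) B -> ultra_pseudo_seminorm P ->
  (forall K K', compact K -> compact K' -> K `<=` K'° -> exists k c,
    forall U, GK K U -> P U <= c * Gc_seminorm K' k U) ->
  exists c, forall U, B U -> P U <= c.
Proof.
move=> bB uP HP; apply: (lcbounded_seminorm bB) => //.
by exists [set P]; [exact: dominated_inductive|].
Qed.

Lemma sup_ultra (M : lmodType (Ct R)) (Q : nat -> M -> R) :
  (forall m, ultra_pseudo_seminorm (Q m)) -> (forall u, exists b, forall m, Q m u <= b) ->
  exists P : M -> R, [/\ ultra_pseudo_seminorm P, forall m u, Q m u <= P u &
    forall u b, (forall m, Q m u <= b) -> P u <= b].
Proof.
move=> uQ HQ; pose P u := sup (range (fun m => Q m u)).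
have QP m u : Q m u <= P u.
  apply: ub_le_sup; last by exists m.
  by have [b Hb] := HQ u; exists b => _ [k _ <-].
have Pb u b : (forall m, Q m u <= b) -> P u <= b.
  by move=> Hb; apply: ge_sup => [|_ [k _ <-]//]; exists (Q 0%N u), 0%N.
exists P; split=> //; have P0 u : 0 <= P u.
  by apply: le_trans (QP 0%N u); case: (uQ 0%N).
split=> // [|Z u|u v].
- by apply: le_anti; rewrite P0 andbT; apply: Pb => m; case: (uQ m) => _ ->.
- apply: Pb => m; have [_ _ QZ _] := uQ m; apply: (le_trans (QZ Z u)).
  by rewrite ler_wpM2l// expval_ge0.
- apply: Pb => m; have [_ _ _ QD] := uQ m; apply: (le_trans (QD u v)).
  by rewrite ge_max !le_max !QP orbT.
Qed.

Lemma ultraZ (M : lmodType (Ct R)) (P : M -> R) (c : R) : 0 <= c -> ultra_pseudo_seminorm P ->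
  ultra_pseudo_seminorm (fun u => c * P u).
Proof.
move=> c0 [P0 P00 PZ PD]; split=> [u||Z u|u v].
- exact: mulr_ge0.
- by rewrite P00 mulr0.
- by rewrite mulrCA ler_wpM2l.
- by rewrite -maxr_pMr// ler_wpM2l.
Qed.

End GcSeminorms.

(** * Bounded sets *)

Section GcBounded.
Context {R : realType} {n : nat}.
Local Notation Rn := 'rV[R]_n.
Local Notation I := (eps01 R).
Implicit Types (U V : Gc R n) (A K L : set Rn) (k m : nat) (a r b : R).

Lemma Gc_seminorm_vanishing L k U : compact L -> L `&` gsupport (val U) `<=` set0 ->
  Gc_seminorm L k U = 0.
Proof.
move=> cL LU; apply: expval_eq0 => b.
have su : forall e, smooth (val (repr (val U)) e) by case: (moderateP (repr (val U))).
have [q bq] : exists q : nat, b <= q%:R by exists (Num.truncn b).+1; rewrite ltW// truncnS_gt.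
apply: (OepsS bq); apply/(netO_sup_upto _ _ _ su); exact: netO_vanishing.
Qed.

Lemma Gc_seminorm_detects U r : ~ (gsupport (val U) `<=` cball r) ->
  exists L k, [/\ compact L, forall x, L x -> r < `|x| & 0 < Gc_seminorm L k U].
Proof.
move=> /existsNP[x /not_implyP[Ux rx]].
have oV : open (~` cball r : set Rn) by apply: closed_openC; exact: cball_closed.
have /existsNP[L /existsNP[a /not_implyP[cL /not_implyP[Lr /existsNP[q Hq]]]]] := Ux _ oV rx.
exists L, (mlength a); split=> [//|y /Lr /negP|].
  by rewrite -ltNge.
have [P0 _ _ _] := Gc_seminorm_ultra (mlength a) cL.
rewrite lt_neqAle P0 andbT eq_sym; apply/negP => /eqP H0; apply: Hq.
have mU : G_moderate (val (repr (val U))) := moderateP (repr (val U)).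
have [r' r0 Lr'] := compact_cball cL.
have [N HN] := G_seminorm_moderate (mlength a) Lr' mU.
apply: netO_sup_on; apply/(netO_sup_upto _ _ _ mU.1).
(* A vanishing seminorm lies below every positive [c]; for this one, - ln c = q + 1 exceeds [q]. *)
apply: (Oeps_expval HN (c := expR (- q%:R - 1))).
- by rewrite [leLHS]H0 expR_ge0.
- exact: expR_gt0.
- by rewrite expRK opprD !opprK ltrDl.
Qed.

(* A weighted supremum of seminorms that see, far away, one element of [B] each
   is locally a finite supremum, hence continuous, but unbounded on [B]. *)
Lemma Gc_bounded_support (B : set (Gc R n)) : lcbounded (@Gc_family R n) B ->
  exists2 a, 0 <= a & forall U, B U -> gsupport (val U) `<=` cball a.
Proof.
move=> bB; apply: contrapT => nB.
have H m : exists z : Gc R n * (set Rn * nat), [/\ B z.1, compact z.2.1,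
    forall x, z.2.1 x -> m%:R < `|x| & 0 < Gc_seminorm z.2.1 z.2.2 z.1].
  apply: contrapT => Hm; apply: nB; exists m%:R => // U BU; apply: contrapT.
  move=> /Gc_seminorm_detects[L [k [cL Lm P0]]].
  by apply: Hm; exists (U, (L, k)).
have {H} [z Hz] := choice H.
pose L m := (z m).2.1; pose k m := (z m).2.2.
(* Normalized so that [Q m] takes the value [m] at the [m]-th chosen element of [B]. *)
pose c m : R := m%:R / Gc_seminorm (L m) (k m) (z m).1.
have c0 m : 0 <= c m by case: (Hz m) => _ _ _ P0; rewrite divr_ge0// ltW.
pose Q m U := c m * Gc_seminorm (L m) (k m) U.
have uQ m : ultra_pseudo_seminorm (Q m).
  by apply: ultraZ => //; apply: Gc_seminorm_ultra; case: (Hz m).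
have Q0 m U : 0 <= Q m U by case: (uQ m).
(* An element with compact support is seen by finitely many of the [Q m] only. *)
have far m r U : gsupport (val U) `<=` cball r -> r <= m%:R -> Q m U = 0.
  move=> Ur rm; rewrite /Q Gc_seminorm_vanishing ?mulr0//; first by case: (Hz m).
  move=> x [Lx /Ur xr]; have [_ _ /(_ x Lx) mx _] := Hz m.
  by have := lt_le_trans mx (le_trans xr rm); rewrite ltxx.
have nat_ge r : exists M : nat, r <= M%:R by exists (Num.truncn r).+1; rewrite ltW// truncnS_gt.
have [U|P [uP QP Pb]] := sup_ultra uQ.
  have /asboolP/compact_cball[r r0 Ur] := valP U; have [M rM] := nat_ge r.
  exists (\sum_(m < M) Q m U) => m; have [mM|Mm] := ltnP m M.
    by rewrite (bigD1 (Ordinal mM))//= lerDl sumr_ge0.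
  by rewrite (far m r)// ?sumr_ge0// (le_trans rM)// ler_nat.
have [|C HC] := Gc_bounded_seminorm bB uP; last first.
  have [M CM] := nat_ge (C + 1); have [BM _ _ P0] := Hz M.
  have := le_trans (QP M _) (HC _ BM); rewrite /Q /c divfK ?gt_eqF// => MC.
  by have := le_trans CM MC; rewrite gerDl ler10.
move=> K K' cK cK' KK'; have [r r0 Kr] := compact_cball cK; have [M rM] := nat_ge r.
(* The sums bound all orders and coefficients with m < M, the only ones that matter on [GK K]. *)
exists (\sum_(m < M) k m)%N, (\sum_(m < M) c m) => U UK; apply: Pb => m.
have [S0 _ _ _] := Gc_seminorm_ultra (\sum_(m < M) k m) cK'.
have [mM|Mm] := ltnP m M; last first.
  rewrite (far m r)//; [by rewrite mulr_ge0// sumr_ge0|exact: subset_trans Kr|].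
  by rewrite (le_trans rM)// ler_nat.
apply: ler_pM => //.
- by have [_ cL _ _] := Hz m; have [] := Gc_seminorm_ultra (k m) cL.
- by rewrite (bigD1 (Ordinal mM))//= lerDl sumr_ge0.
- apply: (GK_dominated KK') => //; first by case: (Hz m).
  by rewrite (bigD1 (Ordinal mM))//= leq_addr.
Qed.

Lemma Gc_bounded_netO (B : set (Gc R n)) r m : lcbounded (@Gc_family R n) B ->
  exists b, forall U, B U -> netO (cball r) m 0 (val (repr (val U))) b.
Proof.
move=> bB; have cr := @cball_compact R n r.
have [|C HC] := Gc_bounded_seminorm bB (Gc_seminorm_ultra m cr).
  move=> K K' cK cK' KK'; exists m, 1 => U UK; rewrite mul1r.
  exact: (GK_dominated KK' cK' cr UK).
have [||b Hb] := @net_seminorm_uniform _ _ (G_space R n) (fun=> 1) (cball r) (upto m) _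
    (val @` B) C.
- by move=> u; exact: G_seminorm_moderate (@subset_refl _ _).
- by move=> _ [U BU <-]; exact: HC.
exists b => U BU; have su : forall e, smooth (val (repr (val U)) e).
  by case: (moderateP (repr (val U))).
by apply/(netO_sup_upto _ _ _ su); apply: Hb; exists U.
Qed.

Lemma G_bounded_netO (B : set (G R n)) r m : lcbounded (@G_family R n) B ->
  exists b, forall U : G R n, B U -> netO (cball r) m 0 (val (repr U)) b.
Proof.
move=> bB; have cr := @cball_compact R n r.
have [|C HC] := lcbounded_seminorm bB _ (G_seminorm_ultra m cr).
  by exists (cball r), m.
have [|b Hb] := @net_seminorm_uniform _ _ (G_space R n) (fun=> 1) (cball r) (upto m) _ B C HC.
  by move=> u; exact: G_seminorm_moderate (@subset_refl _ _).
exists b => U BU; have su : forall e, smooth (val (repr U) e).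
  by case: (moderateP (repr U)).
by apply/(netO_sup_upto _ _ _ su); exact: Hb.
Qed.

Lemma GS_seminorm_ultra k :
  ultra_pseudo_seminorm (net_seminorm (schwartz_norm k) : GS R n -> R).
Proof.
apply: (@net_seminorm_ultra _ _ (GS_space R n) (fun x => (1 + enorm x) ^+ k) setT (upto k)).
- exact: schwartz_weight_ge0.
- by move=> u [su _] e; case: (su e).
- by move=> u [_ H]; exact: H.
- by move=> u [_ H]; exact: H.
Qed.

Lemma GS_bounded_netO (B : set (GS R n)) m k : lcbounded (@GS_family R n) B ->
  exists b, forall U : GS R n, B U -> netO setT m k (val (repr U)) b.
Proof.
move=> bB; pose j := maxn m k.
have [|C HC] := lcbounded_seminorm bB _ (GS_seminorm_ultra j); first by exists j.
have [|b Hb] := @net_seminorm_uniform _ _ (GS_space R n) (fun x => (1 + enorm x) ^+ j) setT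
    (upto j) _ B C HC.
  by move=> u [_ H]; exact: H.
exists b => U BU; have su : forall e, smooth (val (repr U) e).
  by move=> e; have [/(_ e)[]] := moderateP (repr U).
have /(netO_schwartz _ _ su) := Hb U BU.
by apply: netO_mono => //; [exact: leq_maxl|exact: leq_maxr].
Qed.

End GcBounded.

(** * Convergence *)

Section Convergence.
Context {R : realType} {n : nat}.
Local Notation Rn := 'rV[R]_n.
Local Notation fct := (Rn -> R[i]).
Local Notation I := (eps01 R).
Implicit Types (Te : I -> fct -> R[i]) (rho : fct) (j N q : nat) (b eta : R).

(** On each bounded set the error is dominated by a geometric sequence of ratio exp(-1). *)
Lemma dual_cvg_rate (M : lmodType (Ct R)) (F : set (M -> R)) (S : nat -> M -> Ct R) (T : M -> Ct R) :
  (forall B, lcbounded F B -> exists b, forall q u, B u ->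
     sharp_norm (S q u - T u) <= expR (- (b + q%:R))) -> dual_cvg F S T.
Proof.
move=> H B /H[b Hb].
apply: (@squeeze_cvge _ _ _ _ (fun=> 0%E) _ (fun q => (geometric (expR (- b)) (expR (-1)) q)%:E)).
- apply: nearW => q; apply/andP; split; first by apply: ereal_sup_ubound; left.
  apply: ge_ereal_sup => _ [->|[u Bu ->]]; rewrite lee_fin /geometric /=.
    by rewrite mulr_ge0 ?exprn_ge0// expR_ge0.
  apply: (le_trans (Hb q u Bu)); rewrite opprD expRD -expRM_natl.
  by rewrite mulrN1.
- exact: cvg_cst.
- apply: cvg_EFin; first by apply: nearW.
  by apply: cvg_geometric; rewrite ger0_norm ?expR_ge0// expR_lt1 ltrN10.
Qed.

Lemma linear_onB (V : set fct) (t : fct -> R[i]) f g : linear_on V t -> V f -> V g ->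
  t (fun x => f x - g x) = t f - t g.
Proof.
move=> lt Vf Vg; rewrite -[RHS]addrC -mulN1r -(lt _ _ _ Vg Vf).
by congr t; apply/funext => x; rewrite mulN1r addrC.
Qed.

(* Since [T] of the smoothed element is computed by the same net [Te] as [T]
   of the element itself, only [Te] of their difference has to be estimated. *)
Lemma sharp_norm_rate (V V' : set fct) (A : set Rn) Te j k N eta C (v w : net R n) (Y Z : Ct R) b :
  0 < eta -> (forall e, linear_on V' (Te e)) ->
  (forall e, V' (v e)) -> (forall e, V' (w e)) ->
  (forall e : I, val e <= eta ->
    bounded_functional V A j k (C * val e `^ (- N%:R)) (Te e)) ->
  (forall e, V ((w - v) e)) -> netO A j k (w - v) b ->
  crepresents (fun e => Te e (w e)) Y -> crepresents (fun e => Te e (v e)) Z ->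
  sharp_norm (Y - Z) <= expR (- (b - N%:R)).
Proof.
move=> eta0 lT Vv Vw bT Vd Hd HY HZ; apply: (sharp_norm_le (crepresentsB HY HZ)).
have := bf_net eta0 Vd bT Hd; congr Oeps; congr snorm; apply/funext => e.
exact: (linear_onB (lT e) (Vw e) (Vv e)).
Qed.

Variables (rho : fct) (rho_test : test_function rho) (rho1 : cintegral rho = 1).

Lemma conv_Gc_cvg (T : Gc R n -> Ct R) (W : nat -> G R n) : basic_Gc T ->
  (forall q, is_conv_Gc (Gc_cls (mollifier rho q)) T (W q)) ->
  dual_cvg (@Gc_family R n) (fun q => embed_G (W q)) T.
Proof.
move=> [Te [bT HT]] cW; apply: dual_cvg_rate => B bB.
have [a a0 Ba] := Gc_bounded_support bB.
have [b b0 Hrep] := Gc_representative rho_test rho1 a0.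
have /test_functionP[_ [r r0 rr]] := rho_test.
have [r' r0' He] := blur_net_error rho_test rho1.
have [j [N [eta [eta0 HTe]]]] := @basic_Gc_bounded _ _ Te (b + r) bT.
have [c Hc] := Gc_bounded_netO b j.+1 bB.
(* [c] comes from [B] and [N] from the fixed net [Te]; neither depends on [q] or [V]. *)
exists (c - N%:R) => q V BV.
have [v [vV vb Hv]] := Hrep V (Ba V BV).
have [[mv _] _] := vV; have sv := mv.1.
have sb := blur_net_smooth q rho_test sv.
have bb e x : b + r < `|x| -> blur_net rho q v e x = 0.
  apply: blur_support rr (vb e) x; have /andP[l0 ->] := eps_exp01 e q.
  by rewrite ltW.
have vb' e x : b + r < `|x| -> v e x = 0.
  by move=> bx; apply: vb; apply: le_lt_trans bx; rewrite lerDl.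
(* The net hidden in [cW q] may vary with [q]; after this rewriting only [T] occurs, and the fixed
   [Te] computes both of its values. *)
rewrite (embed_conv_Gc rho_test rho1 (cW q) vV) addrAC.
apply: (@sharp_norm_rate (test_function_in (cball (b + r))) (@test_function R n) (cball (b + r))
  Te j 0 N eta 1 v (blur_net rho q v)) => //.
- by move=> e; case: (bT.1 e).
- exact: supported_test sv vb'.
- exact: supported_test sb bb.
- by move=> e ee; rewrite mul1r; exact: HTe.
- move=> e; split; first exact: smoothB (sb e) (sv e).
  by apply/fsupport_cball => x bx; rewrite !fctE bb// vb'// subrr.
- by apply: (He _ setT) => //; apply: Hv; exact: Hc.
- by apply: HT; exact: blur_Gc vV.
- exact: HT.
Qed.

Lemma conv_G_cvg (T : G R n -> Ct R) (W : nat -> Gc R n) : basic_G T ->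
  (forall q, is_conv_G (cls (G_space R n) (mollifier rho q)) T (val (W q))) ->
  dual_cvg (@G_family R n) (fun q => embed_Gc (W q)) T.
Proof.
move=> [Te [bT HT]] cW; apply: dual_cvg_rate => B bB.
have [r' r0' He] := blur_net_error rho_test rho1.
have [r [j [N [eta [r0 eta0 HTe]]]]] := basic_G_bounded bT.
(* Smoothing looks at most r' beyond the ball that [Te] sees and loses one derivative. *)
have [c Hc] := G_bounded_netO (r + r') j.+1 bB.
exists (c - N%:R) => q V BV.
have vV := repr_represents V; set v := val (repr V) in vV *; have [mv _] := vV; have sv := mv.1.
have sb := blur_net_smooth q rho_test sv.
rewrite (embed_conv_G rho_test rho1 (cW q) vV) addrAC.
apply: (@sharp_norm_rate (@smooth R n) (@smooth R n) (cball r) Te j 0 N eta 1 v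
  (blur_net rho q v)) => //.
- by move=> e; case: (bT.1 e).
- by move=> e ee; rewrite mul1r; exact: HTe.
- exact: smooth_netB.
- apply: (He _ (cball (r + r'))) => //; last exact: Hc.
  move=> y z; rewrite /cball /= => yr zy.
  by rewrite -[z](subrK y) (le_trans (ler_normD _ _))// addrC lerD.
- by apply: HT; apply: represents_cls; exact: blur_G_moderate.
- exact: HT.
Qed.

Lemma conv_GS_cvg (T : GS R n -> Ct R) (W : nat -> Gt R n) : basic_GS T ->
  (forall q, is_conv_GS (cls (GS_space R n) (mollifier rho q)) T (W q)) ->
  dual_cvg (@GS_family R n) (fun q => embed_Gt (W q)) T.
Proof.
move=> [Te [bT HT]] cW; apply: dual_cvg_rate => B bB.
have [r' r0' He] := blur_net_error rho_test rho1.
have [j [N [eta [eta0 HTe]]]] := basic_GS_bounded bT.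
have [c Hc] := GS_bounded_netO j.+1 j bB.
exists (c - N%:R) => q V BV.
have vV := repr_represents V; set v := val (repr V) in vV *; have [mv _] := vV.
have Sv : forall e, schwartz (v e) := mv.1.
have mb := blur_GS_moderate q rho_test rho1 mv.
have Sb : forall e, schwartz (blur_net rho q v e) := mb.1.
rewrite (embed_conv_GS _ rho_test rho1 (cW q)) addrAC -/v.
apply: (@sharp_norm_rate (@schwartz R n) (@schwartz R n) setT Te j j N eta (n.+1%:R ^+ j) v
  (blur_net rho q v)) => //.
- by move=> e; case: (bT.1 e).
- move=> e; have := schwartzD (Sb e) (schwartzZ (-1) (Sv e)).
  by congr schwartz; apply/funext => x; rewrite !fctE mulN1r.
- apply: (He _ setT) => //; last exact: Hc.
  by move=> e; case: (Sv e).
- by apply: HT; split.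
- exact: HT.
Qed.

End Convergence.

Theorem theorem1p18 (R : realType) (n : nat) (rho : 'rV[R]_n -> R[i])
    (rho_test : test_function rho) (rho_int : cintegral rho = 1) :
  [/\ forall T : {linear Gc R n -> Ct R | *%R},
        lccontinuous (@Gc_family R n) T -> basic_Gc T ->
        (forall q, exists W : G R n,
           is_conv_Gc (Gc_cls (mollifier rho q)) T W) /\
        (forall W : nat -> G R n,
           (forall q, is_conv_Gc (Gc_cls (mollifier rho q)) T (W q)) ->
           dual_cvg (@Gc_family R n) (fun q => embed_G (W q)) T),
      forall T : {linear G R n -> Ct R | *%R},
        lccontinuous (@G_family R n) T -> basic_G T ->
        (forall q, exists W : Gc R n,
           is_conv_G (cls (G_space R n) (mollifier rho q)) T (val W)) /\
        (forall W : nat -> Gc R n,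
           (forall q,
              is_conv_G (cls (G_space R n) (mollifier rho q)) T (val (W q))) ->
           dual_cvg (@G_family R n) (fun q => embed_Gc (W q)) T) &
      forall T : {linear GS R n -> Ct R | *%R},
        lccontinuous (@GS_family R n) T -> basic_GS T ->
        (forall q, exists W : Gt R n,
           is_conv_GS (cls (GS_space R n) (mollifier rho q)) T W) /\
        (forall W : nat -> Gt R n,
           (forall q,
              is_conv_GS (cls (GS_space R n) (mollifier rho q)) T (W q)) ->
           dual_cvg (@GS_family R n) (fun q => embed_Gt (W q)) T)].
Proof.
split=> T _ bT.
- split=> [q|W]; last exact: conv_Gc_cvg.
  have [Te dT] := bT; have mU := mollifier_Gc q rho_test.
  have [r _ mr] := Gc_represents_supported mU; have [[mm _] _] := mU.
  exists (cls (G_space R n) (conv_net (mollifier rho q) Te)), (mollifier rho q), Te.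
  split=> //; apply: represents_cls; exact: conv_Gc_moderate dT.1 mm mr.
- split=> [q|W]; last exact: conv_G_cvg.
  have [Te dT] := bT; exists (Gc_cls (conv_net (mollifier rho q) Te)).
  exact: conv_G_exists.
- split=> [q|W]; last exact: conv_GS_cvg.
  have [Te dT] := bT; exists (cls (Gt_space R n) (conv_net (mollifier rho q) Te)).
  exact: conv_GS_exists.
Qed.
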